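(* Let $\lambda>0$ and $f\in C_b(X)$, and let $u=R(\lambda,L)f$ be the unique solution in $D(L)$ of $\lambda u-Lu=f$. Then $u$ is $H$-differentiable at every point, and $\nabla_Hu\in Z_H(X,H)$. Moreover, there exists $C>0$, independent of $f$, such that $$\|\nabla_Hu\|_{Z_H(X,H)}\le C\|f\|_\infty .$$
   Context: Let $X$ be a separable real Banach space endowed with a centered Gaussian measure $\gamma$. Let $H\subset X$ be the associated Cameron–Martin space, with norm $\|\cdot\|_H$. $C_b(X)$ is the space of bounded continuous functions $X\to\mathbb R$, with norm $\|f\|_\infty=\sup_X|f|$. The Ornstein–Uhlenbeck semigroup is $$T(t)f(x)=\int_X f\big(e^{-t}x+\sqrt{1-e^{-2t}}\,y\big)\,\gamma(dy),\qquad t\ge0,\ f\in C_b(X).$$ $L$ is the unique linear operator on $C_b(X)$ with resolvent $$R(\lambda,L)f(x)=\int_0^\infty e^{-\lambda t}T(t)f(x)\,dt\quad\text{for all }\lambda>0 .$$ A function $f:X\to\mathbb R$ is $H$-differentiable at $x$ if there is $\nabla_Hf(x)\in H$ with $|f(x+h)-f(x)-\langle\nabla_Hf(x),h\rangle_H|/\|h\|_H\to0$ as $\|h\|_H\to0$. For a Banach space $Y$, $Z_H(X,Y)$ is the set of bounded continuous $F:X\to Y$ such that $$[F]_{Z_H}:=\sup_{x\in X,\ h\in H\setminus\{0\}}\frac{\|F(x+2h)-2F(x+h)+F(x)\|_Y}{\|h\|_H}<\infty .$$ Its norm is $\|F\|_{Z_H(X,Y)}=\sup_x\|F(x)\|_Y+[F]_{Z_H}$.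 *)

(* Defs.v *)
From HB Require Import structures.
From mathcomp Require Import all_boot all_order all_algebra.
From mathcomp Require Import all_classical all_reals all_analysis.
Set Implicit Arguments. Unset Strict Implicit. Unset Printing Implicit Defensive.
Import Order.TTheory GRing.Theory Num.Theory.
Import numFieldNormedType.Exports.
Local Open Scope classical_set_scope.
Local Open Scope ring_scope.

Definition borel (R : realType) (X : normedModType R) :=
  g_sigma_algebraType (@open X).

Definition separable_space (R : realType) (X : normedModType R) : Prop :=
  exists D : set X, countable D /\ closure D = setT.

Definition dual_elt (R : realType) (X : normedModType R) (l : X -> R) : Prop :=
  (forall (a : R) (x y : X), l (a *: x + y) = a * l x + l y) /\ continuous l.

Definition centered_gaussian (R : realType) (X : normedModType R)
  (gamma : probability (borel X) R) : Prop :=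
  forall l : X -> R, dual_elt l ->
    exists s : R, 0 <= s /\
      forall A : set R, measurable A ->
        gamma (l @^-1` A) =
          (if s == 0 then \d_(0:R) A else normal_prob 0 s A).

Definition cm_enorm (R : realType) (X : normedModType R)
  (gamma : probability (borel X) R) (h : X) : \bar R :=
  ereal_sup [set ((l h)%:E) | l in
     [set l : X -> R | dual_elt l /\
        (\int[gamma]_(y in setT) ((l y) ^+ 2)%:E <= 1)%E]].

Definition in_CM (R : realType) (X : normedModType R)
  (gamma : probability (borel X) R) (h : X) : Prop :=
  (cm_enorm gamma h < +oo)%E.

Definition hnorm (R : realType) (X : normedModType R)
  (gamma : probability (borel X) R) (h : X) : R := fine (cm_enorm gamma h).

(* inner product of H, obtained from its (Hilbert) norm by polarization *)
Definition hinner (R : realType) (X : normedModType R)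
  (gamma : probability (borel X) R) (g h : X) : R :=
  (hnorm gamma (g + h) ^+ 2 - hnorm gamma (g - h) ^+ 2) / 4.

Definition H_gradient_at (R : realType) (X : normedModType R)
  (gamma : probability (borel X) R) (u : X -> R) (x g : X) : Prop :=
  in_CM gamma g /\
  forall eps : R, 0 < eps -> exists delta : R, 0 < delta /\
    forall h : X, in_CM gamma h -> h != 0 -> hnorm gamma h < delta ->
      `|u (x + h) - u x - hinner gamma g h| <= eps * hnorm gamma h.

Definition Cb (R : realType) (X : normedModType R) (f : X -> R) : Prop :=
  continuous f /\ exists M : R, forall x, `|f x| <= M.

Definition sup_norm (R : realType) (X : normedModType R) (f : X -> R) : \bar R :=
  ereal_sup [set (`|f x|)%:E | x in [set: X]].

Definition OU (R : realType) (X : normedModType R)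
  (gamma : probability (borel X) R) (t : R) (f : X -> R) (x : X) : R :=
  fine (\int[gamma]_(y in setT)
          (f (expR (- t) *: x + Num.sqrt (1 - expR (- (2 * t))) *: (y : X)))%:E)%E.

Definition OU_resolvent (R : realType) (X : normedModType R)
  (gamma : probability (borel X) R) (lam : R) (f : X -> R) (x : X) : R :=
  fine (\int[lebesgue_measure]_(t in `[0%R, +oo[)
          (expR (- (lam * t)) * OU gamma t f x)%:E)%E.

Definition ZH_semi (R : realType) (X : normedModType R)
  (gamma : probability (borel X) R) (F : X -> X) : \bar R :=
  ereal_sup [set r : \bar R | exists (x h : X), in_CM gamma h /\ h != 0 /\
     r = ((hnorm gamma (F (x + 2 *: h) - 2 *: F (x + h) + F x)
           / hnorm gamma h)%:E)].

Definition ZH_sup (R : realType) (X : normedModType R)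
  (gamma : probability (borel X) R) (F : X -> X) : \bar R :=
  ereal_sup [set (hnorm gamma (F x))%:E | x in [set: X]].

Definition in_ZH (R : realType) (X : normedModType R)
  (gamma : probability (borel X) R) (F : X -> X) : Prop :=
  (forall x, in_CM gamma (F x)) /\
  (forall x (eps : R), 0 < eps -> exists delta : R, 0 < delta /\
     forall y, `|y - x| < delta -> hnorm gamma (F y - F x) < eps) /\
  (ZH_sup gamma F < +oo)%E /\ (ZH_semi gamma F < +oo)%E.

Definition ZH_norm (R : realType) (X : normedModType R)
  (gamma : probability (borel X) R) (F : X -> X) : \bar R :=
  (ZH_sup gamma F + ZH_semi gamma F)%E.

(* Main.v *)
(* Let R denote the covariance operator, s = sqrt (1 - e^(-2t)) and c = e^(-t) / s <= t^(-1/2).  For h = R l the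
   Cameron-Martin formula turns T(t)f(x + h) into the integral of y |-> f (e^(-t) x + s y) against the density
   exp (c l - c^2 q / 2), where q = E l^2 = |h|_H^2.  Hence the gradient G of u = R(lambda, L)f has to satisfy
   m (G x) = int_0^oo e^(-lambda t) c E[f (e^(-t) x + s .) m] dt for every functional m; the right-hand side is
   bounded in the L^2 norm of m, so that it is represented by a vector of X (Pettis integral), and this vector is in H.
   In L^2 the second difference of the weights m (. - c h) exp (c l - c^2 q / 2) is O(min (1, c^2 |h|^2)) and the
   first-order remainder of the densities is O(c |h| min (1, c |h|)).  Integrating in t bounds the second difference
   of G by a multiple of int_0^oo c min (1, c^2 |h|^2) dt = O(|h|), and the remainder of u by O(|h|^(3/2)).
   Since u and G are continuous, both estimates extend from the range of R to its closure H.

   The Cameron-Martin formula follows from the Laplace-Fourier transforms of the functionals, because a functional on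
   bounded Borel functions that is continuous for bounded pointwise convergence and vanishes on all cos (l + c)
   is zero. *)
Require Import Defs.
From HB Require Import structures.
From mathcomp Require Import all_boot all_order all_algebra.
From mathcomp Require Import all_classical all_reals all_analysis.
From mathcomp Require Import measurable_realfun lebesgue_integral_under normal_distribution.
From mathcomp Require Import ring lra.
Import Order.TTheory GRing.Theory Num.Theory.
Import numFieldNormedType.Exports.
Local Open Scope classical_set_scope.
Local Open Scope ring_scope.
Set Implicit Arguments.
Unset Strict Implicit.

(** [hnorm] is the norm dual to the [L^2] norm on functionals: [g] lies in H with norm at most [C]
    as soon as [m g <= C |m|_2] for every functional [m]. All estimates on the gradient are
    therefore scalar integrals, bounded uniformly in one test functional. The obstacle is that [f]
    is merely bounded and continuous, so all regularity comes from the Gaussian density, and each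
    order of smallness in [h] costs a factor [c], which is of order [t^(-1/2)] near 0. A first
    difference of the gradient would cost the integral of [c min (1, c |h|)], of order
    [|h| log (1 / |h|)]; with [c min (1, c^2 |h|^2)] the part [t > |h|^2] contributes only [O(|h|)].
    Hence a Zygmund bound and not a Lipschitz one. The density contains [l] itself, so exact
    formulas are at hand only for [h = R l]; this is why the estimates are proved on the range of
    [R] before passing to the closure. The exponent 3/2 of the remainder is a convenient choice: any
    power of [|h|] above 1 gives differentiability. *)

Lemma near_infty_ger_succ (R : realType) (r : R) : \forall n \near \oo, r <= n.+1%:R.
Proof.
near=> n; apply: (@le_trans _ _ n%:R); last by rewrite ler_nat.
by near: n; exact: nbhs_infty_ger.
Unshelve. all: by end_near. Qed.

(** * Real-valued integrals *)

Section RealIntegral.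
Context d (T : measurableType d) (R : realType) (mu : {measure set T -> \bar R}).
Variable D : set T.
Hypothesis mD : measurable D.

Lemma Rintegral_dominated_cvg (f_ : nat -> T -> R) (f g : T -> R) :
  (forall n, measurable_fun D (f_ n)) ->
  (forall x, D x -> f_ n x @[n --> \oo] --> f x) ->
  mu.-integrable D (EFin \o g) ->
  (forall n x, D x -> `|f_ n x| <= g x) ->
  \int[mu]_(x in D) f_ n x @[n --> \oo] --> \int[mu]_(x in D) f x.
Proof.
move=> mf cf ig fg.
have mfl : measurable_fun D f by apply: measurable_fun_cvg cf.
have cfE x : D x -> (f_ n x)%:E @[n --> \oo] --> (f x)%:E.
  by move=> Dx; apply: cvg_EFin; [exact: nearW|exact: cf].
have [|||//||i _ c] := @dominated_convergence _ _ _ mu D mD (fun n => EFin \o f_ n)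
  (EFin \o f) (EFin \o g).
- by move=> n; exact/measurable_EFinP.
- exact/measurable_EFinP.
- exact: aeW.
- by apply: aeW => x n Dx; rewrite lee_fin fg.
apply: fine_cvg.
rewrite fineK; last exact: integrable_fin_num.
exact: c.
Qed.

Lemma le_Rintegrable (f g : T -> R) : measurable_fun D f ->
  (forall x, D x -> `|f x| <= g x) -> mu.-integrable D (EFin \o g) ->
  mu.-integrable D (EFin \o f).
Proof.
move=> mf fg; apply: le_integrable => //; first exact/measurable_EFinP.
by move=> x Dx; rewrite /= lee_fin (le_trans (fg x Dx))// ler_norm.
Qed.

Lemma RintegrableZl (r : R) (f : T -> R) : mu.-integrable D (EFin \o f) ->
  mu.-integrable D (EFin \o (fun x => r * f x)).
Proof. exact: integrableZl. Qed.

Lemma RintegrableD (f g : T -> R) : mu.-integrable D (EFin \o f) ->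
  mu.-integrable D (EFin \o g) -> mu.-integrable D (EFin \o (fun x => f x + g x)).
Proof. exact: integrableD. Qed.

Lemma RintegrableB (f g : T -> R) : mu.-integrable D (EFin \o f) ->
  mu.-integrable D (EFin \o g) -> mu.-integrable D (EFin \o (fun x => f x - g x)).
Proof. exact: integrableB. Qed.

End RealIntegral.

Lemma cvg_sqr (R : realType) (u : nat -> R) (a : R) : u n @[n --> \oo] --> a ->
  u n ^+ 2 @[n --> \oo] --> a ^+ 2.
Proof.
move=> ua; rewrite expr2; under eq_fun do rewrite expr2.
exact: cvgM.
Qed.

Lemma near_invS_lt (R : realType) (e : R) : 0 < e -> \forall n \near \oo, n.+1%:R^-1 < e.
Proof. by move=> e0; exact: (near_infty_natSinv_lt (PosNum e0)). Qed.

(** * Hahn-Banach: norming functionals *)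

Section HahnBanach.
Context (R : realType) (X : normedModType R).

(* A subspace of [X * R] lying below the norm is the graph of a functional of norm at most 1. *)
Let dominated_graph (S : set (X * R)) :=
  (forall a p q, S p -> S q -> S (a *: p.1 + q.1, a * p.2 + q.2)) /\
  (forall p, S p -> p.2 <= `|p.1|).

(** The new value [c] must lie above every [p.2 - |p.1 - x0|] and below every [|q.1 + x0| - q.2].
    The triangle inequality separates the two families, and the other multiples of [x0] reduce to
    these by homogeneity. *)
Let graph_extension (S : set (X * R)) (x0 : X) : S !=set0 -> dominated_graph S ->
  exists c, dominated_graph [set p | exists a q, S q /\ p = (q.1 + a *: x0, q.2 + a * c)].
Proof.
move=> [p0 Sp0] [Slin Sdom].
pose A := [set r | exists2 p, S p & r = p.2 - `|p.1 - x0|].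
have key p q : S p -> S q -> p.2 - `|p.1 - x0| <= `|q.1 + x0| - q.2.
  move=> Sp Sq; have := Sdom _ (Slin 1 _ _ Sp Sq); rewrite /= scale1r mul1r.
  have : `|p.1 + q.1| <= `|p.1 - x0| + `|q.1 + x0|.
    by apply: le_trans (ler_normD _ _); rewrite addrACA addNr addr0.
  lra.
have A0 : A !=set0 by exists (p0.2 - `|p0.1 - x0|), p0.
have Aub : has_ubound A.
  by exists (`|p0.1 + x0| - p0.2) => _ [p Sp ->]; exact: key.
exists (sup A).
have Sscale a p : S p -> S (a *: p.1, a * p.2).
  move=> Sp.
  have S0 : S (0, 0).
    have := Slin (-1) _ _ Sp0 Sp0.
    by rewrite scaleN1r mulN1r !addNr.
  by have := Slin a _ _ Sp S0; rewrite !addr0.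
have lo p : S p -> p.2 - sup A <= `|p.1 - x0|.
  move=> Sp; rewrite lerBlDr -lerBlDl.
  by apply: ub_le_sup => //; exists p.
have hi p : S p -> p.2 + sup A <= `|p.1 + x0|.
  move=> Sp; rewrite -lerBrDl; apply: ge_sup => // _ [q Sq ->].
  exact: key.
split.
- move=> a _ _ [b [p [Sp ->]]] [c [q [Sq ->]]] /=.
  exists (a * b + c), (a *: p.1 + q.1, a * p.2 + q.2); split; first exact: Slin.
  rewrite /=; congr pair; last ring.
  by rewrite scalerDr scalerDl addrACA scalerA.
- move=> _ [a [p [Sp ->]]] /=.
  have [a0|a0|->] := ltgtP a 0; last by rewrite scale0r mul0r !addr0; exact: Sdom.
  + have b0 : 0 < - a by rewrite oppr_gt0.
    have := lo _ (Sscale (- a)^-1 _ Sp); rewrite /= -(ler_pM2l b0).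
    rewrite mulrBr mulVKf ?gt_eqF// -{2}(gtr0_norm b0) -normrZ scalerBr scalerA.
    by rewrite divff ?gt_eqF// scale1r scaleNr opprK mulNr opprK.
  + have := hi _ (Sscale a^-1 _ Sp); rewrite /= -(ler_pM2l a0).
    rewrite mulrDr mulVKf ?gt_eqF// -{2}(gtr0_norm a0) -normrZ scalerDr scalerA.
    by rewrite divff ?gt_eqF// scale1r.
Qed.

Theorem norming_functional (z : X) :
  exists m : X -> R, [/\ dual_elt m, forall y, `|m y| <= `|y| & m z = `|z|].
Proof.
pose L := [set p : X * R | exists a, p = (a *: z, a * `|z|)].
have Lgraph : dominated_graph L.
  split.
    move=> a _ _ [b ->] [c ->] /=; exists (a * b + c).
    by rewrite scalerDl scalerA mulrDl mulrA.
  move=> _ [a ->] /=; rewrite normrZ ler_wpM2r//; exact: ler_norm.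
(* Zorn is applied to the sets [A] whose union with [L] is dominated, so that the empty chain has an
   upper bound too. *)
have [S [SL Smax]] : exists A, dominated_graph (A `|` L) /\
    forall B, A `<` B -> ~ dominated_graph (B `|` L).
  apply: Zorn_bigcup => F FP Ftot.
  have [F0|/set0P[A0 FA0]] := eqVneq F set0.
    by rewrite F0 bigcup_set0 set0U.
  split.
    move=> a p q Fp Fq.
    have [A [FA [Ap Aq]]] : exists A, F A /\ (A `|` L) p /\ (A `|` L) q.
      case: Fp => [[A FA Ap]|Lp]; case: Fq => [[B FB Bq]|Lq].
      - have [AB|BA] := Ftot _ _ FA FB.
          by exists B; split=> //; split; left => //; exact: AB.
        by exists A; split=> //; split; left => //; exact: BA.
      - by exists A; split=> //; split; [left|right].
      - by exists B; split=> //; split; [right|left].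
      - by exists A0; split=> //; split; right.
    have [/(_ a _ _ Ap Aq) + _] := FP _ FA.
    by case=> [Aa|]; [left; exists A|right].
  move=> p [[A FA Ap]|Lp].
    by have [_] := FP _ FA; apply; left.
  by case: Lgraph => _; apply.
pose G := S `|` L.
have G0 : G !=set0 by exists (0, 0); right; exists 0; rewrite scale0r mul0r.
have Gmax x0 : exists c, G (x0, c).
  have [c Gc] := graph_extension x0 G0 SL.
  set G' := [set p | _] in Gc.
  have GG' : G `<=` G' by move=> p Gp; exists 0, p; rewrite scale0r mul0r !addr0 -surjective_pairing.
  have LG' : L `<=` G' by move=> p Lp; apply: GG'; right.
  have G'G : G' `<=` S.
    apply: contrapT => nG; apply: (Smax G').
      by split=> // p Sp; apply: GG'; left.
    by rewrite setUidl.
  exists c; left; apply: G'G; exists 1, (0, 0); split.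
    by right; exists 0; rewrite scale0r mul0r.
  by rewrite /= scale1r mul1r !add0r.
have [Glin Gdom] := SL.
(* The difference of two points over [x] is a point over 0, whose second coordinate is at most 0: a
   graph below the norm is single-valued. *)
have Guniq x c d : G (x, c) -> G (x, d) -> c = d.
  suff H c' d' : G (x, c') -> G (x, d') -> d' <= c'.
    by move=> xc xd; apply/le_anti; rewrite !H.
  move=> xc xd; have /Gdom := Glin (-1) _ _ xc xd.
  by rewrite /= scaleN1r addNr normr0 mulN1r addrC subr_le0.
have [m Gm] := choice Gmax.
have mlin a x y : m (a *: x + y) = a * m x + m y.
  apply: (@Guniq (a *: x + y)) => //.
  exact: (Glin a _ _ (Gm x) (Gm y)).
have m0 : m 0 = 0.
  by have := mlin (-1) 0 0; rewrite scaler0 addr0 mulN1r addNr.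
have mN x : m (- x) = - m x.
  by have := mlin (-1) x 0; rewrite !addr0 m0 addr0 scaleN1r mulN1r.
have mle y : `|m y| <= `|y|.
  by rewrite ler_norml lerNl -mN -{1}(normrN y); apply/andP; split; exact: (Gdom _ (Gm _)).
exists m; split=> //.
- split=> // x; apply/cvgrPdist_lt => e e0.
  near=> y.
  rewrite -mN -[m x]mul1r -mlin scale1r.
  apply: le_lt_trans (mle _) _.
  by near: y; apply: cvgr_dist_lt.
- apply: (@Guniq z) => //; right; exists 1; by rewrite scale1r mul1r.
Unshelve. all: by end_near.
Qed.

End HahnBanach.

(** * Characteristic function of the normal density *)

Section NormalDensity.
Context (R : realType).
Local Notation mu := (@lebesgue_measure R).
Variables (m s : R).
Hypothesis s0 : s != 0.
Implicit Types (a c k x : R).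

Let pdfE a x : normal_pdf a s x = normal_peak s * normal_fun a s x.
Proof. by rewrite normal_pdfE. Qed.

Let s2_neq0 : s ^+ 2 *+ 2 != 0.
Proof. by rewrite mulrn_eq0/= expf_neq0. Qed.

(** Completing the square: an exponential weight moves the mean by [a * s ^+ 2]. Together with the
    cosine integral below it yields the mixed Laplace-Fourier transforms. *)
Lemma expR_normal_pdf a x : expR (a * x) * normal_pdf m s x =
  expR (a * m + a ^+ 2 * s ^+ 2 / 2) * normal_pdf (m + a * s ^+ 2) s x.
Proof.
rewrite !pdfE mulrCA [RHS]mulrCA /normal_fun -!expRD; congr (_ * expR _).
by field.
Qed.

Lemma integrable_expR_normal_pdf a :
  mu.-integrable setT (EFin \o (fun x => expR (a * x) * normal_pdf m s x)).
Proof.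
rewrite (_ : _ \o _ = fun x => ((expR (a * m + a ^+ 2 * s ^+ 2 / 2))%:E *
    (normal_pdf (m + a * s ^+ 2) s x)%:E)%E); last first.
  by apply/funext => x /=; rewrite expR_normal_pdf EFinM.
by apply: integrableZl => //; exact: integrable_normal_pdf.
Qed.

Lemma Rintegral_normal_pdf a : \int[mu]_x normal_pdf a s x = 1.
Proof. by rewrite /Rintegral integral_normal_pdf. Qed.

Let p x := normal_pdf m s x.

Let integrable_lin_pdf :
  mu.-integrable setT (EFin \o (fun x => `|x - m| * p x)).
Proof.
have i1 := integrable_expR_normal_pdf 1.
have i2 := integrable_expR_normal_pdf (-1).
have i := integrableD measurableT (integrableZl measurableT (expR (- m)) i1)
  (integrableZl measurableT (expR m) i2).
apply: le_integrable i => //.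
- apply/measurable_EFinP/measurable_funM; last exact: measurable_normal_pdf.
  by apply: measurableT_comp => //; exact: measurable_funB.
- move=> x _ /=.
  rewrite lee_fin normrM normr_id [`|p x|]ger0_norm ?normal_pdf_ge0//.
  rewrite [leRHS]ger0_norm; last first.
    by apply: addr_ge0; rewrite !mulr_ge0 ?expR_ge0 ?normal_pdf_ge0.
  rewrite !mulrA -mulrDl ler_wpM2r ?normal_pdf_ge0// -!expRD mul1r mulN1r.
  have := expR_ge1Dx (- m + x); have := expR_ge1Dx (m - x).
  have := expR_ge0 (- m + x); have := expR_ge0 (m - x).
  by rewrite ler_norml => *; apply/andP; split; lra.
Qed.

Let is_derive_pdf x : is_derive x 1 (p : R -> R^o) (- ((x - m) / s ^+ 2) * p x).
Proof.
have -> : (p : R -> R^o) = (normal_peak s \*: (expR \o (fun y : R => - (y - m) ^+ 2 / (s ^+ 2 *+ 2)))).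
  by apply/funext => y; rewrite /p pdfE.
apply: is_derive_eq.
rewrite /GRing.scale /= -[_ *: expR _]/(normal_peak s * _).
by field.
Qed.

Let trig_pdf_integrable (g : R -> R) : measurable_fun setT g -> (forall x, `|g x| <= 1) ->
  mu.-integrable setT (EFin \o (fun x => g x * p x)).
Proof.
move=> mg g1.
apply: le_integrable (integrable_normal_pdf m s) => //.
  by apply/measurable_EFinP/measurable_funM => //; exact: measurable_normal_pdf.
move=> x _; rewrite lee_fin normrM [`|p x|]ger0_norm ?normal_pdf_ge0//.
by rewrite ler_piMl ?normal_pdf_ge0.
Qed.

Let affine_meas k c : measurable_fun setT (fun x => k * (x - m) + c).
Proof. by apply: measurable_funD => //; apply: measurable_funM => //; exact: measurable_funB. Qed.

Let mcos k c : measurable_fun setT (fun x => cos (k * (x - m) + c)).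
Proof. by apply: measurableT_comp (affine_meas k c); exact: continuous_measurable_fun (@continuous_cos R). Qed.

Let msin k c : measurable_fun setT (fun x => sin (k * (x - m) + c)).
Proof. by apply: measurableT_comp (affine_meas k c); exact: continuous_measurable_fun (@continuous_sin R). Qed.

Let lin_trig_integrable (g : R -> R) : measurable_fun setT g -> (forall x, `|g x| <= 1) ->
  mu.-integrable setT (EFin \o (fun x => (x - m) * g x * p x)).
Proof.
move=> mg g1.
apply: le_integrable integrable_lin_pdf => //.
  apply/measurable_EFinP/measurable_funM; last exact: measurable_normal_pdf.
  by apply: measurable_funM => //; exact: measurable_funB.
move=> x _; rewrite lee_fin !normrM normr_id ler_wpM2r//.
by rewrite ler_piMr.
Qed.

Let s2_gt0 : 0 < s ^+ 2. Proof. by rewrite exprn_even_gt0. Qed.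

(** Since [exp y >= y], the density is at most a constant over [(x - m)^2]; this removes the
    boundary terms of the integration by parts below. *)
Let pdf_small e : 0 < e -> exists A, forall x, A <= `|x| -> p x <= e.
Proof.
move=> e0; set B := normal_peak s * (s ^+ 2 *+ 2) / e.
have B0 : 0 <= B.
  by rewrite /B mulr_ge0 ?invr_ge0 ?(ltW e0)// mulr_ge0 ?normal_peak_ge0 ?mulrn_wge0// ltW.
exists (`|m| + 1 + B) => x xA.
have x1 : 1 + B <= `|x - m| by have := lerB_dist x m; lra.
have x2 : B <= (x - m) ^+ 2.
  rewrite -real_normK ?num_real// expr2; have : `|x - m| <= `|x - m| * `|x - m| by rewrite ler_peMr//; lra.
  lra.
have x3 : 0 < (x - m) ^+ 2 by rewrite exprn_even_gt0//= -normr_gt0; lra.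
have c0 : 0 < s ^+ 2 *+ 2 by rewrite pmulrn_lgt0.
rewrite /p pdfE /normal_fun mulNr expRN.
have y0 : 0 < (x - m) ^+ 2 / (s ^+ 2 *+ 2) by rewrite divr_gt0.
apply: le_trans (_ : normal_peak s * ((x - m) ^+ 2 / (s ^+ 2 *+ 2))^-1 <= _).
  rewrite ler_wpM2l ?normal_peak_ge0// lef_pV2 ?posrE ?expR_gt0//.
  by apply: le_trans (expR_ge1Dx _); rewrite ler_wpDl.
by rewrite invf_div mulrA ler_pdivrMr// [leRHS]mulrC -ler_pdivrMr.
Qed.

(** Stein's identity: the difference of the integrands is the derivative of [H], whose values at the
    ends of [[-(n+1), n+1]] tend to 0. *)
Let stein k c : \int[mu]_x ((x - m) * sin (k * (x - m) + c) * p x) =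
  s ^+ 2 * k * \int[mu]_x (cos (k * (x - m) + c) * p x).
Proof.
have i1 := lin_trig_integrable (msin k c) (fun x => sin_max _).
have i2 := trig_pdf_integrable (mcos k c) (fun x => cos_max _).
apply/eqP; rewrite -subr_eq0 -RintegralZl// -RintegralB//; last exact: RintegrableZl.
set h := (fun x => _ - _).
pose H x := - (s ^+ 2 * sin (k * (x - m) + c)) * p x.
have dH x : is_derive x 1 (H : R -> R^o) (h x).
  have dp := is_derive_pdf x.
  apply: is_derive_eq; rewrite /h /GRing.scale /=; by field.
have ih : mu.-integrable setT (EFin \o h).
  by apply: RintegrableB => //; exact: RintegrableZl.
have mh : measurable_fun setT h by apply/measurable_EFinP; exact: measurable_int ih.
have cp x : {for x, continuous p} by exact: (continuous_normal_pdf s0).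
have clin x : {for x, continuous (fun y => k * (y - m) + c)}.
  by apply: cvgD; [apply: cvgM; [exact: cvg_cst|apply: cvgB; [exact: cvg_id|exact: cvg_cst]]|exact: cvg_cst].
have csin x : {for x, continuous (fun y => sin (k * (y - m) + c))}.
  by apply: continuous_comp => //; exact: continuous_sin.
have ccos x : {for x, continuous (fun y => cos (k * (y - m) + c))}.
  by apply: continuous_comp => //; exact: continuous_cos.
have ch : continuous h.
  move=> x; rewrite /h.
  apply: cvgB; apply: cvgM.
  - apply: cvgM; last exact: csin.
    by apply: cvgB; [exact: cvg_id|exact: cvg_cst].
  - exact: cp.
  - exact: cvg_cst.
  - by apply: cvgM; [exact: ccos|exact: cp].
have cH : continuous H.
  move=> x; rewrite /H; apply: cvgM; last exact: cp.
  by apply: cvgN; apply: cvgM; [exact: cvg_cst|exact: csin].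
pose I n : set R := `[- (n.+1%:R), n.+1%:R]%classic.
have cv : \int[mu]_x (h \_ (I n)) x @[n --> \oo] --> \int[mu]_x h x.
  apply: (@Rintegral_dominated_cvg _ _ _ mu _ measurableT _ h (fun x => `|h x|)).
  - move=> n; apply: (measurable_restrictT h (measurable_itv _)).1; exact: measurable_funTS.
  - move=> x _; apply: cvg_near_cst.
    near=> n; rewrite patchE ifT// inE /I /= in_itv/= -ler_norml.
    near: n; exact: near_infty_ger_succ.
  - exact: integrable_norm.
  - by move=> n x _; rewrite patchE; case: ifPn => // _; rewrite normr0.
have hI n : \int[mu]_x (h \_ (I n)) x = H n.+1%:R - H (- n.+1%:R).
  rewrite -Rintegral_mkcond /Rintegral (@continuous_FTC2 _ h H)//.
  - by rewrite gtrN.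
  - exact: continuous_subspaceT.
  - by split=> [x _||]; [have := dH x|apply: cvg_at_right_filter; exact: cH|apply: cvg_at_left_filter; exact: cH].
  - by move=> x _; rewrite derive1E derive_val.
have H0 : H n.+1%:R - H (- n.+1%:R) @[n --> \oo] --> (0:R).
  apply/cvgrPdist_le => e e0.
  have [A pA] := pdf_small (divr_gt0 e0 (mulr_gt0 (ltr0n R 2) s2_gt0)).
  near=> n; rewrite sub0r normrN.
  have HA x : A <= `|x| -> `|H x| <= e / 2.
    move=> Ax; rewrite normrM normrN normrM (ger0_norm (normal_pdf_ge0 _ _ _)).
    rewrite (gtr0_norm s2_gt0) mulrAC; apply: le_trans (_ : s ^+ 2 * p x <= _).
      by rewrite ler_piMr ?sin_max// mulr_ge0// ?normal_pdf_ge0// ltW.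
    apply: le_trans (ler_wpM2l (ltW s2_gt0) (pA _ Ax)) _.
    by rewrite le_eqVlt; apply/orP; left; apply/eqP; field.
  apply: le_trans (ler_normB _ _) _; rewrite [leRHS]splitr.
  have nA : A <= n.+1%:R by near: n; exact: near_infty_ger_succ.
  by rewrite lerD// HA// ?normrN ger0_norm.
move: cv; under eq_fun do rewrite hI.
by move/(cvg_unique _ H0) => <-.
Unshelve. all: by end_near.
Qed.

Let phi c k := \int[mu]_x (cos (k * (x - m) + c) * p x).

(** Differentiation under the integral produces a factor [x - m], which [stein] removes again: [phi]
    solves a linear differential equation in [k]. *)
Let is_derive_phi c k : is_derive k 1 (phi c : R -> R^o) (- (s ^+ 2 * k) * phi c k).
Proof.
pose f k x := cos (k * (x - m) + c) * p x.
have df k' x : is_derive k' 1 (f ^~ x : R -> R^o) (- ((x - m) * sin (k' * (x - m) + c) * p x)).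
  apply: is_derive_eq; rewrite /GRing.scale /=; ring.
have ik : (`]k - 1, k + 1[%classic : set R) k by rewrite /= in_itv/=; lra.
have intf k' : (`]k - 1, k + 1[%classic : set R) k' -> mu.-integrable setT (EFin \o f k').
  by move=> _; apply: trig_pdf_integrable => // x; exact: cos_max.
have derf k' x : (`]k - 1, k + 1[%classic : set R) k' -> setT x -> derivable (f ^~ x : R -> R^o) k' 1.
  by move=> _ _; have := df k' x.
have G0 x : 0 <= `|x - m| * p x by rewrite mulr_ge0// normal_pdf_ge0.
have Gub k' x : (`]k - 1, k + 1[%classic : set R) k' -> setT x -> `|partial1of2 f k' x| <= `|x - m| * p x.
  move=> _ _; rewrite partial1of2E derive_val normrN !normrM [`|p x|]ger0_norm ?normal_pdf_ge0//.
  by rewrite ler_wpM2r ?normal_pdf_ge0// ler_piMr// sin_max.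
apply: DeriveDef.
  exact: (derivable_under_integral measurableT ik intf derf G0 integrable_lin_pdf Gub).
rewrite -derive1E (differentiation_under_integral measurableT ik intf derf G0 integrable_lin_pdf Gub).
under eq_Rintegral do rewrite partial1of2E derive_val -mulN1r.
rewrite RintegralZl//; last first.
  apply: lin_trig_integrable => // x; exact: sin_max.
by rewrite stein mulN1r mulNr.
Qed.

Lemma Rintegral_cos_normal_pdf k c :
  \int[mu]_x (cos (k * (x - m) + c) * normal_pdf m s x) =
  expR (- (k ^+ 2 * s ^+ 2 / 2)) * cos c.
Proof.
pose psi k := expR (k ^+ 2 * s ^+ 2 / 2) * phi c k.
have dpsi k' : is_derive k' 1 (psi : R -> R^o) 0.
  have := is_derive_phi c k' => dphi.
  rewrite /psi; apply: is_derive_eq; rewrite /GRing.scale /=.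
  by field.
have : psi k = psi 0 by apply: is_derive_0_is_cst.
rewrite /psi expr0n/= !mul0r expR0 mul1r => e.
have -> : cos c = phi c 0.
  rewrite /phi; under eq_Rintegral do rewrite mul0r add0r.
  by rewrite RintegralZl ?Rintegral_normal_pdf ?mulr1//; exact: integrable_normal_pdf.
by rewrite -e mulrA -expRD addNr expR0 mul1r.
Qed.

End NormalDensity.

(** * Integrals against the normal law *)

Section NormalLaw.
Context (R : realType).
Local Notation mu := (@lebesgue_measure R).
Variables (m s : R).

(** The change of variables is available for the Radon-Nikodym derivative, which equals [normal_pdf]
    almost everywhere because both integrate to [normal_prob] over measurable sets. *)
Lemma ge0_integral_normal_prob (f : R -> \bar R) :
  measurable_fun setT f -> (forall x, 0 <= f x)%E ->
  (\int[normal_prob m s]_x f x = \int[mu]_x (f x * (normal_pdf m s x)%:E))%E.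
Proof.
move=> mf f0.
have dom := @normal_prob_dominates R m s.
rewrite -(Radon_Nikodym_SigmaFinite.change_of_variables dom f0 measurableT mf).
have mRN := measurable_int _ (Radon_Nikodym_SigmaFinite.f_integrable dom).
have mpdf : measurable_fun setT (EFin \o normal_pdf m s).
  by apply/measurable_EFinP; exact: measurable_normal_pdf.
apply: ae_eq_integral => //.
- exact: emeasurable_funM.
- exact: emeasurable_funM.
- apply: ae_eqe_mul2l; apply: integral_ae_eq => //.
    exact: Radon_Nikodym_SigmaFinite.f_integrable.
  by move=> E _ mE; rewrite -Radon_Nikodym_SigmaFinite.f_integral.
Qed.

Lemma Rintegral_normal_prob (g : R -> R) : measurable_fun setT g ->
  mu.-integrable setT (EFin \o (fun x => g x * normal_pdf m s x)) ->
  (normal_prob m s).-integrable setT (EFin \o g) /\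
  \int[normal_prob m s]_x g x = \int[mu]_x (g x * normal_pdf m s x).
Proof.
move=> mg ig.
have inu : (normal_prob m s).-integrable setT (EFin \o g).
  apply/integrableP; split; first exact/measurable_EFinP.
  rewrite ge0_integral_normal_prob//; last first.
    by apply/measurable_EFinP; exact: measurableT_comp.
  case/integrableP: ig => _; congr (_ < _)%E; apply: eq_integral => x _ /=.
  by rewrite normrM [`|normal_pdf _ _ _|]ger0_norm ?normal_pdf_ge0.
split=> //; rewrite /Rintegral; congr fine.
have mgE : measurable_fun setT (EFin \o g) by exact/measurable_EFinP.
rewrite [LHS]integralE [RHS]integralE; congr (_ - _)%E.
  rewrite ge0_integral_normal_prob//; last exact: measurable_funepos.
  apply: eq_integral => x _; rewrite !funeposE /= -!EFin_max -EFinM.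
  by rewrite maxr_pMl ?normal_pdf_ge0// mul0r.
rewrite ge0_integral_normal_prob//; last exact: measurable_funeneg.
apply: eq_integral => x _; rewrite !funenegE /= -!EFin_max -EFinM.
by rewrite maxr_pMl ?normal_pdf_ge0// mul0r mulNr.
Qed.

End NormalLaw.

Lemma continuous_borel_measurable (R : realType) (X : normedModType R) (f : X -> R) :
  continuous f -> measurable_fun (setT : set (borel X)) (f : borel X -> R).
Proof.
move=> /continuousP cf; apply: (measurability _ (RGenOpens.measurableE R)).
move=> _ [_ [a [b ->] <-]]; rewrite setTI.
by apply: sub_sigma_algebra; apply: cf; exact: interval_open.
Qed.

(** * Laplace-Fourier transform of a functional *)

Section GaussianFunctional.
Context (R : realType) (X : normedModType R) (gamma : probability (borel X) R).
Hypothesis gauss : centered_gaussian gamma.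

(* [v] is [E l^2], but that is a consequence of this formula with [k = c = 0]. *)
Lemma gaussian_exp_cos (l : X -> R) : dual_elt l -> exists2 v : R, 0 <= v &
  forall a k c,
    gamma.-integrable setT (EFin \o (fun y => expR (a * l y) * cos (k * l y + c))) /\
    \int[gamma]_y (expR (a * l y) * cos (k * l y + c)) =
    expR ((a ^+ 2 - k ^+ 2) * v / 2) * cos (c + k * a * v).
Proof.
move=> dl; have [s [sge0 law]] := gauss dl.
pose lb : borel X -> measurableTypeR R := l.
have ml : measurable_fun setT lb.
  by apply: continuous_borel_measurable; case: dl.
exists (s ^+ 2) => [|a k c]; first exact: sqr_ge0.
pose g x := expR (a * x) * cos (k * x + c).
have mg : measurable_fun setT g.
  apply: measurable_funM.
    by apply: measurableT_comp; [exact: measurable_expR|exact: measurable_funM].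
  apply: measurableT_comp; first exact: continuous_measurable_fun (@continuous_cos R).
  by apply: measurable_funD => //; exact: measurable_funM.
have mgE : measurable_fun setT (EFin \o g) by exact/measurable_EFinP.
have mgN : measurable_fun setT (EFin \o (fun x => `|g x|)).
  by apply/measurable_EFinP; exact: measurableT_comp.
(* Dirac mass and normal law are treated together: any measure [nu] equal to the image of [gamma]
   under [l], with the right integral of [g], will do. *)
suff [nu [nuP [inu inuE]]] : exists nu : {measure set (measurableTypeR R) -> \bar R},
    (forall A, measurable A -> gamma (l @^-1` A) = nu A) /\
    nu.-integrable setT (EFin \o g) /\
    \int[nu]_x g x = expR ((a ^+ 2 - k ^+ 2) * s ^+ 2 / 2) * cos (c + k * a * s ^+ 2).
  have ig : gamma.-integrable setT (EFin \o (g \o lb)).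
    apply/integrableP; split; first by apply/measurable_EFinP; exact: measurableT_comp.
    have := @ge0_integral_pushforward _ _ _ _ R lb ml gamma setT _ measurableT mgN (fun y _ => normr_ge0 _).
    rewrite preimage_setT => <-.
    rewrite (eq_measure_integral nu); last by move=> A mA _; exact: nuP.
    by case/integrableP : inu.
  split=> //; rewrite -inuE /Rintegral; congr fine.
  have := @integral_pushforward _ _ _ _ R lb ml gamma setT (EFin \o g) mgE ig measurableT.
  rewrite preimage_setT => <-.
  apply: eq_measure_integral => A mA _; exact: nuP.
have [s_eq0|s_neq0] := eqVneq s 0.
- exists (@dirac _ (measurableTypeR R) 0 R); split; [|split].
  + by move=> A mA; rewrite law// s_eq0 eqxx.
  + apply/integrableP; split=> //.
    by rewrite integral_dirac// diracT mul1e ltry.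
  + rewrite /Rintegral integral_dirac// diracT mul1e /= /g s_eq0.
    by rewrite expr0n/= !mulr0 !mul0r expR0 add0r addr0.
- exists (normal_prob 0 s); split; [|].
  + by move=> A mA; rewrite law// (negbTE s_neq0).
  (* The weight [exp (a x)] recentres the density at [a * s ^+ 2]; writing the cosine around this
     new mean produces the phase [k * a * s ^+ 2]. *)
  + have e x : g x * normal_pdf 0 s x = expR (a ^+ 2 * s ^+ 2 / 2) *
      (cos (k * (x - a * s ^+ 2) + (c + k * a * s ^+ 2)) * normal_pdf (a * s ^+ 2) s x).
      rewrite /g mulrAC expR_normal_pdf// mulr0 !add0r mulrAC -mulrA.
      by congr (_ * (cos _ * _)); ring.
    have ip : (@lebesgue_measure R).-integrable setT (EFin \o (fun x => g x * normal_pdf 0 s x)).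
      apply: le_Rintegrable (integrable_expR_normal_pdf 0 s_neq0 a) => //.
        by apply: measurable_funM => //; exact: measurable_normal_pdf.
      move=> x _; rewrite !normrM ger0_norm ?expR_ge0// [`|normal_pdf _ _ _|]ger0_norm ?normal_pdf_ge0//.
      by rewrite ler_wpM2r ?normal_pdf_ge0// ler_piMr ?expR_ge0// cos_max.
    have [? ->] := Rintegral_normal_prob mg ip; split=> //.
    under eq_Rintegral do rewrite e.
    rewrite RintegralZl//.
      rewrite Rintegral_cos_normal_pdf// mulrA -expRD; congr (expR _ * _).
      by field.
    apply: le_Rintegrable (integrable_normal_pdf (a * s ^+ 2) s) => //.
      apply: measurable_funM; last exact: measurable_normal_pdf.
      apply: measurableT_comp; first exact: continuous_measurable_fun (@continuous_cos R).
      by apply: measurable_funD => //; apply: measurable_funM => //; exact: measurable_funB.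
    move=> x _; rewrite normrM [`|normal_pdf _ _ _|]ger0_norm ?normal_pdf_ge0//.
    by rewrite ler_piMl ?normal_pdf_ge0// cos_max.
Qed.
End GaussianFunctional.

(** * Algebra of continuous functionals *)

Section Dual.
Context (R : realType) (X : normedModType R).
Implicit Types l m : X -> R.

Lemma dual_eltE l : dual_elt l -> forall a x y, l (a *: x + y) = a * l x + l y.
Proof. by case. Qed.

Lemma dual_elt0 l : dual_elt l -> l 0 = 0.
Proof. by case=> lin _; have := lin (-1) 0 0; rewrite scaler0 addr0 mulN1r addNr. Qed.

Lemma dual_eltD l x y : dual_elt l -> l (x + y) = l x + l y.
Proof. by case=> lin _; rewrite -[x in LHS]scale1r lin mul1r. Qed.

Lemma dual_eltZ l a x : dual_elt l -> l (a *: x) = a * l x.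
Proof. by move=> dl; rewrite -[a *: x]addr0 (dual_eltE dl) dual_elt0// addr0. Qed.

Lemma dual_eltN l x : dual_elt l -> l (- x) = - l x.
Proof. by move=> dl; rewrite -scaleN1r dual_eltZ// mulN1r. Qed.

Lemma dual_eltB l x y : dual_elt l -> l (x - y) = l x - l y.
Proof. by move=> dl; rewrite dual_eltD// dual_eltN. Qed.

Lemma dual_lin a l m : dual_elt l -> dual_elt m -> dual_elt (fun y => a * l y + m y).
Proof.
move=> [ll cl] [lm cm]; split=> [b x y|x]; first by rewrite ll lm; ring.
by apply: cvgD; [apply: cvgM; [exact: cvg_cst|exact: cl]|exact: cm].
Qed.

Lemma dual_cst0 : dual_elt (fun _ : X => 0 : R).
Proof. by split=> [b x y|x]; [rewrite mulr0 addr0|exact: cvg_cst]. Qed.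

Lemma dual_scale a l : dual_elt l -> dual_elt (fun y => a * l y).
Proof.
move=> dl; have := dual_lin a dl dual_cst0.
by under eq_fun do rewrite addr0.
Qed.

Lemma dual_add l m : dual_elt l -> dual_elt m -> dual_elt (fun y => l y + m y).
Proof.
move=> dl dm; have := dual_lin 1 dl dm.
by under eq_fun do rewrite mul1r.
Qed.

Lemma dual_opp l : dual_elt l -> dual_elt (fun y => - l y).
Proof.
move=> dl; have := dual_scale (-1) dl.
by under eq_fun do rewrite mulN1r.
Qed.

Lemma dual_sub l m : dual_elt l -> dual_elt m -> dual_elt (fun y => l y - m y).
Proof. by move=> dl dm; apply: dual_add => //; exact: dual_opp. Qed.

Lemma dual_measurable l : dual_elt l -> measurable_fun (setT : set (borel X)) (l : borel X -> R).
Proof. by case=> _; exact: continuous_borel_measurable. Qed.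

End Dual.

(** * Expectation of functions of exponential growth *)

Section Nice.
Context (R : realType) (X : normedModType R) (gamma : probability (borel X) R).
Hypothesis gauss : centered_gaussian gamma.
Implicit Types (f g w : X -> R) (l m : X -> R).

Definition expect (g : X -> R) : R := Rintegral gamma setT (g : borel X -> R).

Definition bmeas (g : X -> R) := measurable_fun (setT : set (borel X)) (g : borel X -> R).

(* Domination by finite sums of exponentials of duals gives integrability and is stable under sums,
   products and translations. *)
Definition nice (g : X -> R) := bmeas g /\
  exists (I : finType) (L : I -> X -> R),
    (forall i, dual_elt (L i)) /\ forall y, `|g y| <= \sum_i expR (L i y).

Lemma integrable_expR_dual l : dual_elt l ->
  gamma.-integrable setT (EFin \o (fun y : borel X => expR (l y))).
Proof.
move=> dl; have [v _ /(_ 1 0 0)[+ _]] := gaussian_exp_cos gauss dl.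
by under eq_fun do rewrite mul1r mul0r add0r cos0 mulr1.
Qed.

Lemma nice_integrable g : nice g -> gamma.-integrable setT (EFin \o (g : borel X -> R)).
Proof.
move=> [mg [I [L [dL gL]]]].
apply: le_Rintegrable mg (fun y _ => gL y) _ => //.
rewrite (_ : _ \o _ = fun y : borel X => (\sum_i (expR (L i y))%:E)%E); last first.
  by apply/funext => y /=; rewrite sumEFin.
by apply: integrable_sum => // i _; exact: integrable_expR_dual.
Qed.

Lemma nice_le f g : bmeas f -> nice g -> (forall y, `|f y| <= `|g y|) -> nice f.
Proof.
move=> mf [_ [I [L [dL gL]]]] fg; split=> //; exists I, L; split=> // y.
exact: le_trans (gL y).
Qed.

Lemma nice_expR l : dual_elt l -> nice (fun y => expR (l y)).
Proof.
move=> dl; split.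
  by apply: (measurableT_comp (@measurable_expR R)); exact: dual_measurable.
exists unit, (fun _ => l); split=> // y.
by rewrite big_const card_unit /= addr0 ger0_norm// expR_ge0.
Qed.

Lemma niceD f g : nice f -> nice g -> nice (fun y => f y + g y).
Proof.
move=> [mf [I [L [dL fL]]]] [mg [J [M [dM gM]]]]; split; first exact: measurable_funD.
exists (I + J)%type, (fun k => match k with inl i => L i | inr j => M j end); split.
  by case.
move=> y; rewrite big_sumType /=; apply: le_trans (ler_normD _ _) _.
exact: lerD.
Qed.

Lemma niceM f g : nice f -> nice g -> nice (fun y => f y * g y).
Proof.
move=> [mf [I [L [dL fL]]]] [mg [J [M [dM gM]]]]; split; first exact: measurable_funM.
exists (I * J)%type, (fun k y => L k.1 y + M k.2 y); split.
  by move=> k; exact: dual_add.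
move=> y; rewrite normrM; apply: le_trans (ler_pM _ _ (fL y) (gM y)) _ => //.
rewrite big_distrl /= [leRHS](eq_bigr (fun k => expR (L k.1 y) * expR (M k.2 y))); last first.
  by move=> k _; rewrite expRD.
rewrite -(pair_bigA _ (fun i j => expR (L i y) * expR (M j y))) /=.
by apply: ler_sum => i _; rewrite big_distrr.
Qed.

Lemma nice_bounded g K : bmeas g -> (forall y, `|g y| <= K) -> nice g.
Proof.
move=> mg gK; split=> //.
(* The value [exp 0 = 1], repeated [truncn K + 1] times, exceeds [K]. *)
exists 'I_(Num.truncn K).+1, (fun _ _ => 0); split=> [_|y]; first exact: dual_cst0.
rewrite expR0 sumr_const card_ord.
apply: le_trans (gK y) _; apply/ltW; exact: truncnS_gt.
Qed.

Lemma nice_cst (r : R) : nice (fun _ => r).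
Proof. by apply: (@nice_bounded _ `|r|) => //; exact: measurable_cst. Qed.

Lemma niceZ (r : R) g : nice g -> nice (fun y => r * g y).
Proof. by move=> ng; apply: niceM => //; exact: nice_cst. Qed.

Lemma niceN g : nice g -> nice (fun y => - g y).
Proof. by move=> /(niceZ (-1)); under eq_fun do rewrite mulN1r. Qed.

Lemma niceB f g : nice f -> nice g -> nice (fun y => f y - g y).
Proof. by move=> nf ng; apply: niceD => //; exact: niceN. Qed.

Lemma niceX n g : nice g -> nice (fun y => g y ^+ n).
Proof.
move=> ng; elim: n => [|n IH]; first exact: nice_cst.
by under eq_fun do rewrite exprS; exact: niceM.
Qed.

Lemma nice_norm g : nice g -> nice (fun y => `|g y|).
Proof.
move=> ng; apply: (nice_le _ ng) => [|y]; last by rewrite normr_id.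
by apply: measurableT_comp => //; case: ng.
Qed.

Lemma normr_le_expR (x : R) : `|x| <= expR x + expR (- x).
Proof.
have := expR_ge1Dx x; have := expR_ge1Dx (- x); have := expR_ge0 x; have := expR_ge0 (- x).
by rewrite ler_norml => *; apply/andP; split; lra.
Qed.

Lemma nice_dual l : dual_elt l -> nice l.
Proof.
move=> dl; apply: (nice_le (g := fun y => expR (l y) + expR (- l y))).
- exact: dual_measurable.
- by apply: niceD; apply: nice_expR => //; exact: dual_opp.
- by move=> y; rewrite [leRHS]ger0_norm ?normr_le_expR// addr_ge0// expR_ge0.
Qed.

Lemma expectD f g : nice f -> nice g ->
  expect (fun y => f y + g y) = expect f + expect g.
Proof. by move=> *; apply: RintegralD => //; exact: nice_integrable. Qed.

Lemma expectB f g : nice f -> nice g ->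
  expect (fun y => f y - g y) = expect f - expect g.
Proof. by move=> *; apply: RintegralB => //; exact: nice_integrable. Qed.

Lemma expectZ r g : nice g -> expect (fun y => r * g y) = r * expect g.
Proof. by move=> *; apply: RintegralZl => //; exact: nice_integrable. Qed.

Lemma expect_cst r : expect (fun _ => r) = r.
Proof.
rewrite /expect /Rintegral integral_cst//.
by rewrite [X in (_ * X)%E](@probability_setT _ _ _ gamma) mule1.
Qed.

Lemma expect_ge0 g : (forall y, 0 <= g y) -> 0 <= expect g.
Proof. by move=> g0; apply: Rintegral_ge0. Qed.

Lemma expect_le f g : nice f -> nice g -> (forall y, f y <= g y) -> expect f <= expect g.
Proof. by move=> *; apply: le_Rintegral => //; exact: nice_integrable. Qed.

Lemma expect_norm g : nice g -> `|expect g| <= expect (fun y => `|g y|).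
Proof. by move=> *; apply: le_normr_Rintegral => //; exact: nice_integrable. Qed.

Lemma expect_dominated_cvg (f_ : nat -> X -> R) f g : nice g ->
  (forall n, bmeas (f_ n)) -> (forall n y, `|f_ n y| <= g y) ->
  (forall y, f_ n y @[n --> \oo] --> f y) ->
  expect (f_ n) @[n --> \oo] --> expect f.
Proof.
move=> ng mf fg cf.
apply: (@Rintegral_dominated_cvg _ _ _ gamma setT measurableT f_ f g) => //.
exact: nice_integrable.
Qed.

Lemma bmeas_cvg (f_ : nat -> X -> R) f : (forall n, bmeas (f_ n)) ->
  (forall y, f_ n y @[n --> \oo] --> f y) -> bmeas f.
Proof.
move=> mf cf; apply: (measurable_fun_cvg (h := f_ : nat -> borel X -> R)).
  exact: mf.
by move=> y _; exact: cf.
Qed.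

(* Cauchy-Schwarz in the additive form that needs no square roots. *)
Lemma expect_mul_le f g a : 0 < a -> nice f -> nice g ->
  `|expect (fun y => f y * g y)| <=
  (a * expect (fun y => f y ^+ 2) + a^-1 * expect (fun y => g y ^+ 2)) / 2.
Proof.
move=> a0 nf ng; have nfg := niceM nf ng.
apply: le_trans (expect_norm nfg) _.
have nf2 := niceX 2 nf; have ng2 := niceX 2 ng.
have nh : nice (fun y => (a * f y ^+ 2 + a^-1 * g y ^+ 2) / 2).
  by under eq_fun do rewrite mulrC; apply: niceZ; apply: niceD; exact: niceZ.
have <- : expect (fun y => (a * f y ^+ 2 + a^-1 * g y ^+ 2) / 2) =
    (a * expect (fun y => f y ^+ 2) + a^-1 * expect (fun y => g y ^+ 2)) / 2.
  under eq_fun do rewrite mulrC.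
  by rewrite expectZ ?expectD ?expectZ 1?mulrC//; [apply: niceZ..|apply: niceD; exact: niceZ].
apply: expect_le => //; first exact: nice_norm.
move=> y; rewrite normrM.
have := sqr_ge0 (a * `|f y| - `|g y|).
rewrite -(pmulr_rge0 _ (_ : 0 < a^-1)) ?invr_gt0// => H.
rewrite -[f y ^+ 2]real_normK ?num_real// -[g y ^+ 2]real_normK ?num_real//.
have E : a^-1 * (a * `|f y| - `|g y|) ^+ 2 =
   a * `|f y| ^+ 2 + a^-1 * `|g y| ^+ 2 - 2 * (`|f y| * `|g y|).
  by field; rewrite gt_eqF.
lra.
Qed.

Lemma expect_CS f g : nice f -> nice g ->
  expect (fun y => f y * g y) ^+ 2 <=
  expect (fun y => f y ^+ 2) * expect (fun y => g y ^+ 2).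
Proof.
move=> nf ng; set A := expect _; set F := expect _; set G := expect _.
have nf2 := niceX 2 nf; have ng2 := niceX 2 ng; have nfg := niceM nf ng.
have F0 : 0 <= F by apply: expect_ge0 => y; exact: sqr_ge0.
have G0 : 0 <= G by apply: expect_ge0 => y; exact: sqr_ge0.
have key a : 0 <= F - 2 * a * A + a ^+ 2 * G.
  have -> : F - 2 * a * A + a ^+ 2 * G = expect (fun y => (f y - a * g y) ^+ 2).
    rewrite /F /A /G -!expectZ// -expectB//; last exact: niceZ.
    rewrite -expectD; [|by apply: niceB => //; exact: niceZ|exact: niceZ].
    by congr expect; apply/funext => y; ring.
  by apply: expect_ge0 => y; exact: sqr_ge0.
(* If [G = 0], the expression in [key] is affine in [a], and [a = (F + 1) / A] would make it
   negative unless [A = 0]. Otherwise [a = A / G] is the minimiser. *)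
move: G0; rewrite le_eqVlt => /orP[/eqP G0|G0].
  have [->|A0] := eqVneq A 0; first by rewrite expr0n/= mulr_ge0// -G0.
  have := key ((F + 1) / A); rewrite -G0 mulr0 addr0.
  have -> : 2 * ((F + 1) / A) * A = 2 * (F + 1) by field.
  lra.
have := key (A / G); rewrite -(pmulr_rge0 _ G0).
have -> : G * (F - 2 * (A / G) * A + (A / G) ^+ 2 * G) = F * G - A ^+ 2.
  by field; rewrite gt_eqF.
by rewrite subr_ge0.
Qed.

End Nice.

(** * Countable norming families *)

Section Separable.
Context (R : realType) (X : normedModType R).
Hypothesis sepX : separable_space X.

Lemma separable_dense_seq : exists d : nat -> X, forall x e, 0 < e -> exists i, `|x - d i| < e.
Proof.
have [D [cD clD]] := sepX.
have near_D x (e : R) : 0 < e -> exists2 z, D z & `|x - z| < e.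
  move=> e0; have : closure D x by rewrite clD.
  move=> /(_ (ball x e) (nbhsx_ballx _ _ e0))[z [Dz]].
  by rewrite -ball_normE; exists z.
have /pcard_surjP[g gD] := cD.
exists g => x e e0; have [z Dz xz] := near_D x e e0.
by have [i _ gi] := gD z Dz; exists i; rewrite gi.
Qed.

(** The functionals norming a dense sequence suffice: at [x] close to [d i] the [i]-th one misses
    the norm of [x] by at most twice the distance. Closed balls thereby become countable
    intersections of half-spaces. *)
Lemma norming_seq : exists m : nat -> X -> R, (forall i, dual_elt (m i)) /\
  forall x r, (`|x| <= r) <-> (forall i, m i x <= r).
Proof.
have [d dP] := separable_dense_seq.
have [m mP] := choice (fun i => norming_functional (d i)).
exists m; split=> [i|x r]; first by have [] := mP i.
split=> [xr i|mr].
  by have [_ /(_ x) mx _] := mP i; apply: le_trans xr; exact: le_trans (ler_norm _) mx.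
apply/ler_addgt0Pr => e e0.
have [i di] := dP x (e / 2) (divr_gt0 e0 (ltr0n R 2)).
have [dl ml md] := mP i.
have := ml (x - d i); rewrite dual_eltB// md ler_norml => /andP[+ _].
have := mr i.
have : `|x| <= `|d i| + `|x - d i| by rewrite -{1}(subrK (d i) x) addrC ler_normD.
lra.
Qed.

End Separable.

(** * Functionals that vanish on trigonometric functions *)

Section TrigUniqueness.
Context (R : realType) (X : normedModType R).
Hypothesis sepX : separable_space X.
Implicit Types (f g w m : X -> R) (l : X -> R).

Definition bddm (f : X -> R) := bmeas f /\ exists K, forall y, `|f y| <= K.

Lemma bddm_mul f g : bddm f -> bddm g -> bddm (fun y => f y * g y).
Proof.
move=> [mf [K fK]] [mg [L gL]]; split; first exact: measurable_funM.
by exists (K * L) => y; rewrite normrM ler_pM.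
Qed.

Lemma bddm_add f g : bddm f -> bddm g -> bddm (fun y => f y + g y).
Proof.
move=> [mf [K fK]] [mg [L gL]]; split; first exact: measurable_funD.
by exists (K + L) => y; apply: le_trans (ler_normD _ _) _; exact: lerD.
Qed.

Lemma bddm_cst r : bddm (fun _ => r).
Proof. by split; [exact: measurable_cst|exists `|r|]. Qed.

Lemma bddm_cos l c : dual_elt l -> bddm (fun y => cos (l y + c)).
Proof.
move=> dl; split; last by exists 1 => y; exact: cos_max.
apply: (measurableT_comp (f := @cos R)).
  exact: continuous_measurable_fun (@continuous_cos R).
by apply: measurable_funD => //; exact: dual_measurable.
Qed.

Variable I : (X -> R) -> R.
Hypothesis I_add : forall f g, bddm f -> bddm g -> I (fun y => f y + g y) = I f + I g.
Hypothesis I_scale : forall r f, bddm f -> I (fun y => r * f y) = r * I f.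
Hypothesis I_cvg : forall (f_ : nat -> X -> R) f K, (forall n, bmeas (f_ n)) ->
  (forall n y, `|f_ n y| <= K) -> (forall y, f_ n y @[n --> \oo] --> f y) ->
  I (f_ n) @[n --> \oo] --> I f.
Hypothesis I_cos : forall l c, dual_elt l -> I (fun y => cos (l y + c)) = 0.

(* The multipliers of the annihilated functions form an algebra that contains the trigonometric functions
   and is closed under bounded pointwise limits, hence contains the indicators of half-spaces. *)
Let annihilated w := bddm w /\ forall l c, dual_elt l -> I (fun y => w y * cos (l y + c)) = 0.

Let multiplier m := bddm m /\ forall w, annihilated w -> annihilated (fun y => m y * w y).

Let multiplier_cst r : multiplier (fun _ => r).
Proof.
split=> [|w [bw wI]]; first exact: bddm_cst.
split=> [|l c dl]; first by apply: bddm_mul => //; exact: bddm_cst.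
under eq_fun do rewrite -mulrA.
by rewrite I_scale ?wI ?mulr0//; apply: bddm_mul => //; exact: bddm_cos.
Qed.

Let multiplier_mul f g : multiplier f -> multiplier g -> multiplier (fun y => f y * g y).
Proof.
move=> [bf fM] [bg gM]; split=> [|w wA]; first exact: bddm_mul.
by under eq_fun do rewrite -mulrA; apply: fM; exact: gM.
Qed.

Let multiplier_add f g : multiplier f -> multiplier g -> multiplier (fun y => f y + g y).
Proof.
move=> [bf fM] [bg gM]; split=> [|w wA]; first exact: bddm_add.
have [[b1 w1] [b2 w2]] := (fM _ wA, gM _ wA).
under eq_fun do rewrite mulrDl.
split=> [|l c dl]; first exact: bddm_add.
under eq_fun do rewrite mulrDl.
by rewrite I_add ?w1 ?w2 ?addr0//; apply: bddm_mul => //; exact: bddm_cos.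
Qed.

Let multiplier_sum n (f : 'I_n -> X -> R) : (forall i, multiplier (f i)) ->
  multiplier (fun y => \sum_(i < n) f i y).
Proof.
elim: n f => [|n IH] f fM.
  by under eq_fun do rewrite big_ord0; exact: multiplier_cst.
by under eq_fun do rewrite big_ord_recr /=; apply: multiplier_add => //; exact: IH.
Qed.

Let bddm_cvg (f_ : nat -> X -> R) f K : (forall n, bmeas (f_ n)) ->
  (forall n y, `|f_ n y| <= K) -> (forall y, f_ n y @[n --> \oo] --> f y) -> bddm f.
Proof.
move=> mf fK cf; split; first exact: bmeas_cvg cf.
exists K => y.
apply: (cvgr_to_le (cvg_norm (cf y))); exact: nearW.
Qed.

Let multiplier_cvg (f_ : nat -> X -> R) f K : (forall n, multiplier (f_ n)) ->
  (forall n y, `|f_ n y| <= K) -> (forall y, f_ n y @[n --> \oo] --> f y) -> multiplier f.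
Proof.
move=> fM fK cf.
have bf : bddm f by apply: bddm_cvg fK cf => n; have [[]] := fM n.
split=> // w wA; have [bw _] := wA; split=> [|l c dl]; first exact: bddm_mul.
have [mw [L wL]] := bw; have bc := bddm_cos c dl.
have c0 : I (fun y => f_ n y * w y * cos (l y + c)) @[n --> \oo] --> I (fun y => f y * w y * cos (l y + c)).
  apply: (I_cvg (K := K * L)).
  - by move=> n; have [[bn _] _] := fM n; apply: measurable_funM; [exact: measurable_funM|case: bc].
  - move=> n y; rewrite normrM -[leRHS]mulr1 ler_pM ?cos_max//.
    by rewrite normrM ler_pM.
  - by move=> y; apply: cvgM; [apply: cvgM => //; exact: cvg_cst|exact: cvg_cst].
apply: (cvg_unique _ c0); first exact: norm_hausdorff.
have -> : (fun n => I (fun y => f_ n y * w y * cos (l y + c))) = cst 0.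
  by apply/funext => n; have [_ /(_ _ wA)[_ ->]] := fM n.
exact: cvg_cst.
Qed.

(* [2 cos a cos b = cos (a + b) + cos (a - b)] *)
Let multiplier_cos l c : dual_elt l -> multiplier (fun y => cos (l y + c)).
Proof.
move=> dl; split=> [|w [bw wI]]; first exact: bddm_cos.
split=> [|k d dk]; first by apply: bddm_mul => //; exact: bddm_cos.
have e y : cos (l y + c) * w y * cos (k y + d) =
    2^-1 * (w y * cos ((l y + k y) + (c + d))) + 2^-1 * (w y * cos ((l y - k y) + (c - d))).
  rewrite (_ : l y + k y + (c + d) = (l y + c) + (k y + d)); last by ring.
  rewrite (_ : l y - k y + (c - d) = (l y + c) - (k y + d)); last by ring.
  by move: (l y + c) (k y + d) => a b; rewrite cosB cosD; field.
under eq_fun do rewrite e.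
have d1 := dual_add dl dk; have d2 := dual_sub dl dk.
have b1 := bddm_mul bw (bddm_cos (c + d) d1).
have b2 := bddm_mul bw (bddm_cos (c - d) d2).
rewrite I_add; [|exact: bddm_mul (bddm_cst _) _|exact: bddm_mul (bddm_cst _) _].
by rewrite !I_scale// wI// wI// !mulr0 addr0.
Qed.

(* The iterates of [p] converge to the sign function on [[-1, 1]]. *)
Let p (x : R) := (3 * x - x ^+ 3) / 2.

Let p_odd n x : iter n p (- x) = - iter n p x.
Proof. by elim: n => //= n ->; rewrite /p; field. Qed.

(** The identity [1 - p z = (1 - z) ((1 - z) (z + 2) / 2)] shows that a step multiplies the distance
    to 1 by at most [1 - z / 2], which is at most [1 - x / 2] because the iterates stay above
    [x]. *)
Let p_iter n x : 0 < x -> x <= 1 ->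
  x <= iter n p x <= 1 /\ 1 - iter n p x <= (1 - x / 2) ^+ n.
Proof.
move=> x0 x1; elim: n => [|n [/andP[xn n1] IH]] /=; first by rewrite lexx x1 expr0; split=> //; lra.
set z := iter n p x in xn n1 IH *.
have e : 1 - p z = (1 - z) * ((1 - z) * (z + 2) / 2) by rewrite /p; field.
have z2 : 0 <= (1 - z) * (z + 2) / 2 by apply: mulr_ge0 => //; apply: mulr_ge0; lra.
have z3 : (1 - z) * (z + 2) / 2 <= 1 - x / 2.
  have := sqr_ge0 z; have -> : (1 - z) * (z + 2) / 2 = 1 - z / 2 - z ^+ 2 / 2 by field.
  lra.
have z4 : 0 <= 1 - p z by rewrite e mulr_ge0//; lra.
have z5 : 1 - p z <= (1 - z) * (1 - x / 2) by rewrite e ler_wpM2l//; lra.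
split.
  apply/andP; split; last lra.
  have : (1 - z) * (1 - x / 2) <= 1 - z by rewrite ler_piMr; lra.
  lra.
apply: le_trans z5 _; rewrite exprSr ler_wpM2r//; lra.
Qed.

Let p_iter_bound n x : `|x| <= 1 -> `|iter n p x| <= 1.
Proof.
have pos y : 0 < y -> y <= 1 -> `|iter n p y| <= 1.
  move=> y0 y1; have [/andP[a b] _] := p_iter n y0 y1.
  by rewrite ger0_norm//; lra.
rewrite ler_norml => /andP[xm xM]; have [x0|x0|->] := ltgtP x 0.
- by rewrite -normrN -p_odd pos//; lra.
- exact: pos.
- by have := p_odd n 0; rewrite oppr0 => h; rewrite (_ : iter n p 0 = 0) ?normr0//; lra.
Qed.

Let p_cvg x : `|x| <= 1 -> iter n p x @[n --> \oo] --> Num.sg x.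
Proof.
have pos y : 0 < y -> y <= 1 -> iter n p y @[n --> \oo] --> (1 : R).
  move=> y0 y1; apply/cvgrPdist_le => e e0.
  have /cvgrPdist_le/(_ _ e0) : (1 - y / 2) ^+ n @[n --> \oo] --> (0 : R).
    by apply: cvg_expr; rewrite ger0_norm; lra.
  apply: filterS => n; rewrite sub0r normrN => h.
  have [/andP[a b] c] := p_iter n y0 y1.
  rewrite ger0_norm; last lra.
  by apply: le_trans c _; apply: le_trans h; exact: ler_norm.
rewrite ler_norml => /andP[xm xM]; have [->|x0|x0] := sgrP x.
- suff -> : (fun n => iter n p 0) = cst 0 by exact: cvg_cst.
  by apply/funext => n; have := p_odd n 0; rewrite oppr0 /=; lra.
- exact: pos.
- rewrite -[x]opprK; under eq_fun do rewrite p_odd.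
  by apply: cvgN; apply: pos; lra.
Qed.

Let multiplier_sg g : multiplier g -> (forall y, `|g y| <= 1) -> multiplier (fun y => Num.sg (g y)).
Proof.
move=> gM g1; apply: (@multiplier_cvg (fun n y => iter n p (g y)) _ 1).
- elim=> //= n IH.
  have -> : (fun y => p (iter n p (g y))) = fun y => (3 / 2) * iter n p (g y) +
      (- 2^-1) * (iter n p (g y) * (iter n p (g y) * iter n p (g y))).
    by apply/funext => y; rewrite /p; field.
  have c := multiplier_cst.
  by apply: multiplier_add; apply: multiplier_mul => //; do 2? apply: multiplier_mul.
- by move=> n y; exact: p_iter_bound.
- by move=> y; exact: p_cvg.
Qed.

(** A sine is a shifted cosine, hence a multiplier, and [sin ((l y - a) / (n + 1))] has the sign of
    [l y - a] once its argument lies between [- pi] and [pi], that is for all large [n]. The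
    indicator is half the sum of this sign and its square. *)
Let multiplier_half_space l a : dual_elt l -> multiplier (\1_[set y | a < l y] : X -> R).
Proof.
move=> dl.
have sgM : multiplier (fun y => Num.sg (l y - a)).
  apply: (@multiplier_cvg (fun n y => Num.sg (sin (n.+1%:R^-1 * l y - n.+1%:R^-1 * a))) _ 1).
  - move=> n; apply: multiplier_sg => [|y]; last exact: sin_max.
    have := multiplier_cos (- (n.+1%:R^-1 * a) - pi / 2) (dual_scale n.+1%:R^-1 dl).
    by under eq_fun do rewrite addrA cosBpihalf.
  - by move=> n y; rewrite normr_sg; case: (_ == _).
  - move=> y; apply: cvg_near_cst; near=> n.
    have n0 : 0 < n.+1%:R :> R by [].
    rewrite -mulrBr; set z := l y - a.
    have zn : `|n.+1%:R^-1 * z| < 2.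
      rewrite normrM ger0_norm ?invr_ge0// ltr_pdivrMl//.
      have : `|z| <= n.+1%:R by near: n; exact: near_infty_ger_succ.
      lra.
    have p2 := pi_ge2 R.
    move: zn; rewrite ltr_norml => /andP[zm zM].
    have [z0|z0|z0] := sgrP z.
    + by rewrite z0 mulr0 sin0 sgr0.
    + rewrite gtr0_sg// sin_gt0_pi// mulr_gt0 ?invr_gt0//=.
      exact: lt_le_trans zM p2.
    + rewrite ltr0_sg// -oppr_gt0 -sinN sin_gt0_pi// oppr_gt0 pmulr_rlt0 ?invr_gt0// z0 /=.
      by apply: lt_le_trans p2; rewrite ltrNl.
have -> : (\1_[set y | a < l y] : X -> R) =
    fun y => 2^-1 * (Num.sg (l y - a) * Num.sg (l y - a)) + 2^-1 * Num.sg (l y - a).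
  apply/funext => y; rewrite indicE; case: sgrP => z.
  - by rewrite memNset /=; [ring|rewrite -subr_gt0 z ltxx].
  - by rewrite mem_set /=; [field|rewrite -subr_gt0].
  - by rewrite memNset /=; [field|apply/negP; rewrite -leNgt -subr_le0 ltW].
by apply: multiplier_add; apply: multiplier_mul => //; exact: multiplier_mul.
Unshelve. all: by end_near. Qed.

Let good := [set A : set (borel X) | measurable A /\ multiplier (\1_A : X -> R)].

Let goodC A : good A -> good (~` A).
Proof.
move=> [mA MA]; split; first exact: measurableC.
have -> : (\1_(~` A) : X -> R) = fun y => 1 + (-1) * (\1_A : X -> R) y.
  apply/funext => y; rewrite !indicE in_setC.
  by case: (y \in A); rewrite /= ?mulr1 ?mulr0 ?addr0 ?subrr.
by apply: multiplier_add; [exact: multiplier_cst|exact: multiplier_mul].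
Qed.

Let goodU A B : good A -> good B -> good (A `|` B).
Proof.
move=> [mA MA] [mB MB]; split; first exact: measurableU.
have -> : (\1_(A `|` B) : X -> R) = fun y => (\1_A : X -> R) y + ((\1_B : X -> R) y
    + (-1) * ((\1_A : X -> R) y * (\1_B : X -> R) y)).
  apply/funext => y; rewrite !indicE in_setU.
  by case: (y \in A); case: (y \in B) => /=; ring.
do 2 apply: multiplier_add => //.
by apply: multiplier_mul => //; exact: multiplier_mul.
Qed.

Let good0 : good set0.
Proof.
by split=> //; rewrite indic0; exact: multiplier_cst.
Qed.

Let good_bigcup (A : (set (borel X))^nat) : (forall n, good (A n)) -> good (\bigcup_n A n).
Proof.
move=> gA; split; first by apply: bigcupT_measurable => n; have [] := gA n.
have gU n : good (\big[setU/set0]_(k < n) A k).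
  elim: n => [|n IH]; first by rewrite big_ord0.
  by rewrite big_ord_recr; exact: goodU.
apply: (@multiplier_cvg (fun n => \1_(\big[setU/set0]_(k < n) A k) : X -> R) _ 1).
- by move=> n; have [] := gU n.
- by move=> n y; rewrite indicE ger0_norm// lern1; case: (_ \in _).
- move=> y; apply: cvg_near_cst.
  have [[k _ Aky]|nU] := pselect ((\bigcup_n A n) y).
    exists k.+1 => // n /= kn; rewrite !indicE !mem_set//; first by exists k.
    by rewrite -bigcup_mkord; exists k.
  apply: nearW => n; rewrite !indicE !memNset// -bigcup_mkord => -[k _ Aky].
  by apply: nU; exists k.
Qed.

Let good_closed_ball z r : good [set x | `|x - z| <= r].
Proof.
have [m [dm mP]] := norming_seq sepX.
have -> : [set x | `|x - z| <= r] = ~` \bigcup_i [set y | r + m i z < m i y].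
  apply/seteqP; split=> x /=.
    move=> /mP h [i _ /=]; have := h i; rewrite dual_eltB//; lra.
  move=> h; apply/mP => i; rewrite leNgt; apply/negP => h'; apply: h; exists i => //=.
  by move: h'; rewrite dual_eltB//; lra.
apply: goodC; apply: good_bigcup => i; split; last exact: multiplier_half_space.
have := dual_measurable (dm i) => /(_ measurableT `]r + m i z, +oo[%classic (measurable_itv _)).
by rewrite setTI; congr measurable; apply/seteqP; split => y /=; rewrite in_itv/= andbT.
Qed.

(** By separability an open set is the union of the countably many closed balls of radius
    [1 / (k + 1)] around the dense sequence that it contains. *)
Let good_open U : open U -> good U.
Proof.
move=> oU; have [d dP] := separable_dense_seq sepX.
pose B i k : set (borel X) := [set x | `|x - d i| <= k.+1%:R^-1].
pose A i k : set (borel X) := if pselect (B i k `<=` U) is left _ then B i k else set0.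
have -> : U = \bigcup_i \bigcup_k A i k.
  apply/seteqP; split=> [x Ux|x [i _ [k _]]]; last first.
    by rewrite /A; case: pselect => // BU; exact: BU.
  have /nbhs_ballP[e /= e0 eU] : nbhs x U by exact: open_nbhs_nbhs.
  have [k kP] : exists k, 2 * k.+1%:R^-1 < e.
    exists (Num.truncn (2 / e)).
    by rewrite ltr_pdivrMr// mulrC -ltr_pdivrMr//; exact: truncnS_gt.
  have [i di] : exists i, `|x - d i| < k.+1%:R^-1 by apply: dP; rewrite invr_gt0.
  exists i => //; exists k => //; rewrite /A; case: pselect => [_|[]]; first exact: ltW.
  move=> y By; apply: eU; rewrite -ball_normE /=.
  apply: le_lt_trans kP; have -> : x - y = (x - d i) - (y - d i) by rewrite opprB addrA subrK.
  by apply: le_trans (ler_normB _ _) _; rewrite mulr_natl mulr2n lerD// ltW.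
apply: good_bigcup => i; apply: good_bigcup => k; rewrite /A; case: pselect => // _.
exact: good_closed_ball.
Qed.

Let good_measurable (A : set (borel X)) : measurable A -> good A.
Proof.
apply: smallest_sub; last exact: good_open.
split=> [|B gB|B gB]; [exact: good0| |exact: good_bigcup].
by rewrite setTD; exact: goodC.
Qed.

Import HBNNSimple.

(** The constant 1 is annihilated by [I_cos], and testing [m * 1] with [cos 0] gives [I m = 0] for
    every multiplier [m]. A bounded Borel [w] is a multiplier because [w + K >= 0] is a bounded
    limit of simple functions, that is, of combinations of indicators of [good] sets. *)
Theorem trig_functional_eq0 w : bddm w -> I w = 0.
Proof.
move=> [mw [K wK]].
have A1 : annihilated (fun _ => 1).
  split=> [|l c dl]; first exact: bddm_cst.
  by under eq_fun do rewrite mul1r; exact: I_cos.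
have IM m : multiplier m -> I m = 0.
  move=> [_ /(_ _ A1)[_ /(_ _ 0 (@dual_cst0 R X))]].
  by under eq_fun do rewrite add0r cos0 !mulr1.
apply: IM.
have mwK : measurable_fun (setT : set (borel X)) (fun y : borel X => (w y + K)%:E).
  by apply/measurable_EFinP; exact: measurable_funD.
pose f := nnsfun_approx measurableT mwK.
have wK0 (y : X) : 0 <= w y + K by have := wK y; rewrite ler_norml; lra.
have fcvg y : f n y @[n --> \oo] --> w y + K.
  have := cvg_nnsfun_approx measurableT mwK (fun z _ => wK0 z : (0 <= (w z + K)%:E)%E) (Logic.I : setT y).
  by move/fine_cvg.
have fM : multiplier (fun y => w y + K).
  apply: (@multiplier_cvg (fun n => f n : X -> R) _ (2 * K)) => //.
  - move=> n.
    have E := funext (fimfunEord (f n)).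
    have -> : (f n : X -> R) = _ := E.
    apply: multiplier_sum => i; apply: multiplier_mul => //.
    set A := _ @^-1` _; suff [] : good A by [].
    exact/good_measurable/measurable_sfunP.
  - move=> n y; rewrite ger0_norm//; apply: le_trans (_ : w y + K <= _); last first.
      by have := wK y; rewrite ler_norml => /andP[_]; lra.
    rewrite -(cvg_lim _ (fcvg y))//; apply: (nondecreasing_cvgn_le (u_ := fun n => f n y)).
      by move=> a b ab; have /lefP := nd_nnsfun_approx measurableT mwK ab; exact.
    by apply/cvg_ex; exists (w y + K); exact: fcvg.
have -> : w = fun y => w y + K + - K by apply/funext => y; rewrite addrK.
exact: multiplier_add.
Qed.

End TrigUniqueness.

(** * Mean and variance of a functional *)

Lemma expR_quotient_cvg (R : realType) (x : R) (t : nat -> R) :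
  (forall n, 0 < t n) -> t n @[n --> \oo] --> (0 : R) ->
  (expR (x * t n) - 1) / t n @[n --> \oo] --> x.
Proof.
move=> t0 ct.
have cx : x * expR (x * t n) @[n --> \oo] --> x.
  rewrite -[X in _ --> X]mulr1; apply: cvgM; first exact: cvg_cst.
  rewrite -expR0 -[X in expR X](mulr0 x).
  apply: (cvg_comp (fun n => x * t n) expR); last exact: continuous_expR.
  by apply: cvgM => //; exact: cvg_cst.
apply: (squeeze_cvgr _ (cvg_cst x) cx).
apply: nearW => n; rewrite ler_pdivlMr// ler_pdivrMr//; apply/andP; split.
  by have := expR_ge1Dx (x * t n); rewrite /cst; lra.
have := expR_ge1Dx (- (x * t n)); rewrite -(ler_pM2r (expR_gt0 (x * t n))) -expRD addNr expR0.
lra.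
Qed.

Lemma normr_expR_sub1 (R : realType) (x : R) : `|expR x - 1| <= `|x| * (expR x + 1).
Proof.
have h1 := expR_ge1Dx x; have e0 := expR_gt0 x.
have h2 := expR_ge1Dx (- x).
have h3 : expR x * (1 - x) <= 1.
  have : expR x * (1 - x) <= expR x * expR (- x) by rewrite ler_wpM2l ?(ltW e0).
  by rewrite -expRD addrN expR0.
have [x0|x0] := lerP 0 x.
  by rewrite [X in X * _]ger0_norm// ler_norml; apply/andP; split; lra.
have x1 : 0 <= - x * expR x by rewrite mulr_ge0 ?(ltW e0)// oppr_ge0 ltW.
by rewrite [X in X * _]ltr0_norm// ler_norml; apply/andP; split; lra.
Qed.

Section SecondMoment.
Context (R : realType) (X : normedModType R) (gamma : probability (borel X) R).
Hypothesis gauss : centered_gaussian gamma.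
Implicit Types l m : X -> R.
Local Notation E := (expect gamma).

Definition cov (l m : X -> R) := E (fun y => l y * m y).

Lemma covC l m : cov l m = cov m l.
Proof. by rewrite /cov; under eq_fun do rewrite mulrC. Qed.

Lemma nice_cos l c : dual_elt l -> nice (fun y => cos (l y + c)).
Proof.
by move=> dl; have [mc [K cK]] := bddm_cos c dl; apply: nice_bounded mc cK.
Qed.

Lemma cov_lin a l m k : dual_elt l -> dual_elt m -> dual_elt k ->
  cov (fun y => a * l y + m y) k = a * cov l k + cov m k.
Proof.
move=> dl dm dk; have nlk := niceM (nice_dual dl) (nice_dual dk).
have nmk := niceM (nice_dual dm) (nice_dual dk).
rewrite /cov -expectZ// -expectD//; last exact: niceZ.
by congr expect; apply/funext => y; ring.
Qed.

Lemma cov_ge0 l : 0 <= cov l l.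
Proof. by apply: expect_ge0 => y; rewrite -expr2 sqr_ge0. Qed.

Lemma cov_CS l m : dual_elt l -> dual_elt m -> cov l m ^+ 2 <= cov l l * cov m m.
Proof.
move=> dl dm; apply: le_trans (expect_CS gauss (nice_dual dl) (nice_dual dm)) _.
by rewrite /cov; under eq_fun do rewrite expr2; under [X in _ * expect _ X]eq_fun do rewrite expr2.
Qed.

(** The quotients [(exp (t l) - 1) / t] tend to [l] as [t] decreases to 0, dominated by one [nice]
    function. Their first two moments come from the Laplace transform and tend to 0 and to
    [2 v - v = v], which identifies the parameter [v] with the variance. *)
Let gaussian_moments l : dual_elt l -> E l = 0 /\ 
  forall a k c, E (fun y => expR (a * l y) * cos (k * l y + c)) =
    expR ((a ^+ 2 - k ^+ 2) * cov l l / 2) * cos (c + k * a * cov l l).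
Proof.
move=> dl; have [v v0 Hv] := gaussian_exp_cos gauss dl.
have mgf a : E (fun y => expR (a * l y)) = expR (a ^+ 2 * v / 2).
  have [_] := Hv a 0 0; rewrite expr0n/= subr0 !mul0r addr0 cos0 mulr1 => <-.
  by congr expect; apply/funext => y; rewrite mul0r addr0 cos0 mulr1.
have nexp a : nice (fun y => expR (a * l y)) by apply: nice_expR; exact: dual_scale.
pose t n : R := n.+1%:R^-1.
have t0 n : 0 < t n by rewrite invr_gt0.
have ct : t n @[n --> \oo] --> (0 : R) by exact: cvg_harmonic.
have nl := nice_dual dl.
pose D n y := (expR (l y * t n) - 1) / t n.
have nD n : nice (D n).
  rewrite /D; under eq_fun do rewrite mulrC (mulrC (l _)).
  by apply: niceZ; apply: niceB => //; exact: nice_cst.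
pose G y := `|l y| * (expR (l y) + 1 + 1).
have nG : nice G.
  apply: niceM; first exact: nice_norm.
  do 2 (apply: niceD; last exact: nice_cst); exact: nice_expR.
have DG n y : `|D n y| <= G y.
  have ti0 : 0 < (t n)^-1 by rewrite invr_gt0.
  rewrite /D normrM (gtr0_norm ti0) ler_pdivrMr//.
  apply: le_trans (normr_expR_sub1 _) _; rewrite normrM (gtr0_norm (t0 n)).
  rewrite /G mulrAC; apply: ler_wpM2r; first exact: ltW.
  rewrite ler_wpM2l// lerD2r.
  have t1 : t n <= 1 by rewrite invf_le1// ler1n.
  have [ly|ly] := lerP 0 (l y).
    by apply: ler_wpDr => //; rewrite ler_expR ler_piMr.
  apply: ler_wpDl; first exact: expR_ge0.
  by rewrite -expR0 ler_expR nmulr_rle0// ltW.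
have cD y : D n y @[n --> \oo] --> l y by exact: expR_quotient_cvg.
have c1 : E (D n) @[n --> \oo] --> E l.
  by apply: expect_dominated_cvg DG cD => // n; have [] := nD n.
have c2 : E (fun y => D n y ^+ 2) @[n --> \oo] --> E (fun y => l y ^+ 2).
  apply: (@expect_dominated_cvg _ _ _ gauss _ _ (fun y => G y ^+ 2)).
  - exact: niceX.
  - by move=> n; have [] := niceX 2 (nD n).
  - by move=> n y; rewrite normrX lerXn2r ?nnegrE// (le_trans _ (DG n y)).
  - by move=> y; apply: cvg_sqr; exact: cD.
have e1 n : E (D n) = (expR (v / 2 * t n ^+ 2) - 1) / t n ^+ 2 * t n.
  have -> : E (D n) = (t n)^-1 * (E (fun y => expR (t n * l y)) - 1).
    rewrite -[X in _ - X](expect_cst gamma) -expectB//; last exact: nice_cst.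
    rewrite -expectZ//; last by apply: niceB => //; exact: nice_cst.
    by congr expect; apply/funext => y; rewrite [RHS]mulrC (mulrC (t n) (l y)).
  rewrite mgf [v / 2 * _]mulrC mulrA; field; exact: lt0r_neq0.
have e2 n : E (fun y => D n y ^+ 2) = (expR (2 * v * t n ^+ 2) - 1) / t n ^+ 2 - 2 * ((expR (v / 2 * t n ^+ 2) - 1) / t n ^+ 2).
  have -> : E (fun y => D n y ^+ 2) = (t n ^+ 2)^-1 *
      (E (fun y => expR (2 * t n * l y)) - 2 * E (fun y => expR (t n * l y)) + 1).
    rewrite -[X in _ + X](expect_cst gamma) -expectZ// -expectB//; last exact: niceZ.
    have n1 : nice (fun _ : X => 1 : R) by exact: nice_cst.
    have n2 := niceB (nexp (2 * t n)) (niceZ 2 (nexp (t n))).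
    rewrite -expectD// -expectZ//; last exact: niceD.
    congr expect; apply/funext => y; rewrite /D (mulrC (l y)) -mulrA.
    rewrite expRM_natl.
    field; exact: lt0r_neq0.
  rewrite !mgf; have -> : (2 * t n) ^+ 2 * v / 2 = 2 * v * t n ^+ 2 by field.
  rewrite (_ : t n ^+ 2 * v / 2 = v / 2 * t n ^+ 2); last by field.
  by field; exact: lt0r_neq0.
have t20 n : 0 < t n ^+ 2 by rewrite exprn_gt0.
have ct2 : t n ^+ 2 @[n --> \oo] --> (0 : R).
  by have := cvg_sqr ct; rewrite expr0n.
have El : E l = 0.
  apply: (cvg_unique _ c1); first exact: norm_hausdorff.
  rewrite (funext e1) /=.
  rewrite -[X in _ --> X](mulr0 (v / 2)); apply: cvgM => //.
  exact: expR_quotient_cvg.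
have Ev : cov l l = v.
  have -> : cov l l = E (fun y => l y ^+ 2) by congr expect; apply/funext => y; rewrite expr2.
  apply: (cvg_unique _ c2); first exact: norm_hausdorff.
  rewrite (funext e2) /=.
  rewrite [X in _ --> X](_ : v = 2 * v - 2 * (v / 2)); last by field.
  by apply: cvgB; [|apply: cvgM; first exact: cvg_cst]; exact: expR_quotient_cvg.
by split=> // a k c; rewrite Ev; have [] := Hv a k c.
Qed.

Lemma cov_opp l : cov (fun y => - l y) (fun y => - l y) = cov l l.
Proof. by rewrite /cov; congr expect; apply/funext => y; rewrite mulrNN. Qed.

Lemma expect_dual l : dual_elt l -> E l = 0.
Proof. by move=> /gaussian_moments[]. Qed.

Lemma expect_exp_cos l : dual_elt l -> forall a k c,
  E (fun y => expR (a * l y) * cos (k * l y + c)) =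
    expR ((a ^+ 2 - k ^+ 2) * cov l l / 2) * cos (c + k * a * cov l l).
Proof. by move=> /gaussian_moments[]. Qed.

Lemma expect_expR l : dual_elt l -> E (fun y => expR (l y)) = expR (cov l l / 2).
Proof.
move=> dl; have := expect_exp_cos dl 1 0 0.
rewrite expr1n expr0n/= subr0 mul1r !mul0r addr0 cos0 mulr1 => <-.
by congr expect; apply/funext => y; rewrite mul1r mul0r addr0 cos0 mulr1.
Qed.

Lemma expect_cos l c : dual_elt l -> E (fun y => cos (l y + c)) = expR (- (cov l l / 2)) * cos c.
Proof.
move=> dl; have := expect_exp_cos dl 0 1 c.
rewrite expr1n expr0n/= sub0r mulN1r mulr0 mul0r addr0 mulNr => <-.
by congr expect; apply/funext => y; rewrite mul0r expR0 !mul1r.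
Qed.

Lemma cov_addl l m k : dual_elt l -> dual_elt m -> dual_elt k ->
  cov (fun y => l y + m y) k = cov l k + cov m k.
Proof.
move=> dl dm dk; rewrite -[cov l k]mul1r -cov_lin//.
by congr expect; apply/funext => y; rewrite mul1r.
Qed.

Lemma cov_scalel a l k : dual_elt l -> dual_elt k -> cov (fun y => a * l y) k = a * cov l k.
Proof.
move=> dl dk; rewrite /cov -expectZ//; last by apply: niceM; exact: nice_dual.
by congr expect; apply/funext => y; rewrite mulrA.
Qed.

End SecondMoment.

(** * Independence of uncorrelated functionals, and the tilted cosine *)

Lemma continuous_borel_borel (R : realType) (X Y : normedModType R) (f : X -> Y) :
  continuous f -> measurable_fun (setT : set (borel X)) (f : borel X -> borel Y).
Proof.
move=> /continuousP cf; apply: (@measurability _ _ (borel X) (borel Y) setT f (@open Y) erefl).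
move=> _ [B oB <-]; rewrite setTI; apply: sub_sigma_algebra; exact: cf.
Qed.

(** Lets the trigonometric uniqueness theorem be applied to functions of one real variable. *)
Lemma separable_real (R : realType) : separable_space (R^o : normedModType R).
Proof.
exists (range (@ratr R)); split.
  exact: card_le_trans (card_image_le _ _) (countableP _).
apply/seteqP; split=> // x _ B /nbhs_ballP[e /= e0 eB].
have [z [xz Qz]] := @dense_rat R (ball x e) (ex_intro _ x (ballxx _ e0)) (ball_open _ _).
by exists z; split; [case: Qz => q _ <-; exists q|exact: eB].
Qed.

Section CameronMartin.
Context (R : realType) (X : normedModType R) (gamma : probability (borel X) R).
Hypothesis gauss : centered_gaussian gamma.
Implicit Types l m : X -> R.
Local Notation E := (expect gamma).
Local Notation cov := (cov gamma).

Lemma bddm_comp_dual l (g : R^o -> R) : dual_elt l -> bddm g -> bddm (fun y => g (l y)).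
Proof.
move=> dl [mg [K gK]]; split; last by exists K.
apply: (measurableT_comp (f := g : borel R^o -> R)) => //.
by apply: (@continuous_borel_borel R X R^o); case: dl.
Qed.

Lemma bddm_nice (f : X -> R) : bddm f -> nice f.
Proof. by move=> [mf [K fK]]; exact: nice_bounded fK. Qed.

Lemma dual_real (k : R^o -> R) : dual_elt k -> k = fun x => k 1 * x.
Proof. by move=> dk; apply/funext => x; rewrite mulrC -dual_eltZ// /GRing.scale/= mulr1. Qed.

(** As a functional of [g] the difference of the two sides lives on the real line, so that [g] may
    be taken to be a cosine. The product of cosines then splits into cosines of [m + s l] and
    [m - s l], which have the same variance because [m] and [l] are uncorrelated. *)
Lemma independent_dual m l d : dual_elt m -> dual_elt l -> cov m l = 0 ->
  forall g : R^o -> R, bddm g ->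
  E (fun y => cos (m y + d) * g (l y)) = E (fun y => cos (m y + d)) * E (fun y => g (l y)).
Proof.
move=> dm dl ml0 g bg.
have bcm := bddm_cos d dm.
apply/eqP; rewrite -subr_eq0; apply/eqP.
pose J (g : R^o -> R) := E (fun y => cos (m y + d) * g (l y)) - E (fun y => cos (m y + d)) * E (fun y => g (l y)).
have nc g' : bddm g' -> nice (fun y => g' (l y)).
  by move=> bg'; apply: bddm_nice; exact: bddm_comp_dual.
have ncc g' : bddm g' -> nice (fun y => cos (m y + d) * g' (l y)).
  by move=> bg'; apply: bddm_nice; apply: bddm_mul => //; exact: bddm_comp_dual.
apply: (@trig_functional_eq0 _ _ (@separable_real R) J) bg.
- move=> f1 f2 b1 b2; rewrite /J (expectD gauss (nc _ b1) (nc _ b2)).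
  under eq_fun do rewrite mulrDr.
  by rewrite (expectD gauss (ncc _ b1) (ncc _ b2)); ring.
- move=> r f1 b1; rewrite /J (expectZ gauss _ (nc _ b1)).
  under eq_fun do rewrite mulrCA.
  by rewrite (expectZ gauss _ (ncc _ b1)); ring.
- move=> f_ f K mf fK cf.
  have nK : nice (fun _ : X => K) by exact: nice_cst.
  have bf n : bddm (f_ n) by split=> //; exists K.
  apply: cvgB.
    apply: (expect_dominated_cvg gauss nK).
    + by move=> n; have [] := ncc _ (bf n).
    + by move=> n y; rewrite normrM; apply: le_trans (fK n (l y)); rewrite ler_piMl// cos_max.
    + by move=> y; apply: cvgM; [exact: cvg_cst|exact: cf].
  apply: cvgM; first exact: cvg_cst.
  apply: (expect_dominated_cvg gauss nK) => //.
  by move=> n; have [] := nc _ (bf n).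
- move=> k c dk; rewrite /J (dual_real dk); move: (k 1) => s {dk k}.
  have dsl := dual_scale s dl.
  have e y : cos (m y + d) * cos (s * l y + c) =
    2^-1 * cos ((m y + s * l y) + (d + c)) + 2^-1 * cos ((m y - s * l y) + (d - c)).
    rewrite (_ : m y + s * l y + (d + c) = (m y + d) + (s * l y + c)); last by ring.
    rewrite (_ : m y - s * l y + (d - c) = (m y + d) - (s * l y + c)); last by ring.
    by move: (m y + d) (s * l y + c) => a b; rewrite cosB cosD; field.
  under eq_fun do rewrite e.
  have d1 := dual_add dm dsl; have d2 := dual_sub dm dsl.
  rewrite expectD// ?expectZ//; try (by apply: niceZ; exact: nice_cos); try exact: nice_cos.
  rewrite !expect_cos//.
  have q1 : cov (fun y => m y + s * l y) (fun y => m y + s * l y) = cov m m + s ^+ 2 * cov l l.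
    rewrite cov_addl// cov_scalel// ![cov _ (fun y => _ + _)]covC !cov_addl// !cov_scalel//.
    by rewrite ml0 (covC _ l) ml0; ring.
  have q2 : cov (fun y => m y - s * l y) (fun y => m y - s * l y) = cov m m + s ^+ 2 * cov l l.
    have -> : (fun y => m y - s * l y) = (fun y => m y + (- s) * l y).
      by apply/funext => y; rewrite mulNr.
    have dsl' := dual_scale (- s) dl.
    rewrite cov_addl//; last exact: dual_add.
    rewrite cov_scalel//; last exact: dual_add.
    rewrite ![cov _ (fun y => _ + _)]covC !cov_addl// !cov_scalel//.
    by rewrite ml0 (covC _ l) ml0; ring.
  have q3 : cov (fun y => s * l y) (fun y => s * l y) = s ^+ 2 * cov l l.
    by rewrite cov_scalel// covC cov_scalel//; ring.
  rewrite q1 q2 q3 cosB cosD.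
  rewrite (_ : - ((cov m m + s ^+ 2 * cov l l) / 2) = - (cov m m / 2) - (s ^+ 2 * cov l l / 2)); last by field.
  by rewrite expRD; field.
Qed.

Let independent_exp_cos m l d k c : dual_elt m -> dual_elt l -> cov m l = 0 ->
  E (fun y => cos (m y + d) * (expR (l y) * cos (k * l y + c))) =
  E (fun y => cos (m y + d)) * E (fun y => expR (l y) * cos (k * l y + c)).
Proof.
move=> dm dl ml0.
(* The exponential is unbounded; capping its argument at [n + 1] gives bounded functions that are
   dominated by [expR]. *)
pose g n (x : R^o) := expR (Num.min x n.+1%:R) * cos (k * x + c).
have gE n x : `|g n x| <= expR x.
  rewrite normrM ger0_norm ?expR_ge0// -[leRHS]mulr1 ler_pM ?expR_ge0 ?cos_max//.
  by rewrite ler_expR ge_min lexx.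
have bg n : bddm (g n).
  split; last first.
    exists (expR n.+1%:R) => x.
    rewrite normrM ger0_norm ?expR_ge0// -[leRHS]mulr1 ler_pM ?expR_ge0 ?cos_max//.
    by rewrite ler_expR ge_min lexx orbT.
  have mid : measurable_fun (setT : set (borel R^o)) (idfun : borel R^o -> R).
    by apply: (@continuous_borel_measurable R R^o) => x; exact: cvg_id.
  apply: measurable_funM.
    apply: (measurableT_comp (@measurable_expR R)); exact: measurable_minr.
  apply: (measurableT_comp (continuous_measurable_fun (@continuous_cos R))).
  by apply: measurable_funD => //; exact: measurable_funM.
have gcvg x : g n x @[n --> \oo] --> expR x * cos (k * x + c).
  apply: cvg_near_cst; near=> n; rewrite /g min_l//.
  by near: n; exact: near_infty_ger_succ.
have nel := nice_expR dl.
have c1 : E (fun y => cos (m y + d) * g n (l y)) @[n --> \oo] -->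
    E (fun y => cos (m y + d) * (expR (l y) * cos (k * l y + c))).
  apply: (expect_dominated_cvg gauss nel).
  - move=> n; apply: measurable_funM; first by have [] := bddm_cos d dm.
    by have [] := bddm_comp_dual dl (bg n).
  - by move=> n y; rewrite normrM; apply: le_trans (gE n (l y)); rewrite ler_piMl// cos_max.
  - by move=> y; apply: cvgM; [exact: cvg_cst|exact: gcvg].
have c2 : E (fun y => g n (l y)) @[n --> \oo] --> E (fun y => expR (l y) * cos (k * l y + c)).
  apply: (expect_dominated_cvg gauss nel) => [n|n y|y]; [|exact: gE|exact: gcvg].
  by have [] := bddm_comp_dual dl (bg n).
apply: (cvg_unique _ c1); first exact: norm_hausdorff.
have -> : (fun n => E (fun y => cos (m y + d) * g n (l y))) =
    (fun n => E (fun y => cos (m y + d)) * E (fun y => g n (l y))).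
  by apply/funext => n; exact: independent_dual.
by apply: cvgM => //; exact: cvg_cst.
Unshelve. all: by end_near. Qed.

(* Split [m] into a multiple of [l] and a part uncorrelated with, hence independent of, [l]. *)
Lemma expect_cos_expR m l c : dual_elt m -> dual_elt l ->
  E (fun y => cos (m y + c) * expR (l y)) =
  expR ((cov l l - cov m m) / 2) * cos (c + cov m l).
Proof.
move=> dm dl.
pose k := cov m l / cov l l; pose m' y := (- k) * l y + m y.
have dm' : dual_elt m' by exact: dual_lin.
have kl : k * cov l l = cov m l.
  (* For [cov l l = 0] the quotient [k] is 0 by the convention on division by 0, and Cauchy-Schwarz
     makes [cov m l] vanish as well. *)
  rewrite /k; have [l0|l0] := eqVneq (cov l l) 0; last by rewrite divfK.
  have := cov_CS gauss dm dl; rewrite l0 !mulr0 => ml.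
  by apply/esym/eqP; rewrite -sqrf_eq0 eq_le ml sqr_ge0.
have m'l : cov m' l = 0 by rewrite /m' cov_lin// mulNr kl addNr.
have m'm' : cov m' m' = cov m m - k ^+ 2 * cov l l.
  rewrite {1}/m' cov_lin// (covC gamma l) m'l mulr0 add0r covC /m' cov_lin// (covC gamma l) -kl; ring.
(* Addition formula, with sines written as cosines shifted by a quarter turn. The second product
   contributes nothing, since the expectation of its first factor is a multiple of
   [cos (pi / 2)]. *)
have e y : cos (m y + c) * expR (l y) = cos (m' y + 0) * (expR (l y) * cos (k * l y + c))
    + cos (m' y + (pi / 2)) * (expR (l y) * cos (k * l y + (c - pi / 2))).
  rewrite (_ : m y + c = m' y + (k * l y + c)); last by rewrite /m'; ring.
  rewrite addr0 cosDpihalf [_ + (c - pi / 2)]addrA cosBpihalf cosD; ring.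
have nc d d' : nice (fun y => cos (m' y + d) * (expR (l y) * cos (k * l y + d'))).
  by repeat (apply: niceM; [first [exact: nice_cos|exact: nice_expR]|]); apply: nice_cos; exact: dual_scale.
under eq_fun do rewrite e.
rewrite expectD// !independent_exp_cos// !expect_cos// cos_pihalf mulr0 mul0r addr0 cos0 mulr1.
have := expect_exp_cos gauss dl 1 k c.
under eq_fun do rewrite mul1r.
move=> ->; rewrite mulrA -expRD mulr1 kl m'm' expr1n; congr (expR _ * _); by field.
Qed.

End CameronMartin.

(** * The Cameron-Martin formula *)

Section Shift.
Context (R : realType) (X : normedModType R) (gamma : probability (borel X) R).
Hypothesis sepX : separable_space X.
Hypothesis gauss : centered_gaussian gamma.
Implicit Types l m w : X -> R.
Local Notation E := (expect gamma).
Local Notation cov := (cov gamma).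

Lemma bmeas_comp w (phi : X -> X) : continuous phi -> bmeas w -> bmeas (w \o phi).
Proof.
move=> cphi mw; apply: (measurableT_comp (f := w : borel X -> R) mw).
exact: (continuous_borel_borel cphi).
Qed.

Lemma nice_sum (I : finType) (f : I -> X -> R) : (forall i, nice (f i)) ->
  nice (fun y => \sum_i f i y).
Proof.
move=> nf; rewrite (_ : (fun y => _) = \sum_i f i); last by apply/funext => y; rewrite fct_sumE.
by apply: big_ind => // [|g h]; [exact: nice_cst|exact: niceD].
Qed.

Lemma nice_shift w h : nice w -> nice (fun y => w (y + h)).
Proof.
move=> [mw [I [L [dL wL]]]].
apply: (nice_le (g := fun y => \sum_i expR (L i h) * expR (L i y))).
- apply: (bmeas_comp (phi := fun y => y + h)) mw => x.
  by apply: cvgD; [exact: cvg_id|exact: cvg_cst].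
- by apply: nice_sum => i; apply: niceZ; exact: nice_expR.
- move=> y; apply: le_trans (wL _) _; rewrite ger0_norm; last first.
    by apply: sumr_ge0 => i _; rewrite mulr_ge0// expR_ge0.
  by apply: ler_sum => i _; rewrite dual_eltD// expRD mulrC.
Qed.

Definition cm_density l y := expR (l y - cov l l / 2).

Lemma cm_densityE l : cm_density l = fun y => expR (- (cov l l / 2)) * expR (l y).
Proof. by apply/funext => y; rewrite /cm_density addrC expRD. Qed.

Lemma nice_cm_density l : dual_elt l -> nice (cm_density l).
Proof. by move=> dl; rewrite cm_densityE; apply: niceZ; exact: nice_expR. Qed.

Let cameron_martin_bounded l h w : dual_elt l ->
  (forall m, dual_elt m -> m h = cov m l) -> bddm w ->
  E (fun y => w (y + h)) = E (fun y => w y * cm_density l y).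
Proof.
move=> dl hl bw.
have nd := nice_cm_density dl.
have shc : continuous (fun y : X => y + h).
  by move=> x; apply: cvgD; [exact: cvg_id|exact: cvg_cst].
have nice1 f : bddm f -> nice (fun y => f (y + h)).
  by move=> /bddm_nice nf; exact: nice_shift.
have nice2 f : bddm f -> nice (fun y => f y * cm_density l y).
  by move=> /bddm_nice nf; exact: niceM.
apply/eqP; rewrite -subr_eq0; apply/eqP.
pose I (f : X -> R) := E (fun y => f (y + h)) - E (fun y => f y * cm_density l y).
apply: (@trig_functional_eq0 _ _ sepX I) bw => {w}.
- move=> f1 f2 b1 b2; rewrite /I (expectD gauss (nice1 _ b1) (nice1 _ b2)).
  under [X in _ - E X]eq_fun do rewrite mulrDl.
  by rewrite (expectD gauss (nice2 _ b1) (nice2 _ b2)); ring.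
- move=> r f1 b1; rewrite /I (expectZ gauss _ (nice1 _ b1)).
  under [X in _ - E X]eq_fun do rewrite -mulrA.
  by rewrite (expectZ gauss _ (nice2 _ b1)); ring.
- move=> f_ f K mf fK cf.
  have bf n : bddm (f_ n) by split=> //; exists K.
  apply: cvgB.
    apply: (expect_dominated_cvg gauss (nice_cst X K)) => // n.
    by have [] := nice1 _ (bf n).
  apply: (expect_dominated_cvg gauss (niceZ K nd)).
  + by move=> n; have [] := nice2 _ (bf n).
  + by move=> n y; rewrite normrM [X in _ * X]ger0_norm ?expR_ge0// ler_wpM2r ?expR_ge0.
  + by move=> y; apply: cvgM => //; exact: cvg_cst.
- move=> m c dm; rewrite /I cm_densityE.
  have -> : E (fun y => cos (m (y + h) + c)) = E (fun y => cos (m y + (m h + c))).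
    by congr expect; apply/funext => y; rewrite dual_eltD// addrA.
  under [X in _ - E X]eq_fun do rewrite mulrCA.
  rewrite expectZ//; last by apply: niceM; [exact: nice_cos|exact: nice_expR].
  rewrite expect_cos// expect_cos_expR// mulrA -expRD hl// (addrC c).
  by rewrite (_ : - (cov l l / 2) + _ = - (cov m m / 2)) ?subrr//; field.
Qed.

(** Truncation at [n + 1] passes from bounded to [nice] functions; the formula is applied below to
    products with functionals, which are unbounded. *)
Theorem cameron_martin l h w : dual_elt l ->
  (forall m, dual_elt m -> m h = cov m l) -> nice w ->
  E (fun y => w (y + h)) = E (fun y => w y * cm_density l y).
Proof.
move=> dl hl nw; have [mw _] := nw.
pose w_ n (y : X) := Num.max (- n.+1%:R) (Num.min (w y) n.+1%:R).
have w_bd n y : `|w_ n y| <= n.+1%:R.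
  rewrite ler_norml /w_ le_max lexx /= ge_max ge_min lexx orbT andbT.
  by apply: le_trans (ler0n _ _); rewrite oppr_le0.
have w_le n y : `|w_ n y| <= `|w y|.
  have n0 : 0 <= n.+1%:R :> R by [].
  rewrite /w_; case: (lerP (w y) n.+1%:R) => h1.
    case: (lerP (- n.+1%:R) (w y)) => h2; first by [].
    by rewrite normrN ger0_norm// ltr0_norm; lra.
  by rewrite max_r; [rewrite !ger0_norm; lra|lra].
have bw n : bddm (w_ n).
  split; last by exists n.+1%:R.
  by apply: measurable_maxr => //; exact: measurable_minr.
have w_cvg y : w_ n y @[n --> \oo] --> w y.
  apply: cvg_near_cst; near=> n.
  have : `|w y| <= n.+1%:R by near: n; exact: near_infty_ger_succ.
  by rewrite ler_norml /w_ => /andP[h1 h2]; rewrite min_l// max_r.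
have nd := nice_cm_density dl.
have c1 : E (fun y => w_ n (y + h)) @[n --> \oo] --> E (fun y => w (y + h)).
  apply: (expect_dominated_cvg gauss (nice_norm (nice_shift h nw))) => // n.
  by have [] := nice_shift h (bddm_nice (bw n)).
have c2 : E (fun y => w_ n y * cm_density l y) @[n --> \oo] --> E (fun y => w y * cm_density l y).
  apply: (expect_dominated_cvg gauss (niceM (nice_norm nw) nd)).
  - by move=> n; have [] := niceM (bddm_nice (bw n)) nd.
  - by move=> n y; rewrite normrM [X in _ * X]ger0_norm ?expR_ge0// ler_wpM2r ?expR_ge0.
  - by move=> y; apply: cvgM => //; exact: cvg_cst.
apply: (cvg_unique _ c1); first exact: norm_hausdorff.
rewrite (_ : (fun n => _) = fun n => E (fun y => w_ n y * cm_density l y)) //.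
by apply/funext => n; exact: cameron_martin_bounded.
Unshelve. all: by end_near. Qed.

End Shift.

(** * Pettis representation of functionals bounded in [L^2] *)

Lemma normr_1Bcos (R : realType) (x : R) : `|1 - cos x| <= `|x|.
Proof.
have pos (y : R) : 0 < y -> `|1 - cos y| <= y.
  move=> y0.
  have dc z : z \in `]0, y[ -> is_derive z 1 (@cos R) (- sin z).
    by move=> _; exact: is_derive_cos.
  have cc : {within `[0, y], continuous (@cos R)}.
    by apply: continuous_subspaceT => z; exact: continuous_cos.
  have [z _] := MVT y0 dc cc; rewrite cos0 subr0 distrC => ->.
  by rewrite normrM normrN (gtr0_norm y0) ler_piMl ?sin_max// ltW.
have [x0|x0|->] := ltgtP x 0; last by rewrite cos0 subrr normr0.
- by rewrite -cosN (ltr0_norm x0) pos// oppr_gt0.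
- by rewrite (gtr0_norm x0) pos.
Qed.

Section Pettis.
Context (R : realType) (X : completeNormedModType R) (gamma : probability (borel X) R).
Hypothesis sepX : separable_space X.
Hypothesis gauss : centered_gaussian gamma.
Implicit Types l m w : X -> R.
Local Notation E := (expect gamma).
Local Notation cov := (cov gamma).

Lemma bmeas_norm : bmeas (fun y : X => `|y|).
Proof. by apply: continuous_borel_measurable => x; exact: norm_continuous. Qed.

(* If [gamma] puts most of its mass on a ball, the characteristic function of [m] is bounded below at one point. *)
Lemma dual_variance_bound : exists2 c : R, 0 < c &
  forall m, dual_elt m -> (forall y, `|m y| <= `|y|) -> cov m m <= c.
Proof.
pose phi n (y : X) := Num.min 1 (n.+1%:R^-1 * `|y|).
have mphi n : bmeas (phi n).
  by apply: measurable_minr => //; apply: measurable_funM => //; exact: bmeas_norm.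
have phi0 n y : 0 <= phi n y by rewrite le_min ler01 mulr_ge0.
have cphi : E (phi n) @[n --> \oo] --> E (fun _ => 0).
  apply: (expect_dominated_cvg gauss (nice_cst X 1)) => // [n y|y].
    by rewrite ger0_norm// ge_min lexx.
  have c0 : n.+1%:R^-1 * `|y| @[n --> \oo] --> (0 : R).
    by rewrite -[X in _ --> X](mul0r `|y|); apply: cvgM; [exact: cvg_harmonic|exact: cvg_cst].
  apply: (squeeze_cvgr _ (cvg_cst 0) c0).
  by apply: nearW => n; rewrite phi0 ge_min lexx orbT.
rewrite expect_cst in cphi.
(* The level 1/4 gives [E cos (k m) >= 1/2], that is [exp (- k^2 cov m m / 2) >= 1/2], whence
   [cov m m <= 2 / k^2]. *)
have [|N _ /(_ N (leqnn N)) HN] := @cvgr_le _ _ _ _ _ _ cphi 4^-1; first by rewrite invr_gt0.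
have nphi : nice (phi N).
  by apply: (nice_bounded (K := 1)) => // y; rewrite ger0_norm// ge_min lexx.
pose k : R := N.+1%:R^-1.
have k0 : 0 < k by rewrite invr_gt0.
exists (2 / k ^+ 2) => [|m dm m1]; first by rewrite divr_gt0// exprn_gt0.
have dkm := dual_scale k dm.
have nc := nice_cos 0 dkm.
have : E (fun y => 1 - 2 * phi N y) <= E (fun y => cos (k * m y + 0)).
  apply: expect_le => //; first by apply: niceB; [exact: nice_cst|exact: niceZ].
  move=> y; rewrite addr0.
  have h1 : 1 - cos (k * m y) <= 2 by have := cos_max (k * m y); rewrite ler_norml => /andP[]; lra.
  have h2 : 1 - cos (k * m y) <= k * `|y|.
    apply: le_trans (ler_norm _) _; apply: le_trans (normr_1Bcos _) _.
    by rewrite normrM (gtr0_norm k0); apply: ler_wpM2l => //; exact: ltW.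
  have h3 : 0 <= k * `|y| by rewrite mulr_ge0// ltW.
  by rewrite /phi -/k; case: (lerP 1 (k * `|y|)); lra.
rewrite expect_cos// cos0 mulr1 expectB//; [|exact: nice_cst|exact: niceZ].
rewrite expect_cst expectZ//.
rewrite cov_scalel// covC cov_scalel// mulrA -expr2.
set z := _ / 2 => h.
have h1 : 2^-1 <= expR (- z) by lra.
have h2 := expR_ge1Dx z.
have h3 : 2^-1 * expR z <= 1.
  by move: h1; rewrite -(ler_pM2r (expR_gt0 z)) -expRD addNr expR0.
have : z <= 1 by lra.
by rewrite /z ler_pdivrMr// mul1r mulrC -ler_pdivlMr// exprn_gt0.
Qed.

(** Follows from [x^4 <= 4! exp |x|]. A bound through [cov m m] alone controls [m ^+ 2] on sets of
    small measure uniformly over the unit functionals. *)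
Lemma expect_pow4_le m : dual_elt m ->
  E (fun y => m y ^+ 4) <= 48 * expR (cov m m / 2).
Proof.
move=> dm; have dNm := dual_opp dm.
have n1 := nice_expR dm; have n2 := nice_expR dNm.
have -> : 48 * expR (cov m m / 2) = E (fun y => 24 * (expR (m y) + expR (- m y))).
  rewrite expectZ ?expectD ?expect_expR//; last exact: niceD.
  rewrite cov_opp; ring.
apply: expect_le => //; [exact/niceX/nice_dual|by apply: niceZ; exact: niceD|].
move=> y; set x := m y.
have pos (z : R) : 0 <= z -> z ^+ 4 <= 24 * expR z.
  move=> z0; have := expR_ge1Dxn 3 z0; rewrite (_ : 4`! = 24)// => h.
  by rewrite -ler_pdivrMl// mulrC; apply: le_trans h; rewrite ler_wpDl.
have [x0|x0] := lerP 0 x.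
  by apply: le_trans (pos _ x0) _; rewrite ler_wpM2l// ler_wpDr// expR_ge0.
have -> : x ^+ 4 = (- x) ^+ 4 by ring.
have nx0 : 0 <= - x by rewrite oppr_ge0 ltW.
by apply: le_trans (pos _ nx0) _; rewrite ler_wpM2l// ler_wpDl// expR_ge0.
Qed.

Lemma dual_bounded m : dual_elt m -> exists2 K, 0 < K & forall y, `|m y| <= K * `|y|.
Proof.
move=> dm; have cm : m x @[x --> (0 : X)] --> m 0 by case: dm => _; apply.
have /cvgrPdist_le/(_ _ ltr01)/nbhs_ballP[e /= e0 em] := cm.
exists (2 / e) => [|y]; first by rewrite divr_gt0.
have [->|y0] := eqVneq y 0; first by rewrite dual_elt0// !normr0 mulr0.
have ny : 0 < `|y| by rewrite normr_gt0.
have := em ((e / 2 / `|y|) *: y).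
rewrite /= dual_elt0// sub0r normrN dual_eltZ// normrM => h.
have a0 : 0 < e / 2 / `|y| by rewrite !divr_gt0.
have {}h : e / 2 / `|y| * `|m y| <= 1.
  rewrite -[X in X * _](gtr0_norm a0); apply: h.
  rewrite -ball_normE /= sub0r normrN normrZ (gtr0_norm a0) divfK ?gt_eqF//.
  by rewrite ltr_pdivrMr// ltr_pMr// ltr1n.
move: h; rewrite -ler_pdivlMl// mulr1; congr (_ <= _).
by field; rewrite !gt_eqF.
Qed.

(* A functional that is bounded in [L^2] is represented by a vector of [X]: it is approximated by its values on the
   indicators of a countable partition into small sets, uniformly over the duals of norm at most one. *)
Theorem pettis (Gam : (X -> R) -> R) C :
  (forall f g, nice f -> nice g -> Gam (fun y => f y + g y) = Gam f + Gam g) ->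
  (forall r f, nice f -> Gam (fun y => r * f y) = r * Gam f) ->
  (forall f, nice f -> Gam f ^+ 2 <= C * E (fun y => f y ^+ 2)) -> 0 <= C ->
  exists g : X, forall m, dual_elt m -> Gam m = m g.
Proof.
move=> GamD GamZ GamE C0.
have [d dP] := separable_dense_seq sepX.
have [c c0 cP] := dual_variance_bound.
have Gam0 : Gam (fun _ => 0) = 0.
  have := GamZ 0 (fun _ => 0) (nice_cst X 0).
  by under eq_fun do rewrite mul0r; rewrite mul0r.
pose B e i : set (borel X) := [set y | `|y - d i| < e].
have mB e i : measurable (B e i).
  apply: sub_sigma_algebra; rewrite (_ : B e i = ball (d i) e); last first.
    by apply/seteqP; split=> y; rewrite /B -ball_normE /= distrC.
  exact: ball_open.
pose U e n : set (borel X) := \big[setU/set0]_(k < n) B e k.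
have mU e n : measurable (U e n) by apply: bigsetU_measurable.
pose A e k : set (borel X) := B e k `\` U e k.
have mA e k : measurable (A e k) by apply: measurableD.
have nind (S : set (borel X)) : measurable S -> nice (\1_S : X -> R).
  move=> mS; apply: (nice_bounded (K := 1)) => [|y]; first exact: measurable_indic.
  by rewrite indicE ger0_norm// lern1; case: (_ \in _).
pose s e m n (y : X) := \sum_(k < n) m (d k) * (\1_(A e k) : X -> R) y.
have ns e m n : nice (s e m n) by apply: nice_sum => i; apply: niceZ; exact: nind.
have s_in e m n y : dual_elt m -> (forall y, `|m y| <= `|y|) ->
    (U e n y -> `|m y - s e m n y| <= e) /\ (~ U e n y -> s e m n y = 0).
  move=> dm m1; elim: n => [|n [IH1 IH2]].
    by rewrite /U /s !big_ord0.
  have sS : s e m n.+1 y = s e m n y + m (d n) * (\1_(A e n) : X -> R) y.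
    by rewrite /s big_ord_recr.
  rewrite sS indicE {1 2}/U big_ord_recr -/(U e n) /=; split.
    have [Uy _|nUy [//|By]] := pselect (U e n y).
      by rewrite memNset ?mulr0 ?addr0; [exact: IH1|case].
    rewrite mem_set// mulr1 IH2// add0r -dual_eltB//.
    by apply: le_trans (m1 _) _; exact: ltW.
  move=> nUB; rewrite IH2; last by move=> Uy; apply: nUB; left.
  by rewrite memNset ?mulr0 ?addr0// => -[By _]; apply: nUB; right.
have s_rep e m n : dual_elt m -> Gam (s e m n) = m (\sum_(k < n) Gam (\1_(A e k) : X -> R) *: d k).
  move=> dm; elim: n => [|n IH].
    rewrite big_ord0 dual_elt0// (_ : s e m 0%N = fun _ => 0)//.
    by apply/funext => y; rewrite /s big_ord0.
  rewrite big_ord_recr /= dual_eltD// dual_eltZ// -IH.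
  rewrite (_ : s e m n.+1 = fun y => s e m n y + m (d n) * (\1_(A e n) : X -> R) y).
    by rewrite GamD ?GamZ 1?mulrC//; [exact: nind|apply: niceZ; exact: nind].
  by apply/funext => y; rewrite /s big_ord_recr.
(* The squared error is at most [e^2 = del / 3] on [U e n] and equals [m^2] outside. With [a] chosen
   so that [a K = del / 3], the additive Cauchy-Schwarz inequality bounds the outer part by
   [(del / 3 + del) / 2], and the sum is [del]. *)
have small del : 0 < del -> exists e n, forall m, dual_elt m -> (forall y, `|m y| <= `|y|) ->
    E (fun y => (m y - s e m n y) ^+ 2) <= del.
  move=> del0; pose e := Num.sqrt (del / 3).
  have e2 : e ^+ 2 = del / 3 by rewrite sqr_sqrtr// divr_ge0// ltW.
  have e0 : 0 < e by rewrite sqrtr_gt0 divr_gt0.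
  pose K : R := 48 * expR (c / 2).
  have K0 : 0 < K by rewrite mulr_gt0// expR_gt0.
  pose a := del / (3 * K).
  have a0 : 0 < a by rewrite divr_gt0// mulr_gt0.
  pose rest n : X -> R := \1_(~` U e n).
  have nrest n : nice (rest n) by apply: nind; exact: measurableC.
  have crest : E (rest n) @[n --> \oo] --> E (fun _ => 0).
    apply: (expect_dominated_cvg gauss (nice_cst X 1)).
    - by move=> n; have [] := nrest n.
    - by move=> n y; rewrite /rest indicE ger0_norm// lern1; case: (_ \in _).
    - move=> y; apply: cvg_near_cst; have [i yi] := dP y e e0.
      exists i.+1 => // n /= ni; rewrite /rest indicE memNset// => nU; apply: nU.
      by rewrite /U -bigcup_mkord; exists i.
  rewrite expect_cst in crest.
  have [|N _ /(_ N (leqnn N)) HN] := @cvgr_le _ _ _ _ _ _ crest (a * del); first by rewrite mulr_gt0.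
  exists e, N => m dm m1.
  have nm := nice_dual dm.
  have nmr : nice (fun y => m y ^+ 2 * rest N y) by apply: niceM => //; exact: niceX.
  have h1 : E (fun y => (m y - s e m N y) ^+ 2) <= E (fun y => e ^+ 2 + m y ^+ 2 * rest N y).
    apply: expect_le => //; first by apply: niceX; apply: niceB.
      by apply: niceD => //; exact: nice_cst.
    move=> y; have [h1 h2] := s_in e m N y dm m1.
    have [Uy|nUy] := pselect (U e N y).
      rewrite /rest indicE memNset ?mulr0 ?addr0; last by apply; exact: Uy.
      by rewrite -[leLHS]real_normK ?num_real// lerXn2r ?nnegrE ?(ltW e0)//; exact: h1.
    rewrite /rest indicE mem_set// mulr1 h2// subr0 lerDr; exact: sqr_ge0.
  have h2 := expect_mul_le gauss a0 (niceX 2 nm) (nrest N).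
  have h3 : E (fun y => (m y ^+ 2) ^+ 2) <= K.
    have -> : E (fun y => (m y ^+ 2) ^+ 2) = E (fun y => m y ^+ 4).
      by congr expect; apply/funext => y; rewrite -exprM.
    apply: le_trans (expect_pow4_le dm) _.
    by rewrite ler_wpM2l// ler_expR ler_wpM2r// cP.
  have h4 : E (fun y => rest N y ^+ 2) = E (rest N).
    by congr expect; apply/funext => y; rewrite /rest indicE; case: (_ \in _); rewrite ?expr1n ?expr0n.
  apply: le_trans h1 _; rewrite expectD//; last exact: nice_cst.
  rewrite expect_cst e2.
  have h5 := le_trans (ler_norm _) h2.
  have h6 : a * E (fun y => (m y ^+ 2) ^+ 2) <= del / 3.
    apply: le_trans (ler_wpM2l (ltW a0) h3) _.
    by rewrite /a le_eqVlt; apply/orP; left; apply/eqP; field; rewrite gt_eqF.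
  have h7 : a^-1 * E (fun y => rest N y ^+ 2) <= del by rewrite h4 ler_pdivrMl.
  lra.
have approx e : 0 < e -> exists x : X, forall m, dual_elt m -> (forall y, `|m y| <= `|y|) ->
    `|Gam m - m x| <= e.
  move=> e0; have C1 : 0 < C + 1 by rewrite ltr_wpDl.
  (* Dividing by [C + 1] covers the case [C = 0]. *)
  have [|e1 [n H]] := small (e ^+ 2 / (C + 1)); first by rewrite divr_gt0// exprn_gt0.
  exists (\sum_(k < n) Gam (\1_(A e1 k) : X -> R) *: d k) => m dm m1.
  have nm := nice_dual dm.
  have -> : Gam m - m (\sum_(k < n) Gam (\1_(A e1 k) : X -> R) *: d k) = Gam (fun y => m y + (-1) * s e1 m n y).
    by rewrite GamD ?GamZ ?mulN1r ?s_rep//; exact: niceZ.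
  rewrite -(@ler_pXn2r _ 2) ?nnegrE ?(ltW e0)// real_normK ?num_real//.
  apply: le_trans (GamE _ _) _; first by apply: niceD => //; exact: niceZ.
  have := H m dm m1.
  have -> : E (fun y => (m y - s e1 m n y) ^+ 2) = E (fun y => (m y + -1 * s e1 m n y) ^+ 2).
    by congr expect; apply/funext => y; rewrite mulN1r.
  set Q := E _ => HQ.
  have Q0 : 0 <= Q by apply: expect_ge0 => y; exact: sqr_ge0.
  by move: HQ; rewrite ler_pdivlMr//; lra.
have approxS k : exists x : X, forall m, dual_elt m -> (forall y, `|m y| <= `|y|) ->
    `|Gam m - m x| <= k.+1%:R^-1.
  by apply: approx; rewrite invr_gt0.
have [x xP] := choice approxS.
(* The approximations are uniform over the unit functionals, so testing with the functional that
   norms [x j - x k] shows the sequence to be Cauchy. *)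
have cx : cvgn x.
  apply/cauchy_cvgP/cauchy_ballP => e e0; near_simpl.
  near=> j k; rewrite -ball_normE /=.
  have [m [dm m1 mz]] := norming_functional (x j - x k).
  rewrite -mz dual_eltB//.
  have j0 : j.+1%:R^-1 < e / 2.
    by near: j; apply: near_invS_lt; exact: divr_gt0.
  have k0 : k.+1%:R^-1 < e / 2.
    by near: k; apply: near_invS_lt; exact: divr_gt0.
  have := le_lt_trans (xP j m dm m1) j0; have := le_lt_trans (xP k m dm m1) k0.
  rewrite !ltr_norml => /andP[? ?] /andP[? ?]; lra.
have xl m : dual_elt m -> m (x k) @[k --> \oo] --> m (limn x).
  by move=> [_ cm]; apply: (cvg_comp x m cx); exact: cm.
have unit_rep m : dual_elt m -> (forall y, `|m y| <= `|y|) -> Gam m = m (limn x).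
  move=> dm m1; apply: (cvg_unique _ _ (xl _ dm)); first exact: norm_hausdorff.
  apply/cvgrPdist_le => e e0; near=> k.
  apply: le_trans (xP k m dm m1) _.
  by near: k; near do apply/ltW; exact: near_invS_lt.
exists (limn x) => m dm.
have [K K0 mK] := dual_bounded dm.
have dk := dual_scale K^-1 dm.
have : Gam (fun y => K^-1 * m y) = K^-1 * m (limn x).
  apply: (unit_rep _ dk) => y.
  by rewrite normrM gtr0_norm ?invr_gt0// ler_pdivrMl.
rewrite GamZ; last exact: nice_dual.
by move/(mulfI (lt0r_neq0 _)); apply; rewrite invr_gt0.
Unshelve. all: by end_near. Qed.

End Pettis.

(** * The Cameron-Martin norm and the covariance operator *)

Section CMNorm.
Context (R : realType) (X : completeNormedModType R) (gamma : probability (borel X) R).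
Hypothesis sepX : separable_space X.
Hypothesis gauss : centered_gaussian gamma.
Implicit Types (l m w : X -> R) (g h : X).
Local Notation E := (expect gamma).
Local Notation cov := (cov gamma).
Local Notation hnorm := (hnorm gamma).
Local Notation in_CM := (in_CM gamma).

Definition sd m := Num.sqrt (cov m m).

Lemma sd_ge0 m : 0 <= sd m. Proof. exact: sqrtr_ge0. Qed.

Lemma sd_sqr m : sd m ^+ 2 = cov m m.
Proof. by rewrite sqr_sqrtr// cov_ge0. Qed.

Lemma sd_opp m : sd (fun y => - m y) = sd m.
Proof. by rewrite /sd cov_opp. Qed.

Lemma integral_dual_sqr l : dual_elt l ->
  (\int[gamma]_(y in setT) ((l y) ^+ 2)%:E)%E = (cov l l)%:E.
Proof.
move=> dl.
have i := nice_integrable gauss (niceX 2 (nice_dual dl)).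
rewrite -(fineK (integrable_fin_num measurableT i)).
by [].
Qed.

Lemma cm_enorm_ge0 h : (0 <= cm_enorm gamma h)%E.
Proof.
apply: ereal_sup_ubound; exists (fun _ => 0) => //; split; first exact: dual_cst0.
rewrite integral_dual_sqr; last exact: dual_cst0.
rewrite lee_fin /cov.
by under eq_fun do rewrite mulr0; rewrite expect_cst.
Qed.

Lemma hnorm_ge0 h : 0 <= hnorm h.
Proof. by apply: fine_ge0; exact: cm_enorm_ge0. Qed.

(** Dividing [m] by [sd m] makes it admissible in the supremum. If [sd m = 0], all multiples of [m]
    are admissible, and a positive [m h] would let one of them exceed [hnorm h]. *)
Lemma in_CM_le h m : in_CM h -> dual_elt m -> m h <= hnorm h * sd m.
Proof.
move=> hCM dm.
have unit l : dual_elt l -> cov l l <= 1 -> l h <= hnorm h.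
  move=> dl l1; rewrite -lee_fin fineK; last first.
    by rewrite ge0_fin_numE// cm_enorm_ge0.
  by apply: ereal_sup_ubound; exists l => //; split => //; rewrite integral_dual_sqr// lee_fin.
have cs a : cov (fun y => a * m y) (fun y => a * m y) = a ^+ 2 * cov m m.
  rewrite cov_scalel//; last exact: dual_scale.
  by rewrite covC cov_scalel// mulrA expr2.
have := sd_ge0 m; rewrite le_eqVlt => /orP[/eqP s0|s0].
  rewrite -s0 mulr0 leNgt; apply/negP => mh.
  have q0 : cov m m = 0 by rewrite -sd_sqr -s0 expr0n.
  have := unit _ (dual_scale ((hnorm h + 1) / m h) dm); rewrite cs q0 mulr0 => /(_ ler01).
  by rewrite divfK ?gt_eqF//; lra.
have := unit _ (dual_scale (sd m)^-1 dm); rewrite cs -sd_sqr exprVn mulVf ?expf_neq0 ?gt_eqF// lexx.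
by move=> /(_ isT); rewrite ler_pdivrMl// mulrC.
Qed.

Lemma in_CM_norm h m : in_CM h -> dual_elt m -> `|m h| <= hnorm h * sd m.
Proof.
move=> hCM dm; rewrite ler_norml (in_CM_le hCM dm) andbT lerNl.
by rewrite -sd_opp; apply: (@in_CM_le h (fun y => - m y)) => //; exact: dual_opp.
Qed.

(** Converse of the duality bound [in_CM_le]. Membership in H and upper bounds for the norm are
    obtained through it: the test against functionals suffices. *)
Lemma hnorm_le h C : 0 <= C -> (forall m, dual_elt m -> m h <= C * sd m) ->
  in_CM h /\ hnorm h <= C.
Proof.
move=> C0 hC.
have le : (cm_enorm gamma h <= C%:E)%E.
  apply: ge_ereal_sup => _ [l [dl l1] <-]; rewrite lee_fin.
  apply: le_trans (hC l dl) _; rewrite ler_piMr//.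
  by rewrite -sqrtr1 ler_sqrt// -lee_fin -integral_dual_sqr.
have fin : in_CM h by apply: le_lt_trans le _; rewrite ltry.
split=> //; rewrite -lee_fin fineK//.
by rewrite ge0_fin_numE// cm_enorm_ge0.
Qed.

Lemma in_CM_lin a g h : in_CM g -> in_CM h ->
  in_CM (a *: g + h) /\ hnorm (a *: g + h) <= `|a| * hnorm g + hnorm h.
Proof.
move=> gCM hCM; apply: hnorm_le.
  by rewrite addr_ge0 ?mulr_ge0// hnorm_ge0.
move=> m dm; rewrite dual_eltE// mulrDl lerD ?in_CM_le// -mulrA.
by apply: le_trans (ler_norm _) _; rewrite normrM ler_wpM2l// in_CM_norm.
Qed.

Lemma in_CM0 : in_CM 0 /\ hnorm 0 = 0.
Proof.
have [|? le] := @hnorm_le 0 0 (lexx 0).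
  by move=> m dm; rewrite dual_elt0// mul0r.
by split=> //; apply/le_anti; rewrite le hnorm_ge0.
Qed.

Lemma in_CMD g h : in_CM g -> in_CM h -> in_CM (g + h).
Proof. by move=> gCM hCM; rewrite -[g]scale1r; have [] := in_CM_lin 1 gCM hCM. Qed.

Lemma hnormD g h : in_CM g -> in_CM h -> hnorm (g + h) <= hnorm g + hnorm h.
Proof.
move=> gCM hCM; have [_] := in_CM_lin 1 gCM hCM.
by rewrite scale1r normr1 mul1r.
Qed.

Lemma in_CMZ a h : in_CM h -> in_CM (a *: h).
Proof. by move=> hCM; have [] := in_CM_lin a hCM (in_CM0).1; rewrite addr0. Qed.

Lemma hnormZ_le a h : in_CM h -> hnorm (a *: h) <= `|a| * hnorm h.
Proof. by move=> hCM; have [_] := in_CM_lin a hCM (in_CM0).1; rewrite !addr0 (in_CM0).2 addr0. Qed.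

Lemma in_CMN h : in_CM h -> in_CM (- h).
Proof. by rewrite -scaleN1r; exact: in_CMZ. Qed.

Lemma hnormN h : in_CM h -> hnorm (- h) = hnorm h.
Proof.
move=> hCM; apply/le_anti/andP; split.
  by rewrite -scaleN1r; apply: le_trans (hnormZ_le _ hCM) _; rewrite normrN normr1 mul1r.
rewrite -{1}[h]opprK -[- - h]scaleN1r; apply: le_trans (hnormZ_le _ (in_CMN hCM)) _.
by rewrite normrN normr1 mul1r.
Qed.

Lemma in_CMB g h : in_CM g -> in_CM h -> in_CM (g - h).
Proof. by move=> gCM hCM; apply: in_CMD => //; exact: in_CMN. Qed.

Lemma hnorm_dist g h : in_CM g -> in_CM h -> `|hnorm g - hnorm h| <= hnorm (g - h).
Proof.
move=> gCM hCM; rewrite ler_norml.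
have h1 := hnormD (in_CMB gCM hCM) hCM; rewrite subrK in h1.
have h2 := hnormD (in_CMB hCM gCM) gCM; rewrite subrK in h2.
have h3 := hnormN (in_CMB gCM hCM); rewrite opprB in h3.
apply/andP; split; lra.
Qed.

(** H embeds continuously into [X] because the unit functionals have uniformly bounded variance. *)
Lemma norm_le_hnorm : exists2 K, 0 < K & forall h, in_CM h -> `|h| <= K * hnorm h.
Proof.
have [c c0 cP] := dual_variance_bound gauss.
exists (Num.sqrt c); first by rewrite sqrtr_gt0.
move=> h hCM; have [m [dm m1 <-]] := norming_functional h.
apply: le_trans (in_CM_le hCM dm) _; rewrite mulrC ler_wpM2r ?hnorm_ge0//.
by rewrite ler_sqrt ?(ltW c0)//; exact: cP.
Qed.

(* [h] is the image of [l] under the covariance operator. *)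
Definition represents h l := forall m, dual_elt m -> m h = cov m l.

(** The vector is the Pettis integral of [l y *: y]: it represents [w |-> E (w l)], which
    Cauchy-Schwarz bounds in [L^2]. *)
Lemma ex_represents l : dual_elt l -> exists h, represents h l.
Proof.
move=> dl; have nl := nice_dual dl.
have [||||h hP] := @pettis R X gamma sepX gauss (fun w => E (fun y => w y * l y)) (cov l l).
- move=> f g nf ng; rewrite -expectD//; [|exact: niceM|exact: niceM].
  by congr expect; apply/funext => y; rewrite mulrDl.
- move=> r f nf; rewrite -expectZ//; last exact: niceM.
  by congr expect; apply/funext => y; rewrite mulrA.
- move=> f nf; apply: le_trans (expect_CS gauss nf nl) _.
  rewrite mulrC le_eqVlt; apply/orP; left; apply/eqP; congr (_ * _).
- exact: cov_ge0.
- by exists h => m /hP <-.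
Qed.

(** Cauchy-Schwarz bounds the norm from above; testing [h] with [l] itself bounds it from below. *)
Lemma represents_hnorm h l : dual_elt l -> represents h l -> in_CM h /\ hnorm h = sd l.
Proof.
move=> dl hl.
have [|hCM hle] := @hnorm_le h (sd l) (sd_ge0 l).
  move=> m dm; rewrite hl//; apply: le_trans (ler_norm _) _.
  rewrite -(@ler_pXn2r _ 2) ?nnegrE ?mulr_ge0 ?sd_ge0// real_normK ?num_real//.
  by rewrite exprMn !sd_sqr mulrC; exact: cov_CS.
split=> //; apply/le_anti; rewrite hle /=.
have := in_CM_le hCM dl; rewrite hl// -sd_sqr expr2.
have [->|s0] := eqVneq (sd l) 0; first by rewrite hnorm_ge0.
by rewrite ler_pM2r// lt_def s0 sd_ge0.
Qed.

Lemma represents_lin a g h l m : dual_elt l -> dual_elt m ->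
  represents g l -> represents h m -> represents (a *: g + h) (fun y => a * l y + m y).
Proof.
move=> dl dm gl hm k dk.
by rewrite dual_eltE// gl// hm// [RHS]covC cov_lin// (covC gamma l) (covC gamma m).
Qed.

(* [l] nearly minimises [q(l) / 2 - l(h)], whose exact minimiser would represent [h]. *)
Lemma in_CM_approx h e : in_CM h -> 0 < e ->
  exists l h', [/\ dual_elt l, represents h' l, in_CM (h - h') & hnorm (h - h') <= e].
Proof.
move=> hCM e0.
pose phi l := cov l l / 2 - l h.
pose A := [set r | exists2 l, dual_elt l & r = phi l].
have Alb : has_lbound A.
  exists (- (hnorm h ^+ 2 / 2)) => _ [l dl ->].
  have h1 := in_CM_le hCM dl; have h2 := sqr_ge0 (hnorm h - sd l).
  rewrite /phi -sd_sqr; lra.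
have A0 : A !=set0 by exists (phi (fun _ => 0)), (fun _ => 0) => //; exact: dual_cst0.
have d0 : 0 < e ^+ 2 / 2 by rewrite divr_gt0// exprn_gt0.
have [_ [l dl ->] hl] := inf_adherent d0 (conj A0 Alb).
have [h' h'l] := ex_represents dl.
exists l, h'.
have key m : dual_elt m -> `|m (h - h')| <= e * sd m.
  move=> dm; rewrite dual_eltB// (h'l m dm); set b := m h - cov m l.
  (* Compare [phi] at [l] and at [l + s m]: minimality up to [e^2 / 2] bounds [s b] for every real
     [s], and [s = b / cov m m] then gives [b^2 <= e^2 cov m m]. *)
  have ineq s : s * b <= s ^+ 2 * cov m m / 2 + e ^+ 2 / 2.
    have : inf A <= phi (fun y => s * m y + l y).
      by apply: ge_inf => //; exists (fun y => s * m y + l y) => //; exact: dual_lin.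
    have := hl; rewrite /phi /b.
    rewrite cov_lin//; last exact: dual_lin.
    rewrite ![cov _ (fun y => _ * _ y + _ y)]covC !cov_lin// (covC gamma l m); lra.
  have := sd_ge0 m; rewrite le_eqVlt => /orP[/eqP s0|s0].
    rewrite -s0 mulr0; have [->|b0] := eqVneq b 0; first by rewrite normr0.
    have := ineq ((e ^+ 2 / 2 + 1) / b); rewrite -sd_sqr -s0 expr0n/= mulr0 mul0r add0r divfK//.
    lra.
  have q0 : 0 < cov m m by rewrite -sd_sqr exprn_gt0.
  have := ineq (b / cov m m).
  have -> : (b / cov m m) ^+ 2 * cov m m / 2 = b / cov m m * b / 2 by field; rewrite gt_eqF.
  move=> h1; have {}h1 : b ^+ 2 / cov m m <= e ^+ 2.
    have -> : b ^+ 2 / cov m m = b / cov m m * b by field; rewrite gt_eqF.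
    lra.
  rewrite -(@ler_pXn2r _ 2) ?nnegrE ?mulr_ge0 ?sd_ge0 ?(ltW e0)// real_normK ?num_real//.
  by rewrite exprMn sd_sqr -ler_pdivrMr.
have [|hCM' hle] := @hnorm_le (h - h') e (ltW e0); last by split.
by move=> m dm; exact: le_trans (ler_norm _) (key m dm).
Qed.

Lemma in_CM_approx_seq h : in_CM h -> exists (l_ : nat -> X -> R) (h_ : nat -> X),
  [/\ forall n, dual_elt (l_ n), forall n, represents (h_ n) (l_ n),
      forall n, in_CM (h_ n) & hnorm (h - h_ n) @[n --> \oo] --> (0 : R)].
Proof.
move=> hCM.
have ap n : exists p : (X -> R) * X, [/\ dual_elt p.1, represents p.2 p.1, in_CM (h - p.2)
    & hnorm (h - p.2) <= n.+1%:R^-1].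
  have [|l [h' lh']] := @in_CM_approx h n.+1%:R^-1 hCM; first by rewrite invr_gt0.
  by exists (l, h').
have [p pP] := choice ap.
exists (fun n => (p n).1), (fun n => (p n).2); split=> [n|n|n|].
- by have [] := pP n.
- by have [] := pP n.
- by have [d r _ _] := pP n; have [] := represents_hnorm d r.
- apply: (squeeze_cvgr _ (cvg_cst 0) (@cvg_harmonic R)).
  by apply: nearW => n; rewrite hnorm_ge0; have [] := pP n.
Qed.

Lemma hnorm_cvg (g_ : nat -> X) g : in_CM g -> (forall n, in_CM (g_ n)) ->
  hnorm (g - g_ n) @[n --> \oo] --> (0 : R) -> hnorm (g_ n) @[n --> \oo] --> hnorm g.
Proof.
move=> gCM gnCM c0; apply/cvgrPdist_le => e e0.
move/cvgrPdist_le : c0 => /(_ e e0); apply: filterS => n.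
rewrite sub0r normrN (ger0_norm (hnorm_ge0 _)); apply: le_trans.
exact: hnorm_dist.
Qed.

Lemma hinner_cvg (g_ h_ : nat -> X) g h : in_CM g -> in_CM h ->
  (forall n, in_CM (g_ n)) -> (forall n, in_CM (h_ n)) ->
  hnorm (g - g_ n) @[n --> \oo] --> (0 : R) -> hnorm (h - h_ n) @[n --> \oo] --> (0 : R) ->
  hinner gamma (g_ n) (h_ n) @[n --> \oo] --> hinner gamma g h.
Proof.
move=> gCM hCM gnCM hnCM cg ch.
have c0 : hnorm (g - g_ n) + hnorm (h - h_ n) @[n --> \oo] --> (0 : R).
  by rewrite -[X in _ --> X](addr0 0); exact: cvgD.
apply: cvgM; last exact: cvg_cst.
apply: cvgB; apply: cvg_sqr; apply: hnorm_cvg.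
- exact: in_CMD.
- by move=> n; exact: in_CMD.
- apply: (squeeze_cvgr _ (cvg_cst 0) c0); apply: nearW => n; rewrite hnorm_ge0 /=.
  rewrite opprD addrACA; apply: hnormD; exact: in_CMB.
- exact: in_CMB.
- by move=> n; exact: in_CMB.
- apply: (squeeze_cvgr _ (cvg_cst 0) c0); apply: nearW => n; rewrite hnorm_ge0 /=.
  rewrite (_ : g - h - (g_ n - h_ n) = (g - g_ n) + - (h - h_ n)); last first.
    by rewrite !opprD !opprK addrACA.
  rewrite -(hnormN (in_CMB hCM (hnCM n))); apply: hnormD; first exact: in_CMB.
  by apply: in_CMN; exact: in_CMB.
Qed.

(** For [g] in the range of the covariance operator the squared norms in the polarization formula
    are variances, and the formula returns a covariance. Both sides are continuous in the H-norm,
    and the range is dense in H. *)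
Lemma hinner_represents g h m : in_CM g -> dual_elt m -> represents h m ->
  hinner gamma g h = m g.
Proof.
move=> gCM dm hm.
have [hCM _] := represents_hnorm dm hm.
have [l_ [g_ [dl gl gnCM cg]]] := in_CM_approx_seq gCM.
have ch : hnorm (h - h) @[_ --> \oo] --> (0 : R).
  by rewrite subrr (in_CM0).2; exact: cvg_cst.
have c1 := hinner_cvg gCM hCM gnCM (fun _ : nat => hCM) cg ch.
have inn n : hinner gamma (g_ n) h = m (g_ n).
  have r1 := represents_lin 1 dm (dl n) hm (gl n).
  have r2 := represents_lin (-1) dm (dl n) hm (gl n).
  have [_ e1] := represents_hnorm (dual_lin 1 dm (dl n)) r1.
  have [_ e2] := represents_hnorm (dual_lin (-1) dm (dl n)) r2.
  rewrite scale1r addrC in e1; rewrite scaleN1r addrC in e2.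
  rewrite /hinner e1 e2 !sd_sqr.
  rewrite cov_lin//; last exact: dual_lin.
  rewrite [X in _ - X]cov_lin//; last exact: dual_lin.
  rewrite ![cov _ (fun y => _ * _ y + _ y)]covC !cov_lin// (covC gamma (l_ n)) (gl n m dm).
  by field.
apply: (cvg_unique _ c1); first exact: norm_hausdorff.
rewrite (funext inn) /=; apply/cvgrPdist_le => e e0.
have c2 : hnorm (g - g_ n) * sd m @[n --> \oo] --> (0 : R).
  by rewrite -[X in _ --> X](mul0r (sd m)); apply: cvgM => //; exact: cvg_cst.
move/cvgrPdist_le : c2 => /(_ e e0); apply: filterS => n.
rewrite sub0r normrN => h1; apply: le_trans h1; rewrite -dual_eltB//.
apply: le_trans (ler_norm _); apply: in_CM_norm => //; exact: in_CMB.
Qed.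

End CMNorm.

(** * Differences of Gaussian averages under shifts *)

Section GaussianShiftBounds.
Context (R : realType) (X : completeNormedModType R) (gamma : probability (borel X) R).
Hypothesis sepX : separable_space X.
Hypothesis gauss : centered_gaussian gamma.
Implicit Types (l m w phi : X -> R) (g h : X).
Local Notation E := (expect gamma).
Local Notation cov := (cov gamma).
Local Notation sd := (sd gamma).
Local Notation cm_density := (cm_density gamma).

Lemma expect_lin a (f g : X -> R) : nice f -> nice g ->
  E (fun y => a * f y + g y) = a * E f + E g.
Proof. by move=> nf ng; rewrite expectD ?expectZ//; exact: niceZ. Qed.

Lemma expect_bdd_le phi w M : nice phi -> nice w -> 0 <= M -> (forall y, `|phi y| <= M) ->
  `|E (fun y => phi y * w y)| <= M * Num.sqrt (E (fun y => w y ^+ 2)).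
Proof.
move=> np nw M0 pM.
have W0 : 0 <= E (fun y => w y ^+ 2) by apply: expect_ge0 => y; exact: sqr_ge0.
rewrite -(@ler_pXn2r _ 2) ?nnegrE ?mulr_ge0 ?sqrtr_ge0// real_normK ?num_real//.
rewrite exprMn sqr_sqrtr//; apply: le_trans (expect_CS gauss np nw) _.
rewrite ler_wpM2r// -[leRHS](expect_cst gamma); apply: expect_le => //; first exact: niceX.
  exact: nice_cst.
by move=> y; rewrite -[leLHS]real_normK ?num_real// lerXn2r ?nnegrE.
Qed.

Variables (l : X -> R) (h : X).
Hypotheses (dl : dual_elt l) (hl : represents gamma h l).

Let q := cov l l.

(** Density of the translate of [gamma] by [b *: h]. *)
Let e b := cm_density (fun y => b * l y).

Let nice_e b : nice (e b).
Proof. by apply: nice_cm_density; exact: dual_scale. Qed.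

Let cov_bl b : cov (fun y => b * l y) (fun y => b * l y) = b ^+ 2 * q.
Proof.
rewrite cov_scalel//; last exact: dual_scale.
by rewrite covC cov_scalel// mulrA expr2.
Qed.

Let eE b y : e b y = expR (b * l y - b ^+ 2 * q / 2).
Proof. by rewrite /e /cm_density cov_bl. Qed.

Let shiftE b w : nice w -> E (fun y => w (y + b *: h)) = E (fun y => w y * e b y).
Proof.
move=> nw; apply: cameron_martin => //; first exact: dual_scale.
by move=> m dm; rewrite dual_eltZ// hl// [RHS]covC cov_scalel// covC.
Qed.

Let e0E b : E (e b) = 1.
Proof.
have := shiftE b (nice_cst X 1); rewrite expect_cst => ->.
by congr expect; apply/funext => y; rewrite mul1r.
Qed.

(** Up to a constant, a product of densities is the density of the summed shift; [L^2] inner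
    products of such weights thus become expectations after the shift by [(a + b) *: h]. *)
Let e_mul a b y : e a y * e b y = expR (a * b * q) * e (a + b) y.
Proof. by rewrite !eE -!expRD; congr expR; field. Qed.

Let exp_half (r : R) : 0 <= r -> r <= 2^-1 -> expR r <= 2 /\ expR r - 1 <= 2 * r.
Proof.
move=> r0 r1; have := expR_ge1Dx (- r).
rewrite -(ler_pM2r (expR_gt0 r)) -expRD addNr expR0 => h1.
have e0 := expR_gt0 r.
have h2 : expR r <= 2.
  have : r * expR r <= 2^-1 * expR r by rewrite ler_wpM2r// ltW.
  lra.
split=> //.
have : r * expR r <= r * 2 by rewrite ler_wpM2l.
lra.
Qed.

Section Weighted.
Variable m : X -> R.
Hypothesis dm : dual_elt m.
Let k := cov m l.

(** Since [k = m h], this is [m] evaluated at [y - b *: h], times the density: the weight that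
    absorbs the shift of [phi] in [E (phi (y + b h) m y)]. *)
Let W b y := (m y - b * k) * e b y.

Let nice_W b : nice (W b).
Proof. by apply: niceM => //; apply: niceB; [exact: nice_dual|exact: nice_cst]. Qed.

(** After the shift by [(a + b) *: h] the two factors become [m + b k] and [m + a k], and the terms
    linear in [m] have mean 0. *)
Let gram a b : E (fun y => W a y * W b y) = (cov m m + a * b * k ^+ 2) * expR (a * b * q).
Proof.
have nm := nice_dual dm.
have nma c : nice (fun y => m y - c) by apply: niceB => //; exact: nice_cst.
have n1 : nice (fun y => (m y - a * k) * (m y - b * k)) by exact: niceM.
have -> : E (fun y => W a y * W b y) =
    expR (a * b * q) * E (fun y => (m y - a * k) * (m y - b * k) * e (a + b) y).
  rewrite -(expectZ gauss _ (niceM n1 (nice_e (a + b)))).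
  by congr expect; apply/funext => y; rewrite [RHS]mulrCA -e_mul /W; move: (e a y) (e b y) (m y) => u v x; ring.
rewrite -(shiftE (a + b) n1) mulrC; congr (_ * _).
have -> : E (fun y => (m (y + (a + b) *: h) - a * k) * (m (y + (a + b) *: h) - b * k)) =
    E (fun y => 1 * (m y * m y) + ((a + b) * k * m y + a * b * k ^+ 2)).
  congr expect; apply/funext => y; rewrite dual_eltD// dual_eltZ// hl// -/k; ring.
have nc : nice (fun _ : X => a * b * k ^+ 2) by exact: nice_cst.
rewrite expect_lin; [|exact: niceM|by apply: niceD => //; exact: niceZ].
by rewrite (expect_lin _ nm nc) expect_cst (expect_dual gauss dm) mul1r mulr0 add0r.
Qed.

Lemma expect_shift_dual b phi : nice phi ->
  E (fun y => phi (y + b *: h) * m y) = E (fun y => phi y * W b y).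
Proof.
move=> np; have nm := nice_dual dm.
have := shiftE b (niceM np (niceB nm (nice_cst X (b * k)))) => /=.
have -> : (fun y => phi y * (m y - b * k) * e b y) = (fun y => phi y * W b y).
  by apply/funext => y; rewrite mulrA.
move=> <-; congr expect; apply/funext => y.
by rewrite (dual_eltD _ _ dm) (dual_eltZ _ _ dm) (hl dm) -/k; congr (_ * _); ring.
Qed.

Let D b y := W (2 * b) y - 2 * W b y + W 0 y.

Let D_sqr b : E (fun y => D b y ^+ 2) =
  (cov m m + 4 * (b ^+ 2 * k ^+ 2)) * expR (4 * (b ^+ 2 * q))
  - 4 * ((cov m m + 2 * (b ^+ 2 * k ^+ 2)) * expR (2 * (b ^+ 2 * q)))
  + 4 * ((cov m m + b ^+ 2 * k ^+ 2) * expR (b ^+ 2 * q)) - cov m m.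
Proof.
have nW a c : nice (fun y => W a y * W c y) by exact: niceM.
have -> : (fun y => D b y ^+ 2) = (fun y => 1 * (W (2 * b) y * W (2 * b) y) +
  (- 4 * (W (2 * b) y * W b y) + (2 * (W (2 * b) y * W 0 y) +
  (4 * (W b y * W b y) + (- 4 * (W b y * W 0 y) + W 0 y * W 0 y))))).
  by apply/funext => y; rewrite /D; move: (W (2 * b) y) (W b y) (W 0 y) => w2 w1 w0; ring.
have n1 := niceD (niceZ (- 4) (nW b 0)) (nW 0 0).
have n2 := niceD (niceZ 4 (nW b b)) n1.
have n3 := niceD (niceZ 2 (nW (2 * b) 0)) n2.
have n4 := niceD (niceZ (- 4) (nW (2 * b) b)) n3.
rewrite (expect_lin _ (nW _ _) n4) (expect_lin _ (nW _ _) n3) (expect_lin _ (nW _ _) n2).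
rewrite (expect_lin _ (nW _ _) n1) (expect_lin _ (nW _ _) (nW _ _)) !gram !mulr0 !mul0r expR0.
have -> : 2 * b * (2 * b) = 4 * b ^+ 2 by ring.
have -> : 2 * b * b = 2 * b ^+ 2 by ring.
rewrite -expr2 !mulrA; ring.
Qed.

Let k_le : k ^+ 2 <= cov m m * q.
Proof. exact: cov_CS. Qed.

(** With [z = exp r] the value of [D_sqr] regroups so that [Q] carries [(z - 1)^2] and [K] carries
    [z - 1], while [z - 1 <= 2 r], and [K <= Q r] by Cauchy-Schwarz. The sum is at most
    [(28 + 80) r^2 Q], and [108 <= 11^2]. *)
Let D_small b : b ^+ 2 * q <= 2^-1 -> E (fun y => D b y ^+ 2) <= (11 * (b ^+ 2 * q)) ^+ 2 * cov m m.
Proof.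
set r := b ^+ 2 * q => r1.
have r0 : 0 <= r by rewrite mulr_ge0 ?sqr_ge0// cov_ge0.
have [z2 z1] := exp_half r0 r1.
have z0 : 1 <= expR r by rewrite -expR0 ler_expR.
rewrite D_sqr -/r; set z := expR r in z0 z1 z2 *.
have -> : expR (4 * r) = z ^+ 4 by rewrite expRM_natl.
have -> : expR (2 * r) = z ^+ 2 by rewrite expRM_natl.
have q0 := cov_ge0 gamma m.
set Q := cov m m in q0 *; set K := b ^+ 2 * k ^+ 2.
have K0 : 0 <= K by rewrite mulr_ge0 ?sqr_ge0.
have Kr : K <= Q * r.
  have -> : Q * r = b ^+ 2 * (Q * q) by rewrite /r; ring.
  by rewrite ler_wpM2l ?sqr_ge0.
have u0 : 0 <= z - 1 by lra.
have u2 : (z - 1) ^+ 2 <= 4 * r ^+ 2.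
  have -> : 4 * r ^+ 2 = (2 * r) ^+ 2 by ring.
  by rewrite !expr2; apply: ler_pM.
have -> : (Q + 4 * K) * z ^+ 4 - 4 * ((Q + 2 * K) * z ^+ 2) + 4 * ((Q + K) * z) - Q =
   Q * ((z - 1) ^+ 2 * (z ^+ 2 + 2 * z - 1)) + K * (4 * z * (z - 1) * (z ^+ 2 + z - 1)) by ring.
have z22 : z ^+ 2 <= 4.
  have -> : (4 : R) = 2 ^+ 2 by ring.
  by rewrite !expr2; apply: ler_pM => //; lra.
have z21 : 1 <= z ^+ 2 by rewrite expr_ge1//; lra.
have h1 : Q * ((z - 1) ^+ 2 * (z ^+ 2 + 2 * z - 1)) <= Q * (4 * r ^+ 2 * 7).
  rewrite ler_wpM2l//; apply: ler_pM => //; [exact: sqr_ge0|lra|lra].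
have h2 : K * (4 * z * (z - 1) * (z ^+ 2 + z - 1)) <= Q * r * (4 * 2 * (2 * r) * 5).
  apply: ler_pM => //.
    by rewrite !mulr_ge0//; lra.
  apply: ler_pM; [by rewrite !mulr_ge0//; lra|lra| |lra].
  by apply: ler_pM; lra.
apply: le_trans (lerD h1 h2) _.
have -> : Q * (4 * r ^+ 2 * 7) + Q * r * (4 * 2 * (2 * r) * 5) = 108 * (r ^+ 2 * Q) by ring.
have -> : (11 * r) ^+ 2 * Q = 121 * (r ^+ 2 * Q) by ring.
have : 0 <= r ^+ 2 * Q by rewrite mulr_ge0// sqr_ge0.
lra.
Qed.

Lemma second_difference_bound b phi M : nice phi -> 0 <= M -> (forall y, `|phi y| <= M) ->
  `|E (fun y => phi (y + (2 * b) *: h) * m y) - 2 * E (fun y => phi (y + b *: h) * m y)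
    + E (fun y => phi y * m y)| <= M * (11 * Num.min 1 (b ^+ 2 * q)) * sd m.
Proof.
move=> np M0 pM.
have nm := nice_dual dm.
have EmE : E (fun y => m y ^+ 2) = cov m m by congr expect; apply/funext => y; rewrite expr2.
have bd (c : R) : `|E (fun y => phi (y + c *: h) * m y)| <= M * sd m.
  rewrite /sd -EmE; apply: expect_bdd_le => //; exact: nice_shift.
have r0 : 0 <= b ^+ 2 * q by rewrite mulr_ge0 ?sqr_ge0// cov_ge0.
have s0 : 0 <= M * sd m by rewrite mulr_ge0// sd_ge0.
have -> : E (fun y => phi y * m y) = E (fun y => phi (y + 0 *: h) * m y).
  by congr expect; apply/funext => y; rewrite scale0r addr0.
rewrite mulrAC; have [r1|r1] := lerP (b ^+ 2 * q) 2^-1.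
  rewrite min_r; last lra.
  rewrite !expect_shift_dual//.
  have -> : E (fun y => phi y * W (2 * b) y) - 2 * E (fun y => phi y * W b y) + E (fun y => phi y * W 0 y)
      = E (fun y => phi y * D b y).
    have nW c : nice (fun y => phi y * W c y) by exact: niceM.
    have e2 := expect_lin (- 2) (nW b) (nW 0).
    have e1 := expect_lin 1 (nW (2 * b)) (niceD (niceZ (- 2) (nW b)) (nW 0)).
    rewrite e2 in e1.
    have -> : (fun y => phi y * D b y) = (fun y => 1 * (phi y * W (2 * b) y) +
        (- 2 * (phi y * W b y) + phi y * W 0 y)).
      by apply/funext => y; rewrite /D; move: (W (2 * b) y) (W b y) (W 0 y) => w2 w1 w0; ring.
    by rewrite e1 mul1r mulNr addrA.
  have nD : nice (D b) by apply: niceD => //; apply: niceB => //; exact: niceZ.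
  apply: le_trans (expect_bdd_le np nD M0 pM) _.
  rewrite -mulrA ler_wpM2l// mulrC.
  have -> : 11 * (b ^+ 2 * q) * sd m = Num.sqrt ((11 * (b ^+ 2 * q)) ^+ 2 * cov m m).
    by rewrite sqrtrM ?sqr_ge0// sqrtr_sqr ger0_norm// mulr_ge0.
  by rewrite ler_sqrt ?D_small// mulr_ge0 ?sqr_ge0 ?cov_ge0.
(* When [b ^+ 2 * q > 1/2], the trivial bounds of the three terms add up to [1 + 2 + 1 = 4], which
   is below [11 / 2]. *)
have mn : 2^-1 <= Num.min 1 (b ^+ 2 * q) by rewrite le_min (ltW r1) andbT; lra.
apply: le_trans (_ : M * sd m * 4 <= _); last by rewrite ler_wpM2l//; lra.
apply: le_trans (ler_normD _ _) _; have := bd 0; have := bd b; have := bd (2 * b).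
have : `|E (fun y => phi (y + (2 * b) *: h) * m y) - 2 * E (fun y => phi (y + b *: h) * m y)|
  <= `|E (fun y => phi (y + (2 * b) *: h) * m y)| + 2 * `|E (fun y => phi (y + b *: h) * m y)|.
  by apply: le_trans (ler_normB _ _) _; rewrite normrM [`|2|]ger0_norm.
lra.
Qed.

End Weighted.

(** For small [s] the remainder is the integral of [phi] against [e b - 1 - b l], whose second
    moment is exactly [exp (s^2) - 1 - s^2], of order [s^4]. For [s^2 > 1/2] the crude bound [2 + s]
    stays below [6 s min (1, s)], which accounts for the 6. *)
Lemma first_order_bound b phi M : 0 <= b -> nice phi -> 0 <= M -> (forall y, `|phi y| <= M) ->
  `|E (fun y => phi (y + b *: h)) - E phi - b * E (fun y => phi y * l y)|
   <= M * (6 * (b * sd l * Num.min 1 (b * sd l))).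
Proof.
move=> b0 np M0 pM.
have nl := nice_dual dl; have s0 := sd_ge0 gamma l.
set s := b * sd l.
have ss : 0 <= s by rewrite mulr_ge0.
have sr : s ^+ 2 = b ^+ 2 * q by rewrite exprMn sd_sqr.
have [s1|s1] := lerP (s ^+ 2) 2^-1.
  have sle1 : s <= 1.
    rewrite -(@ler_pXn2r _ 2) ?nnegrE// expr1n; lra.
  rewrite min_r//.
  pose F y := e b y + (- 1 + (- b) * l y).
  have n1 : nice (fun y => - 1 + (- b) * l y) by apply: niceD; [exact: nice_cst|exact: niceZ].
  have nF : nice F by exact: niceD.
  have -> : E (fun y => phi (y + b *: h)) - E phi - b * E (fun y => phi y * l y) = E (fun y => phi y * F y).
    have npe := niceM np (nice_e b); have npl := niceM np nl.
    have e2 := expect_lin (- 1) np (niceZ (- b) npl).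
    have e1 := expect_lin 1 npe (niceD (niceZ (- 1) np) (niceZ (- b) npl)).
    rewrite e2 (expectZ gauss _ npl) in e1.
    have -> : (fun y => phi y * F y) = (fun y => 1 * (phi y * e b y) +
        (- 1 * phi y + - b * (phi y * l y))).
      by apply/funext => y; rewrite /F; move: (e b y) => u; ring.
    by rewrite e1 (shiftE b np) mul1r mulN1r mulNr addrA.
  apply: le_trans (expect_bdd_le np nF M0 pM) _; rewrite ler_wpM2l//.
  have -> : E (fun y => F y ^+ 2) = expR (s ^+ 2) - 1 - s ^+ 2.
    have nee := niceM (nice_e b) (nice_e b); have nle := niceM nl (nice_e b).
    have nll := niceM nl nl; have nc : nice (fun _ : X => 1 : R) by exact: nice_cst.
    have n1' := niceD (niceZ (b ^+ 2) nll) nc.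
    have n2 := niceD (niceZ (2 * b) nl) n1'.
    have n3 := niceD (niceZ (- (2 * b)) nle) n2.
    have n4 := niceD (niceZ (- 2) (nice_e b)) n3.
    have -> : (fun y => F y ^+ 2) = (fun y => 1 * (e b y * e b y) + (- 2 * e b y +
        (- (2 * b) * (l y * e b y) + (2 * b * l y + (b ^+ 2 * (l y * l y) + 1))))).
      by apply/funext => y; rewrite /F; move: (e b y) => u; ring.
    rewrite (expect_lin _ nee n4) (expect_lin _ (nice_e b) n3) (expect_lin _ nle n2).
    rewrite (expect_lin _ nl n1') (expect_lin _ nll nc) expect_cst (expect_dual gauss dl) e0E.
    have -> : E (fun y => l y * e b y) = b * q.
      rewrite -(shiftE b nl).
      have -> : (fun y => l (y + b *: h)) = (fun y => 1 * l y + b * q).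
        by apply/funext => y; rewrite (dual_eltD _ _ dl) (dual_eltZ _ _ dl) (hl dl) mul1r.
      by rewrite (expect_lin _ nl (nice_cst X (b * q))) expect_cst (expect_dual gauss dl) mulr0 add0r.
    have -> : E (fun y => e b y * e b y) = expR (s ^+ 2).
      have -> : (fun y => e b y * e b y) = (fun y => expR (b * b * q) * e (b + b) y).
        by apply/funext => y; exact: e_mul.
      by rewrite (expectZ gauss _ (nice_e (b + b))) e0E mulr1 sr expr2.
    have -> : E (fun y => l y * l y) = q by [].
    by rewrite sr; ring.
  rewrite -[leRHS]ger0_norm ?mulr_ge0// -sqrtr_sqr ler_sqrt ?sqr_ge0//.
  set r := s ^+ 2 in s1 *; have r0 : 0 <= r by exact: sqr_ge0.
  have [_ e1] := exp_half r0 s1.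
  have : expR r - 1 - r <= 2 * r ^+ 2.
    have := expR_ge1Dx (- r).
    rewrite -(ler_pM2r (expR_gt0 r)) -expRD addNr expR0 => h1.
    have : r * expR r <= r * (1 + 2 * r) by rewrite ler_wpM2l//; lra.
    rewrite expr2; lra.
  have -> : (6 * (s * s)) ^+ 2 = 36 * r ^+ 2 by rewrite /r; ring.
  have := sqr_ge0 r; lra.
have h1 : `|E (fun y => phi (y + b *: h))| <= M.
  apply: le_trans (expect_norm gauss (nice_shift _ np)) _.
  rewrite -[leRHS](expect_cst gamma); apply: (expect_le gauss) => [||y]; last exact: pM.
    by apply: nice_norm; exact: nice_shift.
  exact: nice_cst.
have h2 : `|E phi| <= M.
  apply: le_trans (expect_norm gauss np) _.
  rewrite -[leRHS](expect_cst gamma); apply: (expect_le gauss) => [||y]; last exact: pM.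
    exact: nice_norm.
  exact: nice_cst.
have h3 : b * `|E (fun y => phi y * l y)| <= M * s.
  have := expect_bdd_le np nl M0 pM.
  have -> : E (fun y => l y ^+ 2) = q by congr expect; apply/funext => y; rewrite expr2.
  by move=> h3; rewrite /s mulrCA ler_wpM2l.
apply: (@le_trans _ _ (M * (2 + s))).
  apply: le_trans (ler_normB _ _) _; rewrite normrM (ger0_norm b0).
  have := ler_normB (E (fun y => phi (y + b *: h))) (E phi); lra.
rewrite ler_wpM2l//.
have [s2|s2] := lerP 1 s; first by rewrite mulr1; lra.
by rewrite -expr2; lra.
Qed.

End GaussianShiftBounds.

(** * Integrals over the half-line *)

Section HalfLine.
Context (R : realType).
Local Notation mu := (@lebesgue_measure R).
Local Notation D := (`]0%R, +oo[%classic : set R).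
Implicit Types (f F g : R -> R) (t b x : R).

(** As [f] may be singular at 0, the fundamental theorem is applied on [[1 / (n + 1), +oo[], where
    the integral is [- F (1 / (n + 1))]; monotone convergence then gives integrability and the bound
    together. *)
Lemma halfline_integral_le f F B : (forall x, 0 < x -> 0 <= f x) ->
  (forall x, 0 < x -> {for x, continuous f}) ->
  (forall x, 0 < x -> is_derive x 1 (F : R -> R^o) (f x)) ->
  F x @[x --> +oo] --> (0 : R) -> (forall x, 0 < x -> - F x <= B) ->
  mu.-integrable D (EFin \o f) /\ \int[mu]_(x in D) f x <= B.
Proof.
move=> f0 cf dF F0 FB.
have inD x : D x -> 0 < x by rewrite /= in_itv/= andbT.
have mD : measurable_fun D f.
  apply: open_continuous_measurable_fun; first exact: interval_open.
  by move=> x; rewrite inE => /inD; exact: cf.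
pose I n : set R := `[n.+1%:R^-1, +oo[%classic.
have DI : D = \bigcup_n I n.
  apply/seteqP; split=> x /=; last first.
    case=> n _; rewrite /I /= !in_itv/= !andbT; apply: lt_le_trans.
    by rewrite invr_gt0.
  rewrite in_itv/= andbT => x0; exists (Num.truncn x^-1) => //.
  rewrite /I /= in_itv/= andbT -[leRHS]invrK lef_pV2 ?posrE ?invr_gt0//.
  by apply/ltW; exact: truncnS_gt.
have ID n : I n `<=` D by rewrite DI; exact: bigcup_sup.
have intI n : (\int[mu]_(x in I n) (f x)%:E = (- F n.+1%:R^-1)%:E)%E.
  have n0 : 0 < n.+1%:R^-1 :> R by rewrite invr_gt0.
  rewrite (@ge0_continuous_FTC2y _ f F _ 0) ?sub0e//.
  - by move=> x nx; apply: f0; exact: lt_le_trans nx.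
  - apply: continuous_in_subspaceT => x; rewrite inE => /ID /inD; exact: cf.
  - by move=> x nx; have := dF x (lt_trans n0 nx).
  - apply: cvg_at_right_filter.
    have := dF _ n0 => dFn.
    by apply: differentiable_continuous; apply/derivable1_diffP; exact: ex_derive.
  - move=> x; rewrite in_itv/= andbT => nx; have := dF x (lt_trans n0 nx) => dFx.
    by rewrite derive1E derive_val.
have le : (\int[mu]_(x in D) (f x)%:E <= B%:E)%E.
  have c : (\int[mu]_(x in I n) (f x)%:E)%E @[n --> \oo] --> (\int[mu]_(x in D) (f x)%:E)%E.
    rewrite DI; apply: ge0_nondecreasing_set_cvg_integral.
    - move=> i j ij; apply/subsetPset => x; rewrite /I /= !in_itv/= !andbT.
      by apply: le_trans; rewrite lef_pV2 ?posrE// ler_nat ltnS.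
    - by move=> n; exact: measurable_itv.
    - by move=> n; apply/measurable_EFinP; apply: measurable_funS mD => //; exact: measurable_itv.
    - by move=> n x /ID /inD x0; rewrite lee_fin f0.
  apply: (cvge_to_le c); apply: nearW => n.
  by rewrite intI lee_fin FB// invr_gt0.
have i : mu.-integrable D (EFin \o f).
  apply/integrableP; split; first exact/measurable_EFinP.
  apply: le_lt_trans (ltry B); apply: le_trans le.
  rewrite le_eqVlt; apply/orP; left; apply/eqP; apply: eq_integral => x.
  by rewrite inE => /inD x0; rewrite /= ger0_norm// f0.
split=> //; rewrite -lee_fin fineK//; exact: integrable_fin_num.
Qed.

Lemma halfline_expR_le a : 0 < a ->
  mu.-integrable D (EFin \o (fun t => expR (- (a * t)))) /\
  \int[mu]_(t in D) expR (- (a * t)) <= a^-1.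
Proof.
move=> a0.
have dF x : is_derive x 1 ((fun t => - (a^-1 * expR (- (a * t)))) : R -> R^o) (expR (- (a * x))).
  by apply: is_derive_eq; rewrite /GRing.scale /=; field; rewrite gt_eqF.
apply: halfline_integral_le (fun x _ => dF x) _ _ => [x _|x _||x x0].
- exact: expR_ge0.
- apply: (cvg_comp (fun t => - (a * t)) expR); last exact: continuous_expR.
  by apply: cvgN; apply: cvgM; [exact: cvg_cst|exact: cvg_id].
- rewrite -oppr0; apply: cvgN; rewrite -[X in _ --> X](mulr0 a^-1).
  apply: cvgM; first exact: cvg_cst.
  apply: (@cvg_comp _ _ _ (fun t => a * t) (fun t => expR (- t)) _ (pinfty_nbhs R)).
    exact: gt0_cvgMry.
  exact: cvgr_expR.
- rewrite opprK ler_piMr ?invr_ge0 ?(ltW a0)// -expR0 ler_expR oppr_le0.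
  by rewrite mulr_ge0// ltW.
Qed.

(* Derivative of [- 2 b^2 / (b + sqrt t)]; it dominates [t^(-1/2)] for [t <= b^2] and [b^2 t^(-3/2)] for
   [t >= b^2], up to a factor [4]. *)
Definition sing_kernel b t := b ^+ 2 / (Num.sqrt t * (b + Num.sqrt t) ^+ 2).

Lemma halfline_sing_kernel_le b : 0 < b ->
  mu.-integrable D (EFin \o sing_kernel b) /\ \int[mu]_(t in D) sing_kernel b t <= 2 * b.
Proof.
move=> b0.
have bs x : 0 < b + Num.sqrt x by rewrite ltr_wpDr// sqrtr_ge0.
pose F x := - (2 * b ^+ 2 * (b + Num.sqrt x)^-1).
apply: (@halfline_integral_le (sing_kernel b) F (2 * b)) => [x x0|x x0|x x0||x x0].
- by rewrite /sing_kernel divr_ge0 ?sqr_ge0// mulr_ge0 ?sqrtr_ge0 ?sqr_ge0.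
- have sx : Num.sqrt y @[y --> x] --> Num.sqrt x by exact: sqrt_continuous.
  have bx : b + Num.sqrt y @[y --> x] --> b + Num.sqrt x by apply: cvgD => //; exact: cvg_cst.
  apply: cvgM; first exact: cvg_cst.
  apply: cvgV; first by rewrite mulf_neq0 ?expf_neq0 ?gt_eqF// sqrtr_gt0.
  by apply: cvgM => //; rewrite !expr2; apply: cvgM.
- have ds := is_derive1_sqrt x0.
  have s0 : 0 < Num.sqrt x by rewrite sqrtr_gt0.
  have nz : b + Num.sqrt x != 0 by rewrite gt_eqF.
  rewrite /F; apply: is_derive_eq; rewrite /GRing.scale /= /sing_kernel.
  by field; rewrite nz gt_eqF.
- apply/cvgrPdist_le => e e0; near=> x.
  rewrite sub0r /F opprK ger0_norm; last first.
    by apply: divr_ge0; [apply: mulr_ge0 => //; exact: sqr_ge0|exact: ltW].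
  rewrite ler_pdivrMr// -ler_pdivrMl//.
  have -> : e^-1 * (2 * b ^+ 2) = Num.sqrt ((e^-1 * (2 * b ^+ 2)) ^+ 2).
    by rewrite sqrtr_sqr ger0_norm// mulr_ge0 ?invr_ge0 ?(ltW e0)// mulr_ge0 ?sqr_ge0.
  apply: ler_wpDl; first exact: ltW.
  apply: ler_wsqrtr; near: x; apply: nbhs_pinfty_ge; exact: num_real.
- rewrite /F opprK ler_pdivrMr// expr2.
  have := sqrtr_ge0 x => s0.
  have : 0 <= b * Num.sqrt x by rewrite mulr_ge0// ltW.
  lra.
Unshelve. all: by end_near. Qed.

Lemma sing_kernel_small b t : 0 < b -> 0 < t -> t <= b ^+ 2 -> (Num.sqrt t)^-1 <= 4 * sing_kernel b t.
Proof.
move=> b0 t0 tb; have s0 : 0 < Num.sqrt t by rewrite sqrtr_gt0.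
have sb : Num.sqrt t <= b by rewrite -(ger0_norm (ltW b0)) -sqrtr_sqr ler_wsqrtr.
rewrite /sing_kernel; set s := Num.sqrt t in s0 sb *.
have bs : 0 < (b + s) ^+ 2 by rewrite exprn_gt0// addr_gt0.
have -> : 4 * (b ^+ 2 / (s * (b + s) ^+ 2)) = 4 * b ^+ 2 / (b + s) ^+ 2 * s^-1.
  by field; rewrite !gt_eqF// addr_gt0.
rewrite ler_peMl ?invr_ge0 ?(ltW s0)// ler_pdivlMr// mul1r.
have -> : 4 * b ^+ 2 = (2 * b) ^+ 2 by ring.
by rewrite lerXn2r ?nnegrE//; lra.
Qed.

Lemma sing_kernel_large b t : 0 < b -> 0 < t -> b ^+ 2 <= t ->
  b ^+ 2 * (Num.sqrt t)^-1 ^+ 3 <= 4 * sing_kernel b t.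
Proof.
move=> b0 t0 tb; have s0 : 0 < Num.sqrt t by rewrite sqrtr_gt0.
have sb : b <= Num.sqrt t by rewrite -(ger0_norm (ltW b0)) -sqrtr_sqr ler_wsqrtr.
rewrite /sing_kernel; set s := Num.sqrt t in s0 sb *.
have bs : 0 < (b + s) ^+ 2 by rewrite exprn_gt0// addr_gt0.
have p0 : 0 < s * (b + s) ^+ 2 by exact: mulr_gt0.
have bs0 : 0 < b + s by exact: addr_gt0.
rewrite [leRHS]mulrCA; apply: ler_wpM2l; first exact: sqr_ge0.
rewrite ler_pdivlMr//.
have -> : s^-1 ^+ 3 * (s * (b + s) ^+ 2) = ((b + s) / s) ^+ 2 by field; rewrite gt_eqF.
have -> : (4 : R) = 2 * 2 by ring.
have h0 : 0 <= (b + s) / s by rewrite divr_ge0 ?ltW.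
have h : (b + s) / s <= 2 by rewrite ler_pdivrMr//; lra.
by rewrite expr2; exact: ler_pM.
Qed.

End HalfLine.

(** * Time weights of the Ornstein-Uhlenbeck semigroup *)

Section OUKernel.
Context (R : realType).
Local Notation mu := (@lebesgue_measure R).
Local Notation D := (`]0%R, +oo[%classic : set R).
Implicit Types t s : R.

Definition ou_noise t := Num.sqrt (1 - expR (- (2 * t))).

(** Translating [x] by [h] in [T(t)f(x)] amounts to translating the Gaussian variable by
    [ou_shift t *: h]. At [t = 0] this is a division by 0, so the integrals in [t] run over the open
    half-line. *)
Definition ou_shift t := expR (- t) / ou_noise t.

Let expR2 t : expR (- (2 * t)) = expR (- t) ^+ 2.
Proof. by rewrite -expRM_natl mulrN. Qed.

Lemma ou_noise_gt0 t : 0 < t -> 0 < ou_noise t.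
Proof.
move=> t0; rewrite sqrtr_gt0 subr_gt0 -[ltRHS]expR0 ltr_expR; lra.
Qed.

Lemma ou_shift_gt0 t : 0 < t -> 0 < ou_shift t.
Proof. by move=> t0; rewrite divr_gt0 ?expR_gt0 ?ou_noise_gt0. Qed.

Lemma ou_noise_shift t : 0 < t -> ou_noise t * ou_shift t = expR (- t).
Proof. by move=> t0; rewrite mulrCA divff ?mulr1// gt_eqF// ou_noise_gt0. Qed.

(** Squared, this reads [t exp (-2 t) <= 1 - exp (-2 t)], a consequence of
    [1 + 2 t <= exp (2 t)]. *)
Lemma ou_shift_le t : 0 < t -> ou_shift t <= (Num.sqrt t)^-1.
Proof.
move=> t0; have n0 := ou_noise_gt0 t0; have s0 : 0 < Num.sqrt t by rewrite sqrtr_gt0.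
rewrite /ou_shift ler_pdivrMr// mulrC ler_pdivlMr//.
rewrite -(@ler_pXn2r _ 2) ?nnegrE ?mulr_ge0 ?expR_ge0 ?(ltW n0) ?(ltW s0)//.
have e1 : ou_noise t ^+ 2 = 1 - expR (- t) ^+ 2.
  by rewrite sqr_sqrtr ?expR2// -expR2 subr_ge0 -[leRHS]expR0 ler_expR; lra.
rewrite exprMn sqr_sqrtr ?(ltW t0)// e1.
have := expR_ge1Dx (2 * t) => h.
have : expR (- t) ^+ 2 * (1 + 2 * t) <= 1.
  rewrite -expR2; apply: le_trans (ler_wpM2l (expR_ge0 _) h) _.
  by rewrite -expRD addNr expR0.
have : 0 <= expR (- t) ^+ 2 * t by rewrite mulr_ge0 ?sqr_ge0 ?(ltW t0).
lra.
Qed.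

Lemma cvg_expR_comp (u : nat -> R) t : u n @[n --> \oo] --> t ->
  expR (u n) @[n --> \oo] --> expR t.
Proof. by move=> ut; apply: (cvg_comp u expR ut); exact: continuous_expR. Qed.

Lemma cvg_sqrt_comp (u : nat -> R) t : u n @[n --> \oo] --> t ->
  Num.sqrt (u n) @[n --> \oo] --> Num.sqrt t.
Proof. by move=> ut; apply: (cvg_comp u Num.sqrt ut); exact: sqrt_continuous. Qed.

Lemma ou_noise_cvg (u : nat -> R) t : u n @[n --> \oo] --> t ->
  ou_noise (u n) @[n --> \oo] --> ou_noise t.
Proof.
move=> ut; apply: cvg_sqrt_comp; apply: cvgB; first exact: cvg_cst.
by apply: cvg_expR_comp; apply: cvgN; apply: cvgM => //; exact: cvg_cst.
Qed.

(** Reduces continuity in [t] to sequences, the form in which dominated convergence is stated. *)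
Lemma continuous_seqP (g : R -> R) : (forall (u : nat -> R) t, u n @[n --> \oo] --> t ->
  g (u n) @[n --> \oo] --> g t) -> continuous g.
Proof. by move=> gc t; apply/(@cvg_nbhsP _ R^o) => u /gc. Qed.

Lemma measurable_ou_shift : measurable_fun D ou_shift.
Proof.
apply: open_continuous_measurable_fun; first exact: interval_open.
move=> t; rewrite inE /= in_itv/= andbT => t0; apply/(@cvg_nbhsP _ R^o) => u ut.
apply: cvgM; first by apply: cvg_expR_comp; exact: cvgN.
by apply: cvgV; [rewrite gt_eqF// ou_noise_gt0|exact: ou_noise_cvg].
Qed.

Variable lam : R.
Hypothesis lam0 : 0 < lam.

Definition ou_weight t := expR (- (lam * t)) * ou_shift t.

Let inD t : D t -> 0 < t.
Proof. by rewrite /= in_itv/= andbT. Qed.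

Let mexp : measurable_fun D (fun t => expR (- (lam * t))).
Proof. by have [/measurable_int/measurable_EFinP] := halfline_expR_le lam0. Qed.

Lemma ou_weight_ge0 t : 0 < t -> 0 <= ou_weight t.
Proof. by move=> t0; rewrite mulr_ge0 ?expR_ge0// ltW// ou_shift_gt0. Qed.

Lemma measurable_ou_weight : measurable_fun D ou_weight.
Proof. by apply: measurable_funM => //; exact: measurable_ou_shift. Qed.

Let exp_le1 t : 0 < t -> expR (- (lam * t)) <= 1.
Proof. by move=> t0; rewrite -expR0 ler_expR oppr_le0 mulr_ge0 ?(ltW lam0) ?(ltW t0). Qed.

(** The singularity on []0, 1]] is dominated by [4 * sing_kernel 1], of integral at most 8, and the
    tail by the exponential, of integral at most [lam^-1]. *)
Lemma integral_ou_weight : mu.-integrable D (EFin \o ou_weight) /\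
  \int[mu]_(t in D) ou_weight t <= 8 + lam^-1.
Proof.
have [i1 l1] := halfline_sing_kernel_le (ltr01 : 0 < 1 :> R).
have [i2 l2] := halfline_expR_le lam0.
have mD : measurable (D : set (measurableTypeR R)) by exact: measurable_itv.
have i3 := RintegrableD mD (RintegrableZl mD 4 i1) i2.
have le t : D t -> ou_weight t <= 4 * sing_kernel 1 t + expR (- (lam * t)).
  move=> /inD t0; have sk : 0 <= sing_kernel 1 t.
    by rewrite /sing_kernel divr_ge0 ?sqr_ge0// mulr_ge0 ?sqrtr_ge0 ?sqr_ge0.
  have c0 := ltW (ou_shift_gt0 t0); have c1 := ou_shift_le t0.
  rewrite /ou_weight; have [t1|t1] := lerP t 1.
    apply: ler_wpDr; first exact: expR_ge0.
    apply: le_trans (ler_piMl c0 (exp_le1 t0)) _; apply: le_trans c1 _.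
    by apply: sing_kernel_small => //; rewrite expr1n.
  apply: ler_wpDl; first by rewrite mulr_ge0.
  rewrite ler_piMr ?expR_ge0//; apply: le_trans c1 _.
  by rewrite invf_le1 ?sqrtr_gt0// -sqrtr1 ler_wsqrtr// ltW.
have i4 : mu.-integrable D (EFin \o ou_weight).
  apply: le_Rintegrable i3 => //; first exact: measurable_ou_weight.
  by move=> t Dt; rewrite ger0_norm; [exact: le|apply: ou_weight_ge0; exact: inD].
split=> //; apply: le_trans (le_Rintegral mD i4 i3 le) _.
rewrite RintegralD//; last exact: RintegrableZl.
by rewrite RintegralZl//; lra.
Qed.

Lemma halfline_int_le (g B : R -> R) : measurable_fun D g -> mu.-integrable D (EFin \o B) ->
  (forall t, 0 < t -> `|g t| <= B t) ->
  mu.-integrable D (EFin \o g) /\ `|\int[mu]_(t in D) g t| <= \int[mu]_(t in D) B t.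
Proof.
move=> mg iB gB.
have mD : measurable (D : set (measurableTypeR R)) by exact: measurable_itv.
have ig : mu.-integrable D (EFin \o g).
  by apply: le_Rintegrable iB => // t /inD; exact: gB.
split=> //; apply: le_trans (le_normr_Rintegral mD ig) _.
by apply: le_Rintegral => //; [exact: integrable_norm|move=> t /inD; exact: gB].
Qed.

(** The threshold is [b = sqrt s]. Where [c s <= b] the minimum is at most [b]; elsewhere
    [c <= t^(-1/2)] forces [t <= b^2], and [4 * sing_kernel b] dominates. The two parts contribute
    [s b (8 + 1 / lam)] and [8 s b]. *)
Lemma ou_weight_first_order s : 0 <= s ->
  exists B : R -> R, [/\ mu.-integrable D (EFin \o B),
    \int[mu]_(t in D) B t <= (16 + lam^-1) * (s * Num.sqrt s) &
    forall t, 0 < t -> expR (- (lam * t)) * (ou_shift t * s * Num.min 1 (ou_shift t * s)) <= B t].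
Proof.
rewrite le_eqVlt => /orP[/eqP <-|s0].
  exists (fun _ => 0); split.
  - exact: integrable0.
  - by rewrite /Rintegral integral0 mul0r mulr0.
  - by move=> t t0; rewrite mulr0 mul0r mulr0.
have mD : measurable (D : set (measurableTypeR R)) by exact: measurable_itv.
pose b := Num.sqrt s; have b0 : 0 < b by rewrite sqrtr_gt0.
have bs : b ^+ 2 = s by rewrite sqr_sqrtr ?(ltW s0).
have [i1 l1] := halfline_sing_kernel_le b0.
have [i2 l2] := integral_ou_weight.
exists (fun t => s * (4 * sing_kernel b t + b * ou_weight t)).
have i3 := RintegrableD mD (RintegrableZl mD 4 i1) (RintegrableZl mD b i2).
split.
- exact: RintegrableZl.
- rewrite RintegralZl// RintegralD//; [|exact: RintegrableZl|exact: RintegrableZl].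
  rewrite (RintegralZl _ mD i1) (RintegralZl _ mD i2) [leRHS]mulrCA; apply: ler_wpM2l; first exact: ltW.
  have : b * \int[mu]_(t in D) ou_weight t <= b * (8 + lam^-1) by rewrite ler_wpM2l// ltW.
  rewrite -/b; lra.
move=> t t0; have c0 := ltW (ou_shift_gt0 t0); have c1 := ou_shift_le t0.
have sk : 0 <= sing_kernel b t.
  by rewrite /sing_kernel divr_ge0 ?sqr_ge0// mulr_ge0 ?sqrtr_ge0 ?sqr_ge0.
have w0 := ou_weight_ge0 t0; have e1 := exp_le1 t0; have e0 := expR_ge0 (- (lam * t)).
set mn := Num.min 1 _; have mn1 : mn <= 1 by rewrite ge_min lexx.
have mns : mn <= ou_shift t * s by rewrite ge_min lexx orbT.
have mn0 : 0 <= mn by rewrite le_min ler01 mulr_ge0// ltW.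
have -> : expR (- (lam * t)) * (ou_shift t * s * mn) = s * (ou_weight t * mn) by rewrite /ou_weight; ring.
rewrite ler_wpM2l ?(ltW s0)//.
have [cb|cb] := lerP (ou_shift t * s) b.
  apply: ler_wpDl; first by rewrite mulr_ge0.
  by rewrite mulrC ler_wpM2r// (le_trans mns).
apply: ler_wpDr; first by rewrite mulr_ge0// ltW.
apply: (@le_trans _ _ (ou_shift t)).
  by apply: le_trans (ler_piMr w0 mn1) _; exact: ler_piMl.
apply: le_trans (c1) _; apply: sing_kernel_small => //.
have st0 : 0 < Num.sqrt t by rewrite sqrtr_gt0.
have h : b < (Num.sqrt t)^-1 * s.
  by apply: lt_le_trans cb _; apply: ler_wpM2r => //; exact: ltW.
have h2 : Num.sqrt t < b.
  by move: h; rewrite mulrC ltr_pdivlMr// -bs expr2 ltr_pM2l.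
rewrite -[t]sqr_sqrtr ?(ltW t0)// !expr2.
by apply: ler_pM; rewrite ?sqrtr_ge0// ltW.
Qed.

(** The regime changes at [t = s^2]: below it [c <= t^(-1/2)] is used, above it
    [c^3 s^2 <= s^2 t^(-3/2)]. Four times [sing_kernel s] covers both, and its integral is linear in
    [s]. *)
Lemma ou_weight_second_order s : 0 <= s ->
  exists B : R -> R, [/\ mu.-integrable D (EFin \o B),
    \int[mu]_(t in D) B t <= 8 * s &
    forall t, 0 < t -> ou_weight t * Num.min 1 (ou_shift t ^+ 2 * s ^+ 2) <= B t].
Proof.
rewrite le_eqVlt => /orP[/eqP <-|s0].
  exists (fun _ => 0); split.
  - exact: integrable0.
  - by rewrite /Rintegral integral0 mulr0.
  - by move=> t t0; rewrite expr0n/= mulr0 min_r// mulr0.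
have mD : measurable (D : set (measurableTypeR R)) by exact: measurable_itv.
have [i1 l1] := halfline_sing_kernel_le s0.
exists (fun t => 4 * sing_kernel s t); split.
- exact: RintegrableZl.
- by rewrite RintegralZl//; lra.
move=> t t0; have c0 := ltW (ou_shift_gt0 t0); have c1 := ou_shift_le t0.
have e1 := exp_le1 t0.
set mn := Num.min 1 _; have mn1 : mn <= 1 by rewrite ge_min lexx.
have mns : mn <= ou_shift t ^+ 2 * s ^+ 2 by rewrite ge_min lexx orbT.
have mn0 : 0 <= mn by rewrite le_min ler01 mulr_ge0// sqr_ge0.
apply: (@le_trans _ _ (ou_shift t * mn)).
  by rewrite ler_wpM2r//; exact: ler_piMl.
have [ts|ts] := lerP t (s ^+ 2).
  by apply: le_trans (ler_piMr c0 mn1) _; apply: le_trans c1 _; exact: sing_kernel_small.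
apply: (@le_trans _ _ (s ^+ 2 * (Num.sqrt t)^-1 ^+ 3)); last exact: sing_kernel_large (ltW ts).
apply: (@le_trans _ _ (ou_shift t * (ou_shift t ^+ 2 * s ^+ 2))); first by rewrite ler_wpM2l.
have -> : ou_shift t * (ou_shift t ^+ 2 * s ^+ 2) = s ^+ 2 * ou_shift t ^+ 3 by ring.
by rewrite ler_wpM2l ?sqr_ge0// lerXn2r ?nnegrE ?invr_ge0 ?sqrtr_ge0.
Qed.

End OUKernel.

(** * The gradient of the resolvent *)

Section OUResolventGradient.
Context (R : realType) (X : completeNormedModType R) (gamma : probability (borel X) R).
Hypothesis sepX : separable_space X.
Hypothesis gauss : centered_gaussian gamma.
Local Notation mu := (@lebesgue_measure R).
Local Notation D := (`]0%R, +oo[%classic : set (measurableTypeR R)).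
Local Notation E := (expect gamma).
Local Notation sdev := (sd gamma).
Local Notation hnrm := (hnorm gamma).
Implicit Types (l m w : X -> R) (x y g h : X) (t : R).

Variable lam : R.
Hypothesis lam0 : 0 < lam.
Variables (f : X -> R) (M : R).
Hypotheses (cf : continuous f) (fM : forall x, `|f x| <= M).

Let M0 : 0 <= M. Proof. exact: le_trans (fM 0). Qed.

Let mD : measurable D. Proof. exact: measurable_itv. Qed.

Let inD t : D t -> 0 < t.
Proof. by rewrite /= in_itv/= andbT. Qed.

Let W := ou_weight lam.

Definition ou_fun x t y := f (expR (- t) *: x + ou_noise t *: y).

Let ou_fun_cvg (x_ : nat -> X) (t_ : nat -> R) x t y :
  x_ n @[n --> \oo] --> x -> t_ n @[n --> \oo] --> t ->
  ou_fun (x_ n) (t_ n) y @[n --> \oo] --> ou_fun x t y.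
Proof.
move=> cx ct; apply: (cvg_comp _ f); last exact: cf.
apply: cvgD; first by apply: cvgZ => //; apply: cvg_expR_comp; exact: cvgN.
by apply: cvgZ; [exact: ou_noise_cvg|exact: cvg_cst].
Qed.

Let bmeas_ou x t : bmeas (ou_fun x t).
Proof.
apply: continuous_borel_measurable => y; apply: (cvg_comp _ f); last exact: cf.
by apply: cvgD; [exact: cvg_cst|apply: cvgZ; [exact: cvg_cst|exact: cvg_id]].
Qed.

Let ou_bound x t y : `|ou_fun x t y| <= M. Proof. exact: fM. Qed.

Let nice_ou x t : nice (ou_fun x t).
Proof. exact: nice_bounded (bmeas_ou x t) (ou_bound x t). Qed.

Lemma ou_fun_shift x h t y a : 0 < t ->
  ou_fun (x + a *: h) t y = ou_fun x t (y + (a * ou_shift t) *: h).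
Proof.
move=> t0; rewrite /ou_fun !scalerDr -addrA; congr (f (_ + _)).
rewrite addrC; congr (_ + _); rewrite !scalerA mulrCA ou_noise_shift// mulrC.
by [].
Qed.

(** Joint continuity in [x] and [t]: in [t] it gives measurability for the outer integral, in [x]
    the continuity of the resolvent. *)
Let Eou_cvg (x_ : nat -> X) (t_ : nat -> R) x t w : nice w ->
  x_ n @[n --> \oo] --> x -> t_ n @[n --> \oo] --> t ->
  E (fun y => ou_fun (x_ n) (t_ n) y * w y) @[n --> \oo] --> E (fun y => ou_fun x t y * w y).
Proof.
move=> nw cx ct; apply: (expect_dominated_cvg gauss (niceZ M (nice_norm nw))).
- by move=> n; have [] := niceM (nice_ou (x_ n) (t_ n)) nw.
- by move=> n y; rewrite normrM ler_wpM2r.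
- by move=> y; apply: cvgM; [exact: ou_fun_cvg|exact: cvg_cst].
Qed.

Let measurable_Eou x w : nice w -> measurable_fun D (fun t => E (fun y => ou_fun x t y * w y)).
Proof.
move=> nw; apply: (measurable_funS measurableT) => //.
apply: continuous_measurable_fun; apply: continuous_seqP => u t ut.
by apply: Eou_cvg => //; exact: cvg_cst.
Qed.

Let Eou_le x t w : nice w -> `|E (fun y => ou_fun x t y * w y)| <= M * Num.sqrt (E (fun y => w y ^+ 2)).
Proof. by move=> nw; exact: expect_bdd_le. Qed.

Definition Gam x w := \int[mu]_(t in D) (W t * E (fun y => ou_fun x t y * w y)).

Let Gam_integrable x w : nice w ->
  mu.-integrable D (EFin \o (fun t => W t * E (fun y => ou_fun x t y * w y))) /\
  `|Gam x w| <= (8 + lam^-1) * M * Num.sqrt (E (fun y => w y ^+ 2)).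
Proof.
move=> nw; have [iW lW] := integral_ou_weight lam0.
set s := Num.sqrt _.
have s0 : 0 <= s by exact: sqrtr_ge0.
have [|||i le] := @halfline_int_le R (fun t => W t * E (fun y => ou_fun x t y * w y)) (fun t => M * s * W t).
- by apply: measurable_funM; [exact: measurable_ou_weight|exact: measurable_Eou].
- exact: RintegrableZl.
- move=> t t0; have w0 := ou_weight_ge0 lam t0; rewrite normrM ger0_norm// mulrC.
  by apply: ler_wpM2r => //; exact: Eou_le.
split=> //; apply: le_trans le _; rewrite RintegralZl//.
have -> : (8 + lam^-1) * M * s = M * s * (8 + lam^-1) by ring.
by apply: ler_wpM2l => //; exact: mulr_ge0.
Qed.

Lemma Gam_represented : exists G : X -> X, forall x m, dual_elt m -> Gam x m = m (G x).
Proof.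
suff GamR x : exists g, forall m, dual_elt m -> Gam x m = m g.
  by have [G GP] := choice GamR; exists G.
apply: (pettis sepX gauss (C := ((8 + lam^-1) * M) ^+ 2)).
- move=> w1 w2 n1 n2; have [i1 _] := Gam_integrable x n1; have [i2 _] := Gam_integrable x n2.
  rewrite /Gam -(RintegralD mD i1 i2); apply: eq_Rintegral => t _.
  have e := expectD gauss (niceM (nice_ou x t) n1) (niceM (nice_ou x t) n2).
  rewrite -mulrDr -e; congr (_ * _); congr expect; apply/funext => y; exact: mulrDr.
- move=> r w nw; have [i _] := Gam_integrable x nw.
  rewrite /Gam -(RintegralZl r mD i); apply: eq_Rintegral => t _.
  have e := expectZ gauss r (niceM (nice_ou x t) nw).
  rewrite mulrCA -e; congr (_ * _); congr expect; apply/funext => y; exact: mulrCA.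
- move=> w nw; have [_ le] := Gam_integrable x nw.
  have W0 : 0 <= E (fun y => w y ^+ 2) by apply: expect_ge0 => y; exact: sqr_ge0.
  rewrite -[X in _ <= _ * X](sqr_sqrtr W0) -exprMn -real_normK ?num_real// !expr2.
  by apply: ler_pM.
- exact: sqr_ge0.
Qed.

Let u x := OU_resolvent gamma lam f x.

Let mEou1 x : measurable_fun D (fun t => E (ou_fun x t)).
Proof.
have := measurable_Eou x (nice_cst X 1).
rewrite (_ : (fun t => E (fun y => ou_fun x t y * 1)) = (fun t => E (ou_fun x t)))//.
by apply/funext => t; congr expect; apply/funext => y; rewrite mulr1.
Qed.

Let Eou1_le x t : `|E (ou_fun x t)| <= M.
Proof.
apply: le_trans (expect_norm gauss (nice_ou x t)) _.
rewrite -[leRHS](expect_cst gamma); apply: (expect_le gauss) => [||y]; last exact: ou_bound.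
  by apply: nice_norm; exact: nice_ou.
exact: nice_cst.
Qed.

Let u_integrable x :
  mu.-integrable D (EFin \o (fun t => expR (- (lam * t)) * E (ou_fun x t))).
Proof.
have [i _] := halfline_expR_le lam0.
have [|||//] := @halfline_int_le R (fun t => expR (- (lam * t)) * E (ou_fun x t))
    (fun t => M * expR (- (lam * t))).
- apply: measurable_funM; last exact: mEou1.
  by have [/measurable_int/measurable_EFinP] := halfline_expR_le lam0.
- exact: RintegrableZl.
- move=> t t0; rewrite normrM [X in X * _]ger0_norm ?expR_ge0// mulrC.
  by apply: ler_wpM2r; [exact: expR_ge0|exact: Eou1_le].
Qed.

(** The point 0, present in the definition of the resolvent, has measure 0; it is dropped because
    [ou_shift] degenerates there. *)
Let uE x : u x = \int[mu]_(t in D) (expR (- (lam * t)) * E (ou_fun x t)).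
Proof. by rewrite (Rintegral_itv_obnd_cbnd (u_integrable x)). Qed.

Lemma OU_resolvent_cvg (x_ : nat -> X) x : x_ n @[n --> \oo] --> x ->
  OU_resolvent gamma lam f (x_ n) @[n --> \oo] --> OU_resolvent gamma lam f x.
Proof.
move=> cx; rewrite -/(u x) uE.
rewrite (_ : (fun n => _) = (fun n => \int[mu]_(t in D) (expR (- (lam * t)) * E (ou_fun (x_ n) t)))); last first.
  by apply/funext => n; exact: uE.
have [i _] := halfline_expR_le lam0.
apply: (@Rintegral_dominated_cvg _ _ _ mu D mD _ _ (fun t => M * expR (- (lam * t)))).
- by move=> n; apply/measurable_EFinP; exact: measurable_int (u_integrable (x_ n)).
- move=> t _; apply: cvgM; first exact: cvg_cst.
  have c := Eou_cvg (nice_cst X 1) cx (cvg_cst t : (fun _ : nat => t) n @[n --> \oo] --> t).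
  have e z : E (ou_fun z t) = E (fun y => ou_fun z t y * 1).
    by congr expect; apply/funext => y; rewrite mulr1.
  have en : (fun n => E (ou_fun (x_ n) t)) = (fun n => E (fun y => ou_fun (x_ n) t y * 1)).
    by apply/funext => n; exact: e.
  by rewrite en e; exact: c.
- exact: RintegrableZl.
- move=> n t _; rewrite normrM [X in X * _]ger0_norm ?expR_ge0// mulrC.
  by apply: ler_wpM2r; [exact: expR_ge0|exact: Eou1_le].
Qed.

Variable G : X -> X.
Hypothesis GE : forall x m, dual_elt m -> Gam x m = m (G x).

Let sdE m : Num.sqrt (E (fun y => m y ^+ 2)) = sdev m.
Proof. by rewrite /sd; congr Num.sqrt; congr expect; apply/funext => y; rewrite expr2. Qed.

Lemma gradient_bound x : in_CM gamma (G x) /\ hnrm (G x) <= (8 + lam^-1) * M.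
Proof.
apply: hnorm_le => //; first by rewrite mulr_ge0// addr_ge0// invr_ge0 ltW.
move=> m dm; rewrite -GE//; apply: le_trans (ler_norm _) _.
by rewrite -sdE; have [] := Gam_integrable x (nice_dual dm).
Qed.

Let GCM x : in_CM gamma (G x). Proof. by have [] := gradient_bound x. Qed.

(** For fixed [t], a second difference in [x] with step [h] is one in the Gaussian variable with
    step [ou_shift t *: h]. The constant [88 = 11 * 8] multiplies those of the bound at fixed [t]
    and of the integral in [t]. *)
Let second_difference_rep x h l : dual_elt l -> represents gamma h l ->
  hnrm (G (x + 2 *: h) - 2 *: G (x + h) + G x) <= 88 * M * sdev l.
Proof.
move=> dl hl; have s0 := sd_ge0 gamma l.
have [B [iB lB BP]] := ou_weight_second_order lam0 s0.
refine (hnorm_le gauss _ _).2.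
  by rewrite !mulr_ge0.
move=> m dm; have nm := nice_dual dm; have sm0 := sd_ge0 gamma m.
have [i2 _] := Gam_integrable (x + 2 *: h) nm.
have [i1 _] := Gam_integrable (x + h) nm.
have [i0 _] := Gam_integrable x nm.
rewrite (dual_eltD _ _ dm) (dual_eltB _ _ dm) (dual_eltZ _ _ dm) -!GE// /Gam.
rewrite -(RintegralZl 2 mD i1) -(RintegralB mD i2 (RintegrableZl mD 2 i1)).
rewrite -(RintegralD mD (RintegrableB mD i2 (RintegrableZl mD 2 i1)) i0).
set F := fun t => _ + _.
have [|||iF le] := @halfline_int_le R F (fun t => M * 11 * sdev m * B t).
- apply/measurable_EFinP; apply: (measurable_int mu).
  exact: (RintegrableD mD (RintegrableB mD i2 (RintegrableZl mD 2 i1)) i0).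
- exact: RintegrableZl.
- move=> t t0; have w0 := ou_weight_ge0 lam t0; have c0 := ltW (ou_shift_gt0 t0).
  have -> : F t = W t * (E (fun y => ou_fun (x + 2 *: h) t y * m y)
    - 2 * E (fun y => ou_fun (x + h) t y * m y) + E (fun y => ou_fun x t y * m y)).
    by rewrite /F mulrDr mulrBr [2 * (_ * _)]mulrCA.
  have -> : (fun y => ou_fun (x + 2 *: h) t y * m y) = (fun y => ou_fun x t (y + (2 * ou_shift t) *: h) * m y).
    by apply/funext => y; rewrite ou_fun_shift.
  have -> : (fun y => ou_fun (x + h) t y * m y) = (fun y => ou_fun x t (y + ou_shift t *: h) * m y).
    by apply/funext => y; rewrite -{1}[h]scale1r ou_fun_shift// mul1r.
  have le := second_difference_bound sepX gauss dl hl dm (ou_shift t) (nice_ou x t) M0 (ou_bound x t).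
  rewrite normrM (ger0_norm w0); apply: le_trans (ler_wpM2l w0 le) _.
  have b := BP t t0; rewrite sd_sqr in b.
  have -> : W t * (M * (11 * Num.min 1 (ou_shift t ^+ 2 * cov gamma l l)) * sdev m) =
    M * 11 * sdev m * (W t * Num.min 1 (ou_shift t ^+ 2 * cov gamma l l)) by ring.
  by apply: ler_wpM2l b; rewrite !mulr_ge0.
apply: le_trans (ler_norm _) _; apply: le_trans le _; rewrite RintegralZl//.
have -> : 88 * M * sdev l * sdev m = M * 11 * sdev m * (8 * sdev l) by ring.
by apply: ler_wpM2l => //; rewrite !mulr_ge0.
Qed.

Let first_order_rep x h l : dual_elt l -> represents gamma h l ->
  `|u (x + h) - u x - l (G x)| <= 6 * M * (16 + lam^-1) * (sdev l * Num.sqrt (sdev l)).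
Proof.
move=> dl hl; have s0 := sd_ge0 gamma l.
have [B [iB lB BP]] := ou_weight_first_order lam0 s0.
have nl := nice_dual dl.
have [i0 _] := Gam_integrable x nl.
have j1 := u_integrable (x + h); have j0 := u_integrable x.
rewrite -GE// !uE /Gam -(RintegralB mD j1 j0) -(RintegralB mD (RintegrableB mD j1 j0) i0).
set F := fun t => _ - _.
have [|||iF le] := @halfline_int_le R F (fun t => M * 6 * B t).
- apply/measurable_EFinP; apply: (measurable_int mu).
  exact: (RintegrableB mD (RintegrableB mD j1 j0) i0).
- exact: RintegrableZl.
- move=> t t0; have c0 := ltW (ou_shift_gt0 t0).
  have -> : F t = expR (- (lam * t)) * (E (ou_fun (x + h) t) - E (ou_fun x t)
      - ou_shift t * E (fun y => ou_fun x t y * l y)).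
    have alg (p c a b d : R) : p * a - p * b - p * c * d = p * (a - b - c * d) by ring.
    exact: alg.
  have -> : ou_fun (x + h) t = (fun y => ou_fun x t (y + ou_shift t *: h)).
    by apply/funext => y; rewrite -{1}[h]scale1r ou_fun_shift// mul1r.
  have le := first_order_bound sepX gauss dl hl c0 (nice_ou x t) M0 (ou_bound x t).
  rewrite normrM [X in X * _]ger0_norm ?expR_ge0//.
  apply: le_trans (ler_wpM2l (expR_ge0 _) le) _.
  rewrite (_ : expR (- (lam * t)) * _ = M * 6 * (expR (- (lam * t)) *
    (ou_shift t * sdev l * Num.min 1 (ou_shift t * sdev l)))); last by ring.
  by apply: ler_wpM2l (BP t t0); rewrite mulr_ge0.
apply: le_trans le _; rewrite RintegralZl//.
have -> : 6 * M * (16 + lam^-1) * (sdev l * Num.sqrt (sdev l)) =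
  M * 6 * ((16 + lam^-1) * (sdev l * Num.sqrt (sdev l))) by ring.
by apply: ler_wpM2l => //; rewrite mulr_ge0.
Qed.

(** The bound has to be uniform in [m]: Cauchy-Schwarz extracts [sd m] and leaves the [L^2] distance
    [N n t] between [ou_fun x t] and [ou_fun (x_ n) t]. It tends to 0 by dominated convergence under
    [gamma], and its weighted integral by dominated convergence in [t]. *)
Lemma gradient_cvg (x_ : nat -> X) x : x_ n @[n --> \oo] --> x ->
  hnrm (G x - G (x_ n)) @[n --> \oo] --> (0 : R).
Proof.
move=> cx.
have [iW _] := integral_ou_weight lam0.
pose d n t y := ou_fun x t y - ou_fun (x_ n) t y.
have d2M n t y : `|d n t y| <= 2 * M.
  by apply: le_trans (ler_normB _ _) _; have := ou_bound x t y; have := ou_bound (x_ n) t y; lra.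
have nd n t : nice (d n t) by apply: niceB; exact: nice_ou.
have d24 n t y : `|d n t y ^+ 2| <= 4 * M ^+ 2.
  rewrite normrX; have -> : 4 * M ^+ 2 = (2 * M) ^+ 2 by ring.
  by rewrite !expr2; apply: ler_pM.
pose N n t := Num.sqrt (E (fun y => d n t y ^+ 2)).
have mN n : measurable_fun D (N n).
  apply: (measurable_funS measurableT) => //.
  apply: continuous_measurable_fun; apply: continuous_seqP => t_ t ct.
  apply: cvg_sqrt_comp; apply: (expect_dominated_cvg gauss (nice_cst X (4 * M ^+ 2))) => //.
  - by move=> k; have [] := niceX 2 (nd n (t_ k)).
  - by move=> y; apply: cvg_sqr; apply: cvgB; apply: ou_fun_cvg => //; exact: cvg_cst.
have NM n t : N n t <= 2 * M.
  have -> : 2 * M = Num.sqrt (4 * M ^+ 2).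
    by rewrite (_ : 4 * M ^+ 2 = (2 * M) ^+ 2) ?sqrtr_sqr ?ger0_norm ?mulr_ge0//; ring.
  rewrite ler_wsqrtr// -[leRHS](expect_cst gamma); apply: (expect_le gauss) => [||y].
  - exact: niceX.
  - exact: nice_cst.
  - exact: le_trans (ler_norm _) (d24 n t y).
have N0 t : N n t @[n --> \oo] --> (0 : R).
  rewrite -(sqrtr0 R); apply: cvg_sqrt_comp; rewrite -[X in _ --> X](expect_cst gamma).
  apply: (expect_dominated_cvg gauss (nice_cst X (4 * M ^+ 2))) => //.
  - by move=> n; have [] := niceX 2 (nd n t).
  - move=> y; rewrite (_ : 0 = (ou_fun x t y - ou_fun x t y) ^+ 2); last by rewrite subrr expr0n.
    apply: cvg_sqr; apply: cvgB; first exact: cvg_cst.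
    by apply: ou_fun_cvg => //; exact: cvg_cst.
have WN n t : 0 < t -> `|W t * N n t| <= 2 * M * W t.
  move=> t0; have w0 := ou_weight_ge0 lam t0.
  rewrite normrM (ger0_norm w0) ger0_norm ?sqrtr_ge0// mulrC.
  exact: ler_wpM2r.
have iWN n : mu.-integrable D (EFin \o (fun t => W t * N n t)).
  have [|||//] := @halfline_int_le R (fun t => W t * N n t) (fun t => 2 * M * W t).
  - by apply: measurable_funM; [exact: measurable_ou_weight|exact: mN].
  - exact: RintegrableZl.
  - exact: WN.
have cWN : \int[mu]_(t in D) (W t * N n t) @[n --> \oo] --> (0 : R).
  rewrite [X in _ --> X](_ : 0 = \int[mu]_(t in D) (W t * 0)); last first.
    by under eq_Rintegral do rewrite mulr0; rewrite /Rintegral integral0.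
  apply: (@Rintegral_dominated_cvg _ _ _ mu D mD _ _ (fun t => 2 * M * W t)).
  - by move=> n; apply/measurable_EFinP; exact: measurable_int (iWN n).
  - by move=> t _; apply: cvgM; [exact: cvg_cst|exact: N0].
  - exact: RintegrableZl.
  - by move=> n t /inD; exact: WN.
apply: (squeeze_cvgr _ (cvg_cst 0) cWN); apply: nearW => n; rewrite (hnorm_ge0 gauss)/=.
refine (hnorm_le gauss _ _).2.
  by apply: Rintegral_ge0 => t /inD t0; rewrite mulr_ge0 ?sqrtr_ge0// ou_weight_ge0.
move=> m dm; have nm := nice_dual dm; have sm0 := sd_ge0 gamma m.
have [i1 _] := Gam_integrable x nm; have [i2 _] := Gam_integrable (x_ n) nm.
rewrite (dual_eltB _ _ dm) -!GE// /Gam -(RintegralB mD i1 i2).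
rewrite [leRHS]mulrC -(RintegralZl (sdev m) mD (iWN n)).
apply: (le_Rintegral mD (RintegrableB mD i1 i2) (RintegrableZl mD (sdev m) (iWN n))).
move=> t /inD t0; have w0 := ou_weight_ge0 lam t0.
rewrite -mulrBr mulrCA; apply: ler_wpM2l => //.
rewrite -(expectB gauss (niceM (nice_ou x t) nm) (niceM (nice_ou (x_ n) t) nm)).
apply: le_trans (ler_norm _) _.
have -> : (fun y => ou_fun x t y * m y - ou_fun (x_ n) t y * m y) = (fun y => d n t y * m y).
  by apply/funext => y; rewrite /d mulrBl.
have D0 : 0 <= E (fun y => d n t y ^+ 2) by apply: expect_ge0 => y; exact: sqr_ge0.
have m0 : 0 <= E (fun y => m y ^+ 2) by apply: expect_ge0 => y; exact: sqr_ge0.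
rewrite -sdE mulrC /N -sqrtrM// -sqrtr_sqr ler_wsqrtr//.
exact: expect_CS.
Qed.

Let in_CM_seq_cvg (h_ : nat -> X) h : in_CM gamma h -> (forall n, in_CM gamma (h_ n)) ->
  hnrm (h - h_ n) @[n --> \oo] --> (0 : R) -> h_ n @[n --> \oo] --> h.
Proof.
move=> hCM hnCM c0; have [K K0 HK] := norm_le_hnorm gauss.
have c1 : K * hnrm (h - h_ n) @[n --> \oo] --> (0 : R).
  by rewrite -[X in _ --> X](mulr0 K); apply: cvgM => //; exact: cvg_cst.
apply/cvgrPdist_le => e e0; move/cvgrPdist_le : c1 => /(_ e e0); apply: filterS => n.
rewrite sub0r normrN => h1; apply: le_trans (HK _ (in_CMB gauss hCM (hnCM n))) _.
exact: le_trans (ler_norm _) h1.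
Qed.

Lemma gradient_second_difference x h : in_CM gamma h ->
  hnrm (G (x + 2 *: h) - 2 *: G (x + h) + G x) <= 88 * M * hnrm h.
Proof.
move=> hCM; have [l_ [h_ [dl hl hnCM ch]]] := in_CM_approx_seq sepX gauss hCM.
have cX := in_CM_seq_cvg hCM hnCM ch.
pose T k := G (x + 2 *: k) - 2 *: G (x + k) + G x.
have TCM k : in_CM gamma (T k).
  by apply: (in_CMD gauss) => //; apply: (in_CMB gauss) => //; exact: (in_CMZ gauss).
have cX2 : x + 2 *: h_ n @[n --> \oo] --> x + 2 *: h.
  by apply: cvgD; [exact: cvg_cst|apply: cvgZ => //; exact: cvg_cst].
have cX1 : x + h_ n @[n --> \oo] --> x + h by apply: cvgD => //; exact: cvg_cst.
have c2 := gradient_cvg cX2.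
have c1 := gradient_cvg cX1.
have cT : hnrm (T h - T (h_ n)) @[n --> \oo] --> (0 : R).
  have c3 : hnrm (G (x + 2 *: h) - G (x + 2 *: h_ n)) + 2 * hnrm (G (x + h) - G (x + h_ n)) @[n --> \oo] --> (0 : R).
    rewrite [X in _ --> X](_ : 0 = 0 + 2 * 0); last by rewrite mulr0 addr0.
    by apply: cvgD => //; apply: cvgM => //; exact: cvg_cst.
  apply: (squeeze_cvgr _ (cvg_cst 0) c3); apply: nearW => n; rewrite (hnorm_ge0 gauss) /=.
  have -> : T h - T (h_ n) = - 2 *: (G (x + h) - G (x + h_ n)) + (G (x + 2 *: h) - G (x + 2 *: h_ n)).
    rewrite /T opprD addrACA subrr addr0 opprD addrACA addrC; congr (_ + _).
    by rewrite scalerBr !scaleNr.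
  have [_ le] := in_CM_lin gauss (- 2) (in_CMB gauss (GCM (x + h)) (GCM (x + h_ n)))
    (in_CMB gauss (GCM (x + 2 *: h)) (GCM (x + 2 *: h_ n))).
  by apply: le_trans le _; rewrite normrN ger0_norm// addrC.
have c4 := hnorm_cvg gauss (TCM h) (fun n => TCM (h_ n)) cT.
have c5 : 88 * M * hnrm (h_ n) @[n --> \oo] --> 88 * M * hnrm h.
  by apply: cvgM; [exact: cvg_cst|exact: hnorm_cvg].
apply: (ler_cvg_to c4 c5); apply: nearW => n.
have [_ ->] := represents_hnorm gauss (dl n) (hl n).
exact: second_difference_rep.
Qed.

Lemma gradient_first_order x h : in_CM gamma h ->
  `|OU_resolvent gamma lam f (x + h) - OU_resolvent gamma lam f x - hinner gamma (G x) h|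
  <= 6 * M * (16 + lam^-1) * (hnrm h * Num.sqrt (hnrm h)).
Proof.
move=> hCM; have [l_ [h_ [dl hl hnCM ch]]] := in_CM_approx_seq sepX gauss hCM.
have cX := in_CM_seq_cvg hCM hnCM ch.
have cX1 : x + h_ n @[n --> \oo] --> x + h by apply: cvgD => //; exact: cvg_cst.
have cu := OU_resolvent_cvg cX1.
have cn := hnorm_cvg gauss hCM hnCM ch.
have c0 : hnrm (G x - G x) @[_ --> \oo] --> (0 : R).
  by rewrite subrr (in_CM0 gauss).2; exact: cvg_cst.
have ci := hinner_cvg gauss (GCM x) hCM (fun _ : nat => GCM x) hnCM c0 ch.
have c1 : `|u (x + h_ n) - u x - hinner gamma (G x) (h_ n)| @[n --> \oo] -->
    `|u (x + h) - u x - hinner gamma (G x) h|.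
  by apply: cvg_norm; apply: cvgB; [apply: cvgB; [exact: cu|exact: cvg_cst]|exact: ci].
have c2 : 6 * M * (16 + lam^-1) * (hnrm (h_ n) * Num.sqrt (hnrm (h_ n))) @[n --> \oo] -->
    6 * M * (16 + lam^-1) * (hnrm h * Num.sqrt (hnrm h)).
  by apply: cvgM; [exact: cvg_cst|apply: cvgM => //; exact: cvg_sqrt_comp].
apply: (ler_cvg_to c1 c2); apply: nearW => n /=.
rewrite (hinner_represents sepX gauss (GCM x) (dl n) (hl n)).
have [_ ->] := represents_hnorm gauss (dl n) (hl n).
exact: first_order_rep.
Qed.

Lemma gradient_continuous x e : 0 < e ->
  exists d, 0 < d /\ forall y, `|y - x| < d -> hnrm (G y - G x) < e.
Proof.
move=> e0; apply: contrapT => nd.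
have bad n : exists y, `|y - x| < n.+1%:R^-1 /\ e <= hnrm (G y - G x).
  apply: contrapT => ny; apply: nd; exists n.+1%:R^-1; split; first by rewrite invr_gt0.
  by move=> y yx; rewrite ltNge; apply/negP => ey; apply: ny; exists y.
have [y_ yP] := choice bad.
have cy : y_ n @[n --> \oo] --> x.
  apply/cvgrPdist_lt => d d0; have := near_invS_lt d0; apply: filterS => n.
  by apply: lt_trans; rewrite distrC; have [] := yP n.
have /cvgrPdist_lt/(_ e e0)[n _ /(_ n (leqnn n))] := gradient_cvg cy.
rewrite sub0r normrN (ger0_norm (hnorm_ge0 gauss _)) -(hnormN gauss (in_CMB gauss (GCM x) (GCM _))).
by rewrite opprB ltNge => /negP; apply; have [] := yP n.
Qed.

Lemma gradient_at x : H_gradient_at gamma (OU_resolvent gamma lam f) x (G x).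
Proof.
split=> // e e0.
(* The summand 1 keeps [A] positive when [M = 0]. Once the square root of the H-norm of [h] is at
   most [e / A], the remainder of order 3/2 is at most [e] times that norm. *)
pose A := 6 * M * (16 + lam^-1) + 1.
have A0 : 0 <= 6 * M * (16 + lam^-1) by rewrite !mulr_ge0// addr_ge0// invr_ge0 ltW.
have A1 : 0 < A by rewrite ltr_wpDl.
exists ((e / A) ^+ 2); split; first by rewrite exprn_gt0// divr_gt0.
move=> h hCM _ hd; apply: le_trans (gradient_first_order x hCM) _.
have n0 := hnorm_ge0 gauss h.
rewrite mulrCA [leRHS]mulrC; apply: ler_wpM2l => //.
have sA : Num.sqrt (hnrm h) <= e / A.
  have eA : 0 <= e / A by rewrite divr_ge0 ?ltW.
  by rewrite -[leRHS](ger0_norm eA) -sqrtr_sqr ler_wsqrtr// ltW.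
apply: le_trans (ler_wpM2l A0 sA) _; rewrite mulrA ler_pdivrMr// mulrC ler_wpM2l ?(ltW e0)//.
by rewrite /A lerDl.
Qed.

End OUResolventGradient.

Theorem mainTheorem2 (R : realType) (X : completeNormedModType R)
  (gamma : probability (borel X) R) :
  separable_space X -> centered_gaussian gamma ->
  forall lam : R, 0 < lam ->
  exists C : R, 0 < C /\
  forall f : X -> R, Cb f ->
    exists G : X -> X,
      (forall x : X, H_gradient_at gamma (OU_resolvent gamma lam f) x (G x)) /\
      in_ZH gamma G /\
      (ZH_norm gamma G <= C%:E * sup_norm f)%E.
Proof.
(* [8 + lam^-1] bounds the supremum of the gradient and 88 its Zygmund seminorm; the constant
   depends on [lam] alone. *)
move=> sepX gauss lam lam0; exists (8 + lam^-1 + 88).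
have C0 : 0 < 8 + lam^-1 :> R by rewrite addr_gt0// invr_gt0.
split; first by rewrite addr_gt0.
move=> f [cf [M' fM']].
have sle : (sup_norm f <= M'%:E)%E.
  by apply: ge_ereal_sup => _ [x _ <-]; rewrite lee_fin.
have sge : (0 <= sup_norm f)%E.
  apply: (@le_trans _ _ (`|f 0|)%:E); first by rewrite lee_fin.
  by apply: ereal_sup_ubound; exists 0.
have sfin : sup_norm f \is a fin_num by rewrite ge0_fin_numE// (le_lt_trans sle)// ltry.
(* The estimates are run with the supremum norm itself and not with the arbitrary bound [M'], so
   that the final inequality involves [sup_norm f]. *)
pose M := fine (sup_norm f).
have M0 : 0 <= M by exact: fine_ge0.
have ME : sup_norm f = M%:E by rewrite fineK.
have fM x : `|f x| <= M.
  by rewrite -lee_fin -ME; apply: ereal_sup_ubound; exists x.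
have [G GE] := Gam_represented sepX gauss lam0 cf fM.
have gb := gradient_bound gauss lam0 cf fM GE.
exists G.
have supG : (ZH_sup gamma G <= ((8 + lam^-1) * M)%:E)%E.
  by apply: ge_ereal_sup => _ [x _ <-]; rewrite lee_fin; have [] := gb x.
have semiG : (ZH_semi gamma G <= (88 * M)%:E)%E.
  apply: ge_ereal_sup => _ [x [h [hCM [h0 ->]]]]; rewrite lee_fin.
  (* By the continuous embedding into [X], [h != 0] has a positive H-norm, so the denominator in
     [ZH_semi] is genuine. *)
  have [K K0 HK] := norm_le_hnorm gauss.
  have hn : 0 < hnorm gamma h.
    have : 0 < K * hnorm gamma h by apply: lt_le_trans (HK _ hCM); rewrite normr_gt0.
    by rewrite pmulr_rgt0.
  rewrite ler_pdivrMr//; exact: (gradient_second_difference sepX gauss lam0 cf fM GE x hCM).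
split; first by move=> x; exact: (gradient_at sepX gauss lam0 cf fM GE x).
split.
  split; first by move=> x; have [] := gb x.
  split; first by move=> x e e0; exact: (gradient_continuous gauss lam0 cf fM GE x e0).
  by split; [apply: le_lt_trans supG _|apply: le_lt_trans semiG _]; rewrite ltry.
apply: le_trans (leeD supG semiG) _.
by rewrite ME -EFinD -EFinM lee_fin -mulrDl.
Qed.
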